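(* Let $G$ be a finite group, $\ell$ a prime with $\ell\mid|G|$, $Q$ a Sylow $\ell$-subgroup of $G$ and $M\lneq G$ a proper subgroup. Let $\mathcal H\le\mathcal G$ be a subgroup, and let $\mathfrak G\subseteq\mathrm{Irr}(G)$ and $\mathfrak M\subseteq\mathrm{Irr}(M)$. Assume all of the following: (i) There exist a group $\check G$ with $G\lhd\check G$ and a finite group $E$ such that $\check G\rtimes E$ is defined, $\check G/G$ is abelian, $\mathrm C_{\check G\rtimes E}(G)=\mathrm Z(\check G)\mathrm C_E(G)$, $G\lhd\check G\rtimes E$, and $\mathfrak G$ and $\mathfrak M$ are $\mathcal H\times\mathrm N_{\check G}(M)$-stable. (ii) $M$ is $(\check G\rtimes E)_Q$-stable and $\mathrm N_G(Q)\le M\lneq G$. (iii) Maximal extendibility holds with respect to $G\lhd\check G$ and $M\lhd\check M:=\mathrm N_{\check G}(M)$ for $\mathfrak G$ and $\mathfrak M$, respectively. (iv) For $\hat M:=\mathrm N_{GE}(M)$ there exist $\hat M$-stable $\check M$-transversals $\mathfrak G_0$ in $\mathfrak G$ and $\mathfrak M_0$ in $\mathfrak M$. Additionally there exist $\hat M$-equivariant extension maps $\Phi_{glo}$ and $\Phi_{loc}$ with respect to $G\lhd GE$ for $\mathfrak G_0$ and with respect to $M\lhd\hat M$ for $\mathfrak M_0$, such that $\mathrm{Irr}(\mathrm C_E(G)\mid\Phi_{glo}(\chi))=\mathrm{Irr}(\mathrm C_E(G)\mid\Phi_{loc}(\psi))$ for every $\chi\in\mathfrak G_0$ and $\psi\in\mathfrak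 M_0$. (v) There exists a subgroup $B\le\check GE\times\mathcal H$ with $\mathrm N_{\check GE}(Q)B=\mathrm N_{\check GE}(Q)\times\mathcal H$ that stabilizes $\mathfrak G_0$ and $\mathfrak M_0$. (vi) For $\check{\mathfrak M}:=\mathrm{Irr}(\check M\mid\mathfrak M)$ and $\check{\mathfrak G}:=\mathrm{Irr}(\check G\mid\mathfrak G)$ there exists an $\mathrm{Irr}(\check M/M)\rtimes(\hat MB)$-equivariant bijection $\check\Omega:\check{\mathfrak G}\to\check{\mathfrak M}$ with $\check\Omega(\check{\mathfrak G}\cap\mathrm{Irr}(\check G\mid\nu))=\check{\mathfrak M}\cap\mathrm{Irr}(\check M\mid\nu)$ for every $\nu\in\mathrm{Irr}(\mathrm Z(\check G))$. (vii) The group $B$ normalizes $\hat M$ and $[\Phi_{glo}(\chi),\alpha]|_{\hat M_\chi}=[\Phi_{loc}(\psi),\alpha]$ for every $\alpha\in(\hat MB)_\psi$ and $\chi\in\mathfrak G_0$, where $\psi\in\mathfrak M_0$ is such that $\check\Omega(\mathrm{Irr}(\check G\mid\chi))=\mathrm{Irr}(\check M\mid\psi)$. Then there exists an $\hat M\check M\times\mathcal H$-equivariant bijection $\Omega:\mathfrak G\to\mathfrak M$ such that, for every $\chi\in\mathfrak G$ and $\psi:=\Omega(\chi)$, $$((\check GE)_\chi,G,\chi)\ge_c((\check M\hat M)_\psi,M,\psi)$$ and, additionally, $$((\check GE)_{\chi^{\mathcal H}},G,\chi)_{\mathcal H}\ge_c((\check M\hat M)_{\psi^{\mathcal H}},M,\psi)_{\mathcal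 H}.$$
   Context: $\mathbb Q^{\mathrm{ab}}$ is the field generated over $\mathbb Q$ by all roots of unity in $\mathbb C$ and $\mathcal G:=\mathrm{Gal}(\mathbb Q^{\mathrm{ab}}/\mathbb Q)$, acting on the set $\mathrm{Irr}(X)$ of irreducible complex characters of a finite group $X$ via values. If $G\lhd A$, then $\mathcal G\times\mathrm{Aut}(A)_G$ and $\mathcal G\times A$ act on $\mathrm{Irr}(G)$. For $X\le Y$, $\mathrm{Irr}(Y\mid\mathfrak X)$ (for $\mathfrak X\subseteq\mathrm{Irr}(X)$, or a single character of $X$) is the set of irreducible characters of $Y$ having a constituent in $\mathfrak X$ on restriction to $X$, and $\mathrm{Irr}(X\mid\theta)$ (for a character $\theta$ of $Y$) is the set of irreducible constituents of the restriction of $\theta$ to $X$. Subscripts denote stabilizers. A $Y$-transversal is a set containing exactly one element of each $Y$-orbit. Linear characters of $\check M/M$ act by multiplication on $\mathrm{Irr}(\check M)$, and on $\mathrm{Irr}(\check G)$ via $\check M/M\cong\check G/G$. For $G\lhd A$ and $\mathfrak X\subseteq\mathrm{Irr}(G)$, an extension map with respect to $G\lhd A$ for $\mathfrak X$ is a map $\Lambda:\mathfrak X\to\bigcup_{G\le I\le A}\mathrm{Irr}(I)$ such that $\Lambda(\chi)$ is an extension of $\chi$ to $A_\chi$ for all $\chi\in\mathfrak X$; maximal extendibility holds with respect to $G\lhd A$ for $\mathfrak X$ if such a map exists. If $G\lhd A$, $\alpha\in\mathcal G\times\mathrm{Aut}(A)_G$ fixes $\chi\in\mathrm{Irr}(G)$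 and $\tilde\chi\in\mathrm{Irr}(A)$ extends $\chi$, then $[\tilde\chi,\alpha]$ is the unique linear character $\mu$ of $A$ with $G\le\ker\mu$ and $\tilde\chi^\alpha=\tilde\chi\mu$. If $\mathcal P$ is a projective representation of $A$ (with entries in $\mathbb Q^{\mathrm{ab}}$) associated to $\chi$, then $\mathcal P^\alpha$ is similar to $\mu\mathcal P$ for a unique map $\mu:A/G\to\mathbb C^\times$, denoted $[\mathcal P,\alpha]$. Let $G\lhd A$, $\chi\in\mathrm{Irr}(G)$ be $A$-invariant, $H\le A$ with $A=GH$, $\mathrm C_A(G)\le H$, $M:=G\cap H$, and $\psi\in\mathrm{Irr}(M)$ be $H$-invariant. Write $(A,G,\chi)\ge_c(H,M,\psi)$ if there exist projective representations $\mathcal P$ of $A$ associated to $\chi$ and $\mathcal P'$ of $H$ associated to $\psi$ such that the factor set of $\mathcal P$ restricted to $H\times H$ is the factor set of $\mathcal P'$, and for every $c\in\mathrm C_A(G)$ the matrices $\mathcal P(c)$, $\mathcal P'(c)$ are scalar matrices with the same scalar; $(\mathcal P,\mathcal P')$ is said to give the relation. $\chi^{\mathcal H}$ denotes the sum of the $\mathcal H$-conjugates of $\chi$; $(A,G,\chi)_{\mathcal H}$ is an $\mathcal H$-triple if $G\lhd A$ and $\chi^{\mathcal H}$ is $A$-invariant. For $\mathcal H$-triples with $A=GH$, $\mathrm C_A(G)\le H$, $M=G\cap H$, write $(A,G,\chi)_{\mathcal H}\ge_c(H,M,\psi)_{\mathcal H}$ if $(H\times\mathcal H)_\chi=(H\times\mathcal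 H)_\psi$ and there is $(\mathcal P,\mathcal P')$ giving $(A_\chi,G,\chi)\ge_c(H_\psi,M,\psi)$ with $[\mathcal P,\alpha](h)=[\mathcal P',\alpha](h)$ for all $h\in H_\psi$ and $\alpha\in(H\times\mathcal H)_\psi$. *)

(* Defs.v *)
From HB Require Import structures.
From mathcomp Require Import all_boot all_order all_algebra all_fingroup.
From mathcomp Require Import all_solvable all_field all_character.
From mathcomp Require Import boolp classical_sets functions.

Set Implicit Arguments.
Unset Strict Implicit.
Unset Printing Implicit Defensive.

Import Order.TTheory GRing.Theory Num.Theory GroupScope.

Local Open Scope classical_set_scope.
Local Open Scope ring_scope.

(* The smallest subfield of algC containing all roots of unity.               *)
Definition Qab : {pred algC} := fun x =>
  `[< forall S : {pred algC}, divring_closed S ->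
        (forall (n : nat) (z : algC), (0 < n)%N -> n.-unity_root z -> z \in S) ->
        x \in S >].

Fact Qab_divring_closed : divring_closed Qab.
Proof.
split=> [|x y /asboolP Sx /asboolP Sy|x y /asboolP Sx /asboolP Sy];
  apply/asboolP=> S clS unS; case: (clS) => S1 SB SV //.
- by apply: SB; [apply: Sx | apply: Sy].
- by apply: SV; [apply: Sx | apply: Sy].
Qed.
HB.instance Definition _ :=
  GRing.isDivringClosed.Build algC Qab Qab_divring_closed.

Record qab : predArgType := QabVal { qab_val :> algC; _ : qab_val \in Qab }.
HB.instance Definition _ := [isSub for qab_val].
HB.instance Definition _ := [Choice of qab by <:].
HB.instance Definition _ := [SubChoice_isSubIntegralDomain of qab by <:].
HB.instance Definition _ := [SubIntegralDomain_isSubField of qab by <:].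

(* Every field automorphism fixes the prime field Q, so no condition on Q is  *)
(* needed.                                                                    *)
Record galQab : predArgType := GalQab {
  galQab_fun :> {rmorphism qab -> qab};
  galQab_bij : bijective galQab_fun
}.

HB.instance Definition _ := gen_eqMixin galQab.
HB.instance Definition _ := gen_choiceMixin galQab.

Lemma galQabP (s t : galQab) : s =1 t -> s = t.
Proof.
case: s t => [[f cf] bf] [[g cg] bg] /= /funext efg.
subst g; have -> : cf = cg.
  case: cf cg {bf bg} => [[a] [b]] [[c] [d]].
  by rewrite (Prop_irrelevance a c) (Prop_irrelevance b d).
by rewrite (Prop_irrelevance bf bg).
Qed.

Definition galQab_one : galQab := @GalQab idfun (Bijective (frefl _) (frefl _)).

(* The product is "s, then t", so that galQab acts on the right.              *)
Definition galQab_mul (s t : galQab) : galQab :=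
  @GalQab (t \o s) (bij_comp (galQab_bij t) (galQab_bij s)).

Fact galQab_inv_exists (s : galQab) :
  exists t : galQab, cancel s t /\ cancel t s.
Proof.
have [g sK gK] := galQab_bij s.
have gB : zmod_morphism g by apply: can2_zmod_morphism sK gK.
have gM : monoid_morphism g by apply: can2_monoid_morphism sK gK.
pose gm := GRing.isMonoidMorphism.Build _ _ g gM.
pose ga := GRing.isZmodMorphism.Build _ _ g gB.
pose gR : {rmorphism qab -> qab} := HB.pack g ga gm.
by exists (@GalQab gR (Bijective gK sK)).
Qed.
Definition galQab_inv (s : galQab) : galQab := sval (cid (galQab_inv_exists s)).

Fact galQab_mulA : associative galQab_mul.
Proof. by move=> s t u; apply: galQabP. Qed.
Fact galQab_mul1 : left_id galQab_one galQab_mul.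
Proof. by move=> s; apply: galQabP. Qed.
Fact galQab_1mul : right_id galQab_one galQab_mul.
Proof. by move=> s; apply: galQabP. Qed.
Fact galQab_mulV : left_inverse galQab_one galQab_inv galQab_mul.
Proof.
move=> s; apply: galQabP => x /=; rewrite /galQab_inv; case: cid => t [/= sK tK].
exact: tK.
Qed.
Fact galQab_Vmul : right_inverse galQab_one galQab_inv galQab_mul.
Proof.
move=> s; apply: galQabP => x /=; rewrite /galQab_inv; case: cid => t [/= sK tK].
exact: sK.
Qed.
HB.instance Definition _ := isGroup.Build galQab
  galQab_mulA galQab_mul1 galQab_1mul galQab_mulV galQab_Vmul.

(* s : galQab as a function on algC; it is only meaningful on Qab, and is 0   *)
(* elsewhere.                                                                 *)
Definition galC (s : galQab) (x : algC) : algC := val (s (insubd 0 x)).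

Fact galC0 (s : galQab) : galC s 0 = 0.
Proof. by rewrite /galC -[X in insubd 0 X]/(val (0 : qab)) valKd rmorph0. Qed.

(* The direct product gT x Gal(Q^ab/Q).  An alias is used because prod        *)
(* already carries a group structure, for finite factors only.                *)
Definition gal_prod (gT : finGroupType) : Type := (gT * galQab)%type.

Section GalProd.
Variable gT : finGroupType.
HB.instance Definition _ := Choice.on (gal_prod gT).
Implicit Types a b c : gal_prod gT.

Definition gal_prod_one : gal_prod gT := (1%g, 1%g).
Definition gal_prod_mul a b : gal_prod gT := ((a.1 * b.1)%g, (a.2 * b.2)%g).
Definition gal_prod_inv a : gal_prod gT := ((a.1^-1)%g, (a.2^-1)%g).

Fact gal_prod_mulA : associative gal_prod_mul.
Proof. by move=> a b c; rewrite /gal_prod_mul !mulgA. Qed.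
Fact gal_prod_mul1 : left_id gal_prod_one gal_prod_mul.
Proof. by case=> x s; rewrite /gal_prod_mul /= !mul1g. Qed.
Fact gal_prod_1mul : right_id gal_prod_one gal_prod_mul.
Proof. by case=> x s; rewrite /gal_prod_mul /= !mulg1. Qed.
Fact gal_prod_mulV : left_inverse gal_prod_one gal_prod_inv gal_prod_mul.
Proof. by case=> x s; rewrite /gal_prod_mul /= !mulVg. Qed.
Fact gal_prod_Vmul : right_inverse gal_prod_one gal_prod_inv gal_prod_mul.
Proof. by case=> x s; rewrite /gal_prod_mul /= !mulgV. Qed.
HB.instance Definition _ := isGroup.Build (gal_prod gT) gal_prod_mulA
  gal_prod_mul1 gal_prod_1mul gal_prod_mulV gal_prod_Vmul.
End GalProd.

Definition subgroup (T : groupType) (S : set T) : Prop :=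
  group_closed [pred x | x \in S].

Definition dprod_set (gT : finGroupType) (A : {set gT}) (HH : set galQab) :
  set (gal_prod gT) := [set a | a.1 \in A /\ HH a.2].

(* The product set (X x 1) B.                                                 *)
Definition mul_set (gT : finGroupType) (X : {set gT}) (B : set (gal_prod gT)) :
  set (gal_prod gT) :=
  [set a | exists2 x, x \in X & exists2 b, B b & a = ((x, 1%g) * b)%g].

Definition cfGal (gT : finGroupType) (B : {set gT}) (s : galQab) (phi : 'CF(B)) :
  'CF(B) := cfun_comp (galC0 s) phi.

(* phi^(y, s)(x) = s (phi (x ^ y^-1)) for y in 'N(B)                          *)
Definition cfact (gT : finGroupType) (B : {set gT}) (a : gal_prod gT)
  (phi : 'CF(B)) : 'CF(B) := cfGal a.2 (phi ^ a.1)%CF.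

Definition gal_stable (gT : finGroupType) (B : {set gT}) (S : set (gal_prod gT))
    (X : set 'CF(B)) : Prop :=
  forall a phi, S a -> X phi -> X (cfact a phi).

Definition conj_stable (gT : finGroupType) (B Y : {set gT}) (X : set 'CF(B)) :
  Prop := forall y phi, y \in Y -> X phi -> X (phi ^ y)%CF.

Definition transversal_in (gT : finGroupType) (B Y : {set gT})
    (X X0 : set 'CF(B)) : Prop :=
  X0 `<=` X /\
  forall phi, X phi ->
    exists! phi0, X0 phi0 /\ exists2 y, y \in Y & phi0 = (phi ^ y)%CF.

(* Irr(Y | XX) for XX a set of characters of X <= Y                           *)
Definition Irr_over (gT : finGroupType) (X Y : {group gT}) (XX : set 'CF(X)) :
  set 'CF(Y) :=
  [set theta | theta \in irr Y /\
     exists2 i : Iirr X, i \in irr_constt ('Res[X] theta) & XX 'chi_i].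

(* Irr(X | theta) for theta a character of Y >= X                             *)
Definition Irr_under (gT : finGroupType) (X Y : {group gT}) (theta : 'CF(Y)) :
  set 'CF(X) :=
  [set phi | exists2 i : Iirr X, i \in irr_constt ('Res[X] theta) & phi = 'chi_i].

Arguments Irr_over {gT X} Y XX.
Arguments Irr_under {gT} X {Y} theta.

(* An extension map is a total function here; its values off X are irrelevant.*)
Definition extension_map (gT : finGroupType) (G A : {group gT})
    (X : set 'CF(G)) (L : forall chi : 'CF(G), 'CF('I_A[chi])) : Prop :=
  forall chi, X chi -> L chi \in irr 'I_A[chi] /\ 'Res[G] (L chi) = chi.

Definition maximal_extendibility (gT : finGroupType) (G A : {group gT})
    (X : set 'CF(G)) : Prop :=
  exists L : forall chi : 'CF(G), 'CF('I_A[chi]), extension_map X L.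

(* L (chi ^ y) = (L chi) ^ y, stated pointwise since both sides live in       *)
(* 'CF('I_A[chi ^ y]) only up to the equality 'I_A[chi] :^ y = 'I_A[chi ^ y]. *)
Definition equivariant_extension_map (gT : finGroupType) (G A : {group gT})
    (Y : {set gT}) (X : set 'CF(G))
    (L : forall chi : 'CF(G), 'CF('I_A[chi])) : Prop :=
  forall chi y x, X chi -> y \in Y ->
    L (chi ^ y)%CF (x ^ y)%g = L chi x.

(* [theta, a]: the linear character mu of I with G <= ker mu and              *)
(* theta^a = theta mu (0 if there is none).                                   *)
Definition ext_bracket (gT : finGroupType) (G I : {group gT}) (theta : 'CF(I))
    (a : gal_prod gT) : 'CF(I) :=
  if [pick i : Iirr I | ('chi_i \is a linear_char) && (G \subset cfker 'chi_i)
                        && (cfact a theta == theta * 'chi_i)]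
  is Some i then 'chi_i else 0.

Arguments ext_bracket {gT} G {I} theta a.

(* The sum of the HH-conjugates of chi, each counted once.                    *)
Definition gal_orbit_sum (gT : finGroupType) (G : {group gT}) (HH : set galQab)
    (chi : 'CF(G)) : 'CF(G) :=
  \sum_(phi <- irr G | `[< exists2 s, HH s & phi = cfGal s chi >]) phi.

Definition proj_repr (gT : finGroupType) (A : {set gT}) (n : nat)
    (f : gT -> gT -> algC) (P : gT -> 'M[algC]_n) : Prop :=
  {in A, forall x, P x \in unitmx} /\
  {in A &, forall x y, P x *m P y = f x y *: P (x * y)%g}.

(* P is a projective representation associated to chi : its restriction to G  *)
(* is a representation affording chi and P is multiplicative on G x A, A x G. *)
Definition proj_assoc (gT : finGroupType) (A G : {group gT}) (chi : 'CF(G))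
    (n : nat) (P : gT -> 'M[algC]_n) : Prop :=
  (exists2 rG : mx_representation algC G n,
     {in G, forall g, rG g = P g} & cfRepr rG = chi) /\
  {in G & A, forall g x, P (g * x)%g = P g *m P x /\ P (x * g)%g = P x *m P g}.

(* (P, P') gives (A, G, chi) >=_c (H, M, psi).                                *)
Definition gives_gec (gT : finGroupType)
    (A G : {group gT}) (chi : 'CF(G)) (H M : {group gT}) (psi : 'CF(M))
    (n n' : nat) (P : gT -> 'M[algC]_n) (P' : gT -> 'M[algC]_n') : Prop :=
  [/\ proj_assoc A chi P, proj_assoc H psi P',
      exists f f' : gT -> gT -> algC,
        [/\ proj_repr A f P, proj_repr H f' P' & {in H &, f =2 f'}]
    & {in 'C_A(G), forall c, exists z : algC, P c = z%:M /\ P' c = z%:M}].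

Definition gec_groups (gT : finGroupType) (A G H M : {group gT}) : Prop :=
  [/\ G <| A, H \subset A, A :=: (G * H)%g, 'C_A(G) \subset H & M :=: G :&: H].

Definition gec_triples (gT : finGroupType)
    (A G : {group gT}) (chi : 'CF(G)) (H M : {group gT}) (psi : 'CF(M)) : Prop :=
  [/\ gec_groups A G H M, chi \in irr G, A \subset 'I[chi],
      psi \in irr M & H \subset 'I[psi]].

(* (A, G, chi) >=_c (H, M, psi)                                               *)
Definition gec (gT : finGroupType)
    (A G : {group gT}) (chi : 'CF(G)) (H M : {group gT}) (psi : 'CF(M)) : Prop :=
  gec_triples A chi H psi /\
  exists (n n' : nat) (P : gT -> 'M[algC]_n) (P' : gT -> 'M[algC]_n'),
    gives_gec A chi H psi P P'.

Definition proj_act (gT : finGroupType) (n : nat) (a : gal_prod gT)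
    (P : gT -> 'M[algC]_n) : gT -> 'M[algC]_n :=
  fun x => map_mx (galC a.2) (P (x ^ a.1^-1)%g).

(* mu = [P, a] for a projective representation P of A associated to a         *)
(* character of G; mu is a map on A / G.                                      *)
Definition is_proj_bracket (gT : finGroupType) (A G : {group gT}) (n : nat)
    (P : gT -> 'M[algC]_n) (a : gal_prod gT) (mu : gT -> algC) : Prop :=
  [/\ {in A, forall x, mu x != 0},
      {in A & G, forall x g, mu (x * g)%g = mu x}
    & exists2 T : 'M[algC]_n, T \in unitmx &
        {in A, forall x, proj_act a P x = mu x *: (invmx T *m P x *m T)}].

Definition H_triple (gT : finGroupType) (A G : {group gT}) (HH : set galQab)
    (chi : 'CF(G)) : Prop :=
  [/\ G <| A, chi \in irr G & A \subset 'I[gal_orbit_sum HH chi]].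

(* (A, G, chi)_HH >=_c (H, M, psi)_HH                                         *)
Definition gecH (gT : finGroupType) (HH : set galQab)
    (A G : {group gT}) (chi : 'CF(G)) (H M : {group gT}) (psi : 'CF(M)) : Prop :=
  [/\ H_triple A HH chi, H_triple H HH psi, gec_groups A G H M,
      forall a, dprod_set H HH a -> cfact a chi = chi <-> cfact a psi = psi
    & gec_triples 'I_A[chi]%G chi 'I_H[psi]%G psi /\
      exists (n n' : nat) (P : gT -> 'M[algC]_n) (P' : gT -> 'M[algC]_n'),
        [/\ {in 'I_A[chi], forall x, P x \is a mxOver Qab},
            {in 'I_H[psi], forall x, P' x \is a mxOver Qab},
            gives_gec 'I_A[chi]%G chi 'I_H[psi]%G psi P P'
          & forall a, dprod_set H HH a -> cfact a psi = psi ->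
              exists mu mu' : gT -> algC,
                [/\ is_proj_bracket 'I_A[chi]%G G P a mu,
                    is_proj_bracket 'I_H[psi]%G M P' a mu'
                  & {in 'I_H[psi], mu =1 mu'}]]].

(* Main.v *)
Require Import Defs.
From HB Require Import structures.
From mathcomp Require Import all_boot all_order all_algebra all_fingroup.
From mathcomp Require Import all_solvable all_field all_character.
From mathcomp Require Import boolp classical_sets functions.

Set Implicit Arguments.
Unset Strict Implicit.
Unset Printing Implicit Defensive.

Import Order.TTheory GRing.Theory Num.Theory GroupScope.

Local Open Scope classical_set_scope.
Local Open Scope ring_scope.

(** The characters of Gc above a given chi in GG form one orbit under
multiplication by linear characters of Gc / G, and the inertia group of chi in
Gc is the common kernel of the linear characters fixing a member of this orbit;
this is Clifford theory for an abelian quotient, available because chi extends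
to its inertia group ([lies_over_orbit], [inertia_lin_stab]).  The same holds
over M, and Gc = G Mc with M = G :&: Mc identifies the linear characters of
Gc / G with those of Mc / M.  Hence Omc maps the characters above chi in GG0
onto those above a single psi in MM0, and chi and psi have the same stabilizer
in Mc.  The resulting bijection from GG0 to MM0 therefore extends to an
Mc-equivariant one from GG to MM, and its equivariance under Mh B is inherited
from Omc.  By [defNB], Mc and Mh B together account for Mc Mh x HH.

For matched chi and psi in the transversals, the inertia group of chi in A is
X Y, where X and Y are the inertia groups in Gc and GE and X :&: Y = G.  On X
there is the Clifford correspondent of a character theta above chi, on Y the
extension given by Phi_glo; both extend chi.  Over Q^ab they are afforded by
representations D1 and D2 that coincide on G ([common_realization]), and
P (x y) = D1 x *m D2 y is then well defined.  By Schur's lemma, P is a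
projective representation whose factor set is given by the linear characters
by which elements of Y move the extension to X, and its bracket with an
automorphism a is given by the linear characters by which a moves the two
extensions ([glue_factor], [glue_bracket]).  The same construction applies to
psi, with the correspondent of Omc theta and with Phi_loc.  The linear
characters on the two sides agree: on X because Omc commutes both with linear
characters and with Mh B ([matched0_twist]), on Y by [Phi_bracket].  The scalars
on the centralizer of G agree since Omc preserves the characters of 'Z(Gc) lying
below and since Phi_glo and Phi_loc have the same constituents on 'C_E(G).  An
automorphism in Mc Mh x HH fixing psi is the product of an element of Mh B and
an element of the inertia group of psi in Mc; the latter changes both brackets
by the same quotient of values of the common factor set ([proj_bracket_mul]).
Conjugation by Mc carries everything from the transversals to all of GG and MM.

The brackets require matrices over Q^ab, hence Brauer's theorem that every
character is afforded over Q^ab ([char_realizable]).  It is reached without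
Brauer's induction theorem.  Characters of a group with an abelian normal
subgroup of p-power index are monomial, so they induce to realizable
characters; the ideal of virtual characters generated by the corresponding
permutation characters contains 1, since for every prime p and every g one of
these has a value at g prime to p.  Thus each character is a difference of
realizable ones, and realizable characters may be cancelled because
intertwiners exist over Q^ab as soon as they exist over the algebraic
numbers. *)

(** * Q^ab and its automorphisms *)

Lemma Qab_unity (n : nat) (z : algC) : (0 < n)%N -> n.-unity_root z -> z \in Qab.
Proof. by move=> n0 zn; apply/asboolP=> S _ unS; apply: unS zn. Qed.

Lemma galC_val (s : galQab) (x : qab) : galC s (val x) = val (s x).
Proof. by rewrite /galC valKd. Qed.

Lemma galC_M (s t : galQab) x : galC (s * t)%g x = galC t (galC s x).
Proof. by rewrite /galC valKd. Qed.

Lemma galC_1 x : x \in Qab -> galC 1%g x = x.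
Proof. by move=> xQ; rewrite /galC [LHS]insubdK. Qed.

Lemma galCB s : {in Qab &, {morph galC s : x y / x - y}}.
Proof.
move=> x y Qx Qy; rewrite -[x](insubdK (0 : qab) Qx) -[y](insubdK (0 : qab) Qy).
by rewrite -[X in galC s X]/(val (insubd (0 : qab) x - insubd 0 y)) !galC_val rmorphB.
Qed.

Lemma galCV s : {in Qab &, {morph galC s : x y / x / y}}.
Proof.
move=> x y Qx Qy; rewrite -[x](insubdK (0 : qab) Qx) -[y](insubdK (0 : qab) Qy).
have vE (a b : qab) : val a / val b = val (a / b).
  by rewrite rmorphM -(fmorphV (val : {rmorphism qab -> algC})).
by rewrite vE !galC_val fmorph_div /= vE.
Qed.

Lemma galC1 s : galC s 1 = 1.
Proof. by rewrite -[X in galC s X]/(val (1 : qab)) galC_val rmorph1. Qed.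

Lemma galCM s : {in Qab &, {morph galC s : x y / x * y}}.
Proof.
move=> x y Qx Qy; rewrite -[x](insubdK (0 : qab) Qx) -[y](insubdK (0 : qab) Qy).
by rewrite -[X in galC s X]/(val (insubd (0 : qab) x * insubd 0 y)) !galC_val rmorphM.
Qed.

Lemma galCX s n : {in Qab, {morph galC s : x / x ^+ n}}.
Proof.
move=> x Qx; elim: n => [|n IHn]; first exact: galC1.
by rewrite !exprS galCM ?rpredX // IHn.
Qed.

(** An automorphism of Q^ab acts on the N-th roots of unity by a power
coprime to N, and such a power map is induced by an automorphism of the
algebraic numbers. *)
Lemma galC_aut_unity s N : (0 < N)%N ->
  exists u : {rmorphism algC -> algC}, forall z, z ^+ N = 1 -> galC s z = u z.
Proof.
move=> N_gt0; have [z0 prz0] := C_prim_root_exists N_gt0.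
have Qz z : z ^+ N = 1 -> z \in Qab.
  by move=> zN; apply: (Qab_unity N_gt0); apply/unity_rootP.
have Qz0 := Qz _ (prim_expr_order prz0).
have galz t : exists k, galC t z0 = z0 ^+ k.
  have [k Dk] : {k : 'I_N | galC t z0 = z0 ^+ k}.
    apply: (prim_rootP prz0); by rewrite -galCX // (prim_expr_order prz0) galC1.
  by exists k.
have [k Dk] := galz s; have [j Dj] := galz s^-1%g.
have co_k_N : coprime k N.
  have: z0 ^+ (j * k) = z0 ^+ 1.
    rewrite exprM -Dj -galCX // -Dk -galC_M.
    by rewrite mulgV galC_1.
  move/eqP; rewrite (eq_prim_root_expr prz0) => /eqP jk1.
  apply/eqP; have := gcdn_modr N (j * k); rewrite jk1 gcdn_modr gcdn1.
  move=> /esym jkN; apply/eqP; rewrite -dvdn1 -jkN dvdn_gcd dvdn_gcdr.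
  by rewrite dvdn_mull ?dvdn_gcdl.
have [u Du] := Qn_aut_exists co_k_N; exists u => z zN.
have [i ->] := prim_rootP prz0 zN.
rewrite galCX // Dk rmorphXn /=; congr (_ ^+ _).
by rewrite Du // (prim_expr_order prz0).
Qed.

(** The numbers on which the action of s depends only on its action on the
N-th roots of unity, for some N, form a field containing all roots of unity. *)
Lemma Qab_level x : x \in Qab ->
  exists2 N, (0 < N)%N & forall s (u : {rmorphism algC -> algC}),
    (forall z, z ^+ N = 1 -> galC s z = u z) -> galC s x = u x.
Proof.
pose S : {pred algC} := fun x => `[< x \in Qab /\
  exists2 N, (0 < N)%N & forall s (u : {rmorphism algC -> algC}),
    (forall z, z ^+ N = 1 -> galC s z = u z) -> galC s x = u x >].
move/asboolP/(_ S) => Sx; suff: x \in S by case/asboolP.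
apply: Sx; last first.
  move=> n z n_gt0 zn; apply/asboolP; split; first exact: Qab_unity zn.
  by exists n => // s u; apply; apply/unity_rootP.
have both y z
   (Sy : exists2 N, (0 < N)%N & forall s (u : {rmorphism algC -> algC}),
    (forall z, z ^+ N = 1 -> galC s z = u z) -> galC s y = u y)
   (Sz : exists2 N, (0 < N)%N & forall s (u : {rmorphism algC -> algC}),
    (forall z, z ^+ N = 1 -> galC s z = u z) -> galC s z = u z) :
  exists2 N, (0 < N)%N & forall s (u : {rmorphism algC -> algC}),
    (forall z, z ^+ N = 1 -> galC s z = u z) -> galC s y = u y /\ galC s z = u z.
  have [[N N0 Ny] [P P0 Pz]] := (Sy, Sz); exists (N * P)%N; first by rewrite muln_gt0 N0.
  move=> s u su; split; [apply: Ny | apply: Pz] => t t1; apply: su.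
    by rewrite exprM t1 expr1n.
  by rewrite mulnC exprM t1 expr1n.
split=> [|y z /asboolP[Qy Ny] /asboolP[Qz Nz]|y z /asboolP[Qy Ny] /asboolP[Qz Nz]].
- apply/asboolP; split; first exact: rpred1.
  by exists 1%N => // s u _; rewrite galC1 rmorph1.
- apply/asboolP; split; first exact: rpredB.
  have [N N0 NE] := both y z Ny Nz; exists N => // s u /NE[yE zE].
  by rewrite galCB // yE zE rmorphB.
apply/asboolP; split; first exact: rpred_div.
have [N N0 NE] := both y z Ny Nz; exists N => // s u /NE[yE zE].
by rewrite galCV // yE zE fmorph_div.
Qed.

(** Only finitely many numbers occur in a given argument, so an automorphism
of Q^ab may be replaced there by one of all the algebraic numbers, to which
the theory of Galois-conjugate characters applies. *)
Lemma galC_aut s (xs : seq algC) : {subset xs <= Qab} ->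
  exists u : {rmorphism algC -> algC}, {in xs, galC s =1 u}.
Proof.
move=> Qxs; suff [N N0 NE]: exists2 N, (0 < N)%N & forall (u : {rmorphism algC -> algC}),
    (forall z, z ^+ N = 1 -> galC s z = u z) -> {in xs, galC s =1 u}.
  by have [u su] := galC_aut_unity s N0; exists u; apply: NE.
elim: xs Qxs => [|x xs IHxs] Qxs; first by exists 1%N.
have [|N N0 NE] := IHxs; first by move=> y xs_y; rewrite Qxs ?inE ?xs_y ?orbT.
have [|P P0 PE] := @Qab_level x; first by rewrite Qxs ?mem_head.
exists (N * P)%N => [|u su y]; first by rewrite muln_gt0 N0.
rewrite inE => /predU1P[->|xs_y].
  by apply: PE => z z1; apply: su; rewrite mulnC exprM z1 expr1n.
by apply: NE xs_y => z z1; apply: su; rewrite exprM z1 expr1n.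
Qed.

(** On the cyclic group generated by x a character is a sum of linear
characters, whose values are roots of unity. *)
Lemma char_Qab (gT : finGroupType) (G : {group gT}) (chi : 'CF(G)) x :
  chi \is a character -> chi x \in Qab.
Proof.
move=> Nchi; have [Gx | notGx] := boolP (x \in G); last by rewrite cfun0 ?rpred0.
have sXG : <[x]>%g \subset G by rewrite cycle_subG.
rewrite -(cfResE chi sXG (cycle_id x)).
have /char_sum_irr[r ->] : 'Res[<[x]>%G] chi \is a character by apply: cfRes_char.
rewrite sum_cfunE rpred_sum // => i _.
have Li : 'chi[<[x]>%G]_i \is a linear_char.
  by apply/char_abelianP; apply: cycle_abelian.
apply: (@Qab_unity #[x]%g) => //; apply/unity_rootP.
by rewrite -lin_charX // ?cycle_id // expg_order lin_char1.
Qed.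

(** * Representations over Q^ab *)

Section Average.

Variables (F : fieldType) (gT : finGroupType) (G : {group gT}).

Definition mx_average n1 n2 (r1 : mx_representation F G n1)
    (r2 : mx_representation F G n2) (E : 'M[F]_(n1, n2)) : 'M_(n1, n2) :=
  \sum_(g in G) r1 g^-1%g *m E *m r2 g.

Lemma mx_averageP n1 n2 (r1 : mx_representation F G n1)
    (r2 : mx_representation F G n2) E h : h \in G ->
  r1 h *m mx_average r1 r2 E = mx_average r1 r2 E *m r2 h.
Proof.
move=> Gh; rewrite /mx_average mulmx_sumr mulmx_suml.
rewrite [LHS](reindex_inj (mulIg h)) /=.
rewrite (eq_bigl (mem G)) => [|g]; last by rewrite groupMr.
apply: eq_bigr => g Gg; rewrite !mulmxA -repr_mxM ?groupV ?groupM // invMg mulKVg.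
by rewrite repr_mxM // -!mulmxA.
Qed.

(** The sum is the trace of the operator mx_average r1 r2, computed on the
elementary matrices; so some average of an elementary matrix is nonzero. *)
Lemma nonzero_intertwiner n1 n2 (r1 : mx_representation F G n1)
    (r2 : mx_representation F G n2) :
    \sum_(g in G) \tr (r1 g^-1%g) * \tr (r2 g) != 0 ->
  exists2 X : 'M[F]_(n1, n2), X != 0 & {in G, forall g, r1 g *m X = X *m r2 g}.
Proof.
move=> nz; suff: [exists i, exists j, mx_average r1 r2 (delta_mx i j) != 0].
  case/existsP=> i /existsP[j nzX]; exists (mx_average r1 r2 (delta_mx i j)) => //.
  by move=> g; apply: mx_averageP.
apply: contraR nz; rewrite negb_exists => /forallP av0.
rewrite (eq_bigr (fun g => \sum_i \sum_j r1 g^-1%g i i * r2 g j j)); last first.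
  by move=> g _; rewrite big_distrl; apply: eq_bigr => i _; rewrite big_distrr.
rewrite exchange_big big1 // => i _; rewrite exchange_big big1 // => j _.
have := av0 i; rewrite negb_exists => /forallP/(_ j); rewrite negbK => /eqP avE.
transitivity (mx_average r1 r2 (delta_mx i j) i j); last by rewrite avE mxE.
rewrite /mx_average summxE; apply: eq_bigr => g _.
by rewrite -(mul_delta_mx (0 : 'I_1)) mulmxA -mulmxA -rowE -colE !mxE big_ord1 !mxE.
Qed.

End Average.

Local Notation iota := (val : {rmorphism qab -> algC}).

Lemma natr_qab_neq0 n : (0 < n)%N -> n%:R != 0 :> qab.
Proof.
by move=> n0; rewrite -(fmorph_eq0 iota) rmorph_nat pnatr_eq0 -lt0n.
Qed.

Definition realizable (gT : finGroupType) (G : {group gT}) n (phi : 'CF(G)) :=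
  exists rG : mx_representation qab G n, cfRepr (map_repr iota rG) = phi.

Section Realizable.

Variables (gT : finGroupType) (G : {group gT}).

Lemma realizable0 : realizable 0 (0 : 'CF(G)).
Proof.
exists (grepr0 : representation qab G); apply/cfun_inP=> x Gx.
by rewrite cfunE Gx mulr1n /mxtrace big_ord0 cfunE.
Qed.

Lemma realizableE n (rG : mx_representation qab G n) x : x \in G ->
  cfRepr (map_repr iota rG) x = iota (\tr (rG x)).
Proof. by move=> Gx; rewrite cfunE Gx mulr1n -trace_map_mx. Qed.

Lemma realizableD n1 n2 (phi1 phi2 : 'CF(G)) :
  realizable n1 phi1 -> realizable n2 phi2 -> realizable (n1 + n2) (phi1 + phi2).
Proof.
move=> [r1 <-] [r2 <-]; exists (dadd_grepr (Representation r1) (Representation r2)).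
apply/cfun_inP=> x Gx; rewrite [RHS]cfunE !realizableE //.
by rewrite /= mxtrace_block; apply: (rmorphD iota).
Qed.

Lemma realizable_char n (phi : 'CF(G)) : realizable n phi -> phi \is a character.
Proof. by case=> rG <-; apply: cfRepr_char. Qed.

(** The image of an idempotent commuting with the action is a
subrepresentation; its matrices are obtained from a rank factorization. *)
Lemma realizable_idem n (rG : mx_representation qab G n) (e : 'M_n) :
    e *m e = e -> {in G, forall g, e *m rG g = rG g *m e} ->
  exists2 phi : 'CF(G), realizable (\rank e) phi &
    {in G, forall g, phi g = iota (\tr (e *m rG g))}.
Proof.
move=> ee eG; pose r := row_base e; pose c := col_base e.
have De : c *m r = e by apply: mulmx_base.
have rc : r *m c = 1%:M.
  apply: (row_free_inj (row_base_free e)); apply: (row_full_inj (col_base_full e)).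
  by rewrite mul1mx -[RHS]/(c *m r) -/r -/c -mulmxA (mulmxA c) De ee.
have re : r *m e = r by rewrite -[X in _ *m X]De mulmxA rc mul1mx.
have repD : mx_repr G (fun g => r *m rG g *m c).
  split=> [|g h Gg Gh]; first by rewrite repr_mx1 mulmx1.
  have -> : r *m rG (g * h)%g *m c = r *m e *m (rG g *m (rG h *m c)).
    by rewrite re repr_mxM // -!mulmxA.
  by rewrite -(mulmxA r) (mulmxA e) eG // -[X in _ *m X *m _]De -!mulmxA.
exists (cfRepr (map_repr iota (MxRepresentation repD))).
  by exists (MxRepresentation repD).
by move=> g Gg; rewrite realizableE //= mxtrace_mulC mulmxA De.
Qed.

(** Unless phi1 = 0, there is a nonzero intertwiner X over Q^ab between the
representations affording phi1 and phi2.  Averaging a partial inverse of X, as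
in Maschke's theorem, gives an intertwiner Y back with X Y X = X.  Then X Y and
Y X are idempotents cutting out isomorphic parts, and passing to their
complements lowers the degree of phi1. *)
Lemma realizable_cancel n1 n2 (phi1 phi2 chi : 'CF(G)) :
    realizable n1 phi1 -> realizable n2 phi2 -> chi \is a character ->
  chi + phi1 = phi2 -> exists n, realizable n chi.
Proof.
elim/ltn_ind: n1 n2 phi1 phi2 => [] [|n1] IHn n2 phi1 phi2 Rphi1 Rphi2 Nchi Dphi.
  case: Rphi1 => r1 Dphi1; exists n2; rewrite -(addr0 chi); congr realizable: Rphi2.
  rewrite -Dphi -Dphi1; congr (_ + _); apply/cfun_inP=> x Gx.
  by rewrite realizableE // /mxtrace big_ord0 rmorph0 cfunE.
have [Nphi1 Nphi2] := (realizable_char Rphi1, realizable_char Rphi2).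
case: Rphi1 Rphi2 => r1 Dphi1 [r2 Dphi2].
have: '[phi2, phi1] != 0.
  have nz1 : phi1 != 0.
    apply: contraTneq (ltn0Sn n1) => phi10.
    have := cfRepr1 (map_repr iota r1); rewrite Dphi1 phi10 cfunE.
    by move/esym/eqP; rewrite pnatr_eq0.
  rewrite -Dphi cfdotDl gt_eqF // ltr_wpDl ?cfnorm_gt0 //.
  by rewrite natr_ge0 ?Cnat_cfdot_char.
move=> nz; have [|X nzX hX] := @nonzero_intertwiner _ _ _ _ _ r1 r2.
  apply: contraNneq nz => s0; rewrite cfdotE.
  rewrite (eq_bigr (fun g => iota (\tr (r1 g^-1%g) * \tr (r2 g)))) => [|g Gg].
    by rewrite -rmorph_sum s0 rmorph0 mulr0.
  rewrite rmorphM -!realizableE ?groupV // Dphi1 Dphi2.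
  by rewrite (char_inv _ Nphi1) mulrC.
pose Y : 'M[qab]_(n2, n1.+1) := #|G|%:R^-1 *: mx_average r2 r1 (pinvmx X).
have hY : {in G, forall g, r2 g *m Y = Y *m r1 g}.
  by move=> g Gg; rewrite -scalemxAr -scalemxAl mx_averageP.
have XYX : X *m Y *m X = X.
  rewrite -scalemxAr -scalemxAl mulmx_sumr mulmx_suml.
  rewrite (eq_bigr (fun _ => X)) => [|g Gg].
    rewrite sumr_const -scaler_nat scalerA mulVf ?scale1r //.
    exact/natr_qab_neq0/cardG_gt0.
  have -> : X *m (r2 g^-1%g *m pinvmx X *m r1 g) *m X
          = r1 g^-1%g *m (X *m pinvmx X *m X) *m r2 g.
    by rewrite !mulmxA -hX ?groupV // -!mulmxA hX.
  by rewrite mulmxKpV // -mulmxA -hX // mulmxA -repr_mxM ?groupV // mulVg repr_mx1 mul1mx.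
have [e1 e2] : (X *m Y) *m (X *m Y) = X *m Y /\ (Y *m X) *m (Y *m X) = Y *m X.
  by rewrite mulmxA XYX -!mulmxA (mulmxA X Y X) XYX.
have c1 : {in G, forall g, X *m Y *m r1 g = r1 g *m (X *m Y)}.
  by move=> g Gg; rewrite mulmxA hX // -!mulmxA hY.
have c2 : {in G, forall g, Y *m X *m r2 g = r2 g *m (Y *m X)}.
  by move=> g Gg; rewrite mulmxA hY // -!mulmxA hX.
have f1 : (1%:M - X *m Y) *m (1%:M - X *m Y) = 1%:M - X *m Y.
  by rewrite mulmxBl mul1mx mulmxBr mulmx1 e1 subrr subr0.
have f2 : (1%:M - Y *m X) *m (1%:M - Y *m X) = 1%:M - Y *m X.
  by rewrite mulmxBl mul1mx mulmxBr mulmx1 e2 subrr subr0.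
have [|k1 Rk1 Dk1] := realizable_idem (rG := r1) f1.
  by move=> g Gg; rewrite mulmxBl mulmxBr mul1mx mulmx1 c1.
have [|k2 Rk2 Dk2] := realizable_idem (rG := r2) f2.
  by move=> g Gg; rewrite mulmxBl mulmxBr mul1mx mulmx1 c2.
apply: (IHn _ _ _ k1 k2 Rk1 Rk2 Nchi).
  rewrite ltn_neqAle rank_leq_row andbT; apply: contraNneq nzX => fr.
  have u1 : 1%:M - X *m Y \in unitmx by rewrite -row_free_unit /row_free fr.
  by rewrite -[X](mulKmx u1) mulmxBl mul1mx XYX subrr mulmx0.
apply/cfun_inP=> g Gg; rewrite cfunE Dk1 // Dk2 // !mulmxBl !mul1mx.
have tE : \tr (X *m Y *m r1 g) = \tr (Y *m X *m r2 g).
  by rewrite -mulmxA -hY // mulmxA mxtrace_mulC mulmxA.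
have /cfunP/(_ g) := Dphi; rewrite cfunE -Dphi1 -Dphi2 !realizableE // => Dg.
have trB m (S T : 'M[qab]_m) : \tr (S - T) = \tr S - \tr T by apply: raddfB.
by rewrite !trB tE !(rmorphB iota) addrA Dg.
Qed.

End Realizable.

(** * Characters induced from linear characters *)

Section InducedLinear.

Variables (gT : finGroupType) (G L : {group gT}) (lam : 'CF(L)).
Hypotheses (sLG : L \subset G) (Llam : lam \is a linear_char).

Let mxg (f : gT -> gT -> qab) : 'M[qab]_#|gT| :=
  \matrix_(i, j) f (enum_val i) (enum_val j).

Let mxgM f h : mxg f *m mxg h = mxg (fun x z => \sum_y f x y * h y z).
Proof.
apply/matrixP=> i k; rewrite !mxE [RHS](reindex (@enum_val gT predT)) /=.
  by apply: eq_bigr => j _; rewrite !mxE.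
by exists enum_rank => x _; rewrite ?enum_valK ?enum_rankK.
Qed.

Let mxg_tr f : \tr (mxg f) = \sum_x f x x.
Proof.
rewrite [RHS](reindex (@enum_val gT predT)) /=.
  by apply: eq_bigr => j _; rewrite !mxE.
by exists enum_rank => x _; rewrite ?enum_valK ?enum_rankK.
Qed.

Let eq_mxg f h : (forall x y, f x y = h x y) -> mxg f = mxg h.
Proof. by move=> fh; apply/matrixP=> i j; rewrite !mxE. Qed.

Let lq x : qab := insubd 0 (lam x).

Let val_lq x : val (lq x) = lam x.
Proof. by rewrite insubdK // char_Qab // lin_charW. Qed.

Let lq0 x : x \notin L -> lq x = 0.
Proof. by move=> Lx; apply: val_inj; rewrite val_lq cfun0. Qed.

Let lqM : {in L &, {morph lq : x y / (x * y)%g >-> x * y}}.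
Proof. by move=> x y Lx Ly; apply: val_inj; rewrite [RHS](rmorphM iota) /= !val_lq lin_charM. Qed.

(* Coordinates are indexed by all of gT.  The group G acts by right translation,
and e is left multiplication by the idempotent of lam; the factor (x \in G)
discards the coordinates outside G. *)
Let R g : 'M[qab]_#|gT| := mxg (fun x z => (x * g == z)%g%:R).

Let R_repr : mx_repr G R.
Proof.
split=> [|g h _ _].
  by apply/matrixP=> i j; rewrite !mxE mulg1 (inj_eq enum_val_inj).
rewrite mxgM; apply: eq_mxg => x z.
rewrite (bigD1 (x * g)%g) //= eqxx mul1r big1 ?addr0 ?mulgA // => y.
by rewrite eq_sym => /negPf->; rewrite mul0r.
Qed.

Let e : 'M[qab]_#|gT| :=
  mxg (fun x y => (x \in G)%:R * (#|L|%:R^-1 * lq (x * y^-1)%g)).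

Let e_idem : e *m e = e.
Proof.
rewrite mxgM; apply: eq_mxg => x z.
have [Gx | _] := boolP (x \in G); last first.
  by rewrite mul0r big1 // => y _; rewrite !mul0r.
rewrite mul1r (eq_bigl (fun y => true)) // (reindex_inj invg_inj) /=.
rewrite (reindex_inj (mulgI x^-1%g)) /= (bigID (mem L)) /= addrC.
rewrite big1 ?add0r => [|y Ly]; last first.
  by rewrite invgK mulKVg lq0 // mulr0 mulr0 mul0r.
transitivity (\sum_(y in L) #|L|%:R^-1 * #|L|%:R^-1 * lq (x * z^-1)%g).
  apply: eq_bigr => y Ly; rewrite invgK mulKVg mul1r invMg invgK.
  have Gy : y \in G := fintype.subsetP sLG y Ly.
  have -> : (y^-1 * x)%g \in G by rewrite groupM ?groupV.
  rewrite mul1r mulrACA -mulgA.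
  have [Lxz | Lxz] := boolP (x * z^-1 \in L)%g.
    by rewrite -lqM ?mulKVg // groupMl ?groupV.
  have Lyxz : (y^-1 * (x * z^-1))%g \notin L by rewrite groupMl ?groupV.
  by rewrite (lq0 Lxz) (lq0 Lyxz) !mulr0.
rewrite sumr_const -[LHS]mulr_natl !mulrA divff ?mul1r //.
exact/natr_qab_neq0/cardG_gt0.
Qed.

Let e_comm : {in G, forall g, e *m R g = R g *m e}.
Proof.
move=> g Gg; rewrite !mxgM; apply: eq_mxg => x z.
rewrite (bigD1 (z * g^-1)%g) //= mulgKV eqxx mulr1 big1 ?addr0 => [|y].
  rewrite (bigD1 (x * g)%g) //= eqxx mul1r big1 ?addr0 => [|y].
    by rewrite groupMr // invMg invgK mulgA.
  by rewrite eq_sym => /negPf->; rewrite mul0r.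
by rewrite -(inj_eq (mulIg g)) mulgKV => /negPf->; rewrite mulr0.
Qed.

(** The representation induced from a linear character lam of L is the
right ideal of the group algebra generated by the idempotent attached to lam. *)
Lemma realizable_Ind_lin : exists n, realizable n ('Ind[G] lam).
Proof.
have [phi Rphi Dphi] := realizable_idem (rG := MxRepresentation R_repr) e_idem e_comm.
exists (\rank e); suff <-: phi = 'Ind[G] lam by [].
apply/cfun_inP=> g Gg; rewrite Dphi //.
have -> : \tr (e *m R g) = #|L|%:R^-1 * \sum_(x in G) lq (g ^ x^-1)%g.
  rewrite mxgM mxg_tr (bigID (mem G)) /= addrC big1 ?add0r => [|x /negPf xG]; last first.
    by rewrite big1 // => y _; rewrite xG !mul0r.
  rewrite mulr_sumr; apply: eq_bigr => x Gx.
  rewrite (bigD1 (x * g^-1)%g) //= mulgKV eqxx mulr1 big1 ?addr0 => [|y].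
    by rewrite Gx mul1r invMg invgK conjgE invgK !mulgA.
  by rewrite -(inj_eq (mulIg g)) mulgKV => /negPf->; rewrite mulr0.
rewrite (rmorphM iota) (fmorphV iota) (rmorph_nat iota) (rmorph_sum iota) cfIndE //.
congr (_ * _); rewrite [RHS](reindex_inj invg_inj).
by apply: eq_big => [x | x Gx]; [rewrite groupV | apply: val_lq].
Qed.

End InducedLinear.

(** * Monomial characters *)

(** If C is central, then H / 'Z(H) is a nontrivial p-group, and the preimage of
a nontrivial cyclic subgroup of its center is abelian, being cyclic modulo a
central subgroup. *)
Lemma noncentral_abelian_normal (gT : finGroupType) (H C : {group gT}) (p : nat) :
    C <| H -> abelian C -> p.-nat #|H : C| -> ~~ abelian H ->
  exists N : {group gT}, [/\ N <| H, abelian N & ~~ (N \subset 'Z(H))%g].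
Proof.
move=> nsCH abC pHC nabH.
have [sCZ | nsCZ] := boolP (C \subset 'Z(H))%g; last by exists C.
have nsZH : 'Z(H)%g <| H := center_normal H.
have pHZ : p.-group (H / 'Z(H))%g.
  rewrite /pgroup card_quotient ?normal_norm //.
  by apply: pnat_dvd pHC; apply: indexgS.
have ntHZ : (H / 'Z(H))%g != 1%g.
  apply: contra nabH => /eqP/trivgP; rewrite quotient_sub1 ?normal_norm //.
  by move/fintype.subset_trans/(_ (finset.subsetIr _ _)).
have: 'Z(H / 'Z(H))%g != 1%g by rewrite center_nil_eq1 // (pgroup_nil pHZ).
case/trivgPn=> xb Zxb ntxb; have /centerP[Hxb cxb] := Zxb.
have nsX : (<[xb]> <| H / 'Z(H))%g.
  rewrite /normal cycle_subG Hxb; apply: cents_norm; rewrite centsC cycle_subG.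
  by have /finset.setIP[] := Zxb.
have [N defN sZN nsNH] := inv_quotientN nsZH nsX.
exists N; split=> //.
  apply: (cyclic_factor_abelian (H := 'Z(H)%G)); last by rewrite -defN cycle_cyclic.
  by rewrite finset.subsetI sZN (fintype.subset_trans (finset.subsetIr _ _)) ?centS ?normal_sub.
apply: contra ntxb => sNZ; have NZ1 : (N / 'Z(H))%g = 1%g.
  apply/trivgP; rewrite quotient_sub1 //.
  exact: fintype.subset_trans (normal_sub nsNH) (normal_norm nsZH).
have: xb \in (N / 'Z(H))%g by rewrite -defN cycle_id.
by rewrite NZ1 inE.
Qed.

(** A nonlinear faithful character restricted to a noncentral abelian normal
subgroup is not homogeneous, so Clifford theory induces it from a proper
subgroup.  Subgroups and quotients inherit the hypotheses. *)
Theorem abelian_by_pgroup_monomial (gT : finGroupType) (H C : {group gT}) (p : nat)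
    (i : Iirr H) :
    C <| H -> abelian C -> p.-nat #|H : C| ->
  exists (L : {group gT}) (lam : 'CF(L)),
    [/\ L \subset H, lam \is a linear_char & 'chi_i = 'Ind[H] lam].
Proof.
have [n leHn] := ubnP #|H|.
elim: n => // n IHn in gT H C i leHn * => nsCH abC pHC.
have [Li | nonLi] := boolP ('chi_i \is a linear_char).
  by exists H, 'chi_i; rewrite cfInd_id.
have [faith | nfaith] := eqVneq (cfker 'chi_i) 1%g; last first.
  pose K := cfker_group 'chi_i; have nsKH : K <| H := cfker_normal _.
  have sKi : K \subset cfker 'chi_i by [].
  have [||||Lb [lamb [sLbH Llamb Dquo]]] := IHn _ (H / K)%G (C / K)%G (quo_Iirr K i).
  - rewrite -ltnS (leq_trans _ leHn) // ltnS ltn_quotient ?normal_sub //.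
  - exact: quotient_normal.
  - exact: quotient_abelian.
  - apply: pnat_dvd pHC; apply: index_quotient.
    by rewrite finset.subIset // normal_norm.
  have [L defL sKL sLH] := inv_quotientS nsKH sLbH.
  have eLb : Lb = (L / K)%G by apply: val_inj.
  rewrite {}eLb in lamb Llamb Dquo {sLbH defL}.
  exists L, (lamb %% K)%CF; split=> //; first exact: cfMod_lin_char.
  rewrite -[LHS](cfQuoK nsKH sKi) -quo_IirrE // Dquo.
  by apply: esym; apply: cfIndMorph; rewrite ?ker_coset ?normal_norm.
have nabH : ~~ abelian H.
  by apply: contra nonLi => /char_abelianP/(_ i).
have [N [nsNH abN nNZ]] := noncentral_abelian_normal nsCH abC pHC nabH.
have [t it] := constt_cfRes_irr N i.
have sNH := normal_sub nsNH.
have Lt : 'chi_t \is a linear_char by apply/char_abelianP.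
pose T := 'I_H['chi_t]%G.
have sTH : T \subset H := Inertia_sub _ _.
have [sHT | prT] := boolP (H \subset T).
  case/negP: nNZ; rewrite -(@cfcenter_fful_irr _ _ i) ?/cfaithful ?faith //.
  have tI : H \subset 'I['chi_t] by apply: fintype.subset_trans sHT (finset.subsetIr _ _).
  apply/fintype.subsetP=> x Nx; rewrite /cfcenter irr_char inE.
  rewrite (fintype.subsetP sNH) //=.
  have Di := Clifford_Res_sum_cfclass nsNH it; rewrite cfclass_invariant // big_seq1 in Di.
  have De y : y \in N -> 'chi_i y = '['Res[N] 'chi_i, 'chi_t] * 'chi_t y.
    by move=> Ny; rewrite -(cfResE _ sNH Ny) Di cfunE -Di.
  rewrite (De x) // (De 1%g) // lin_char1 // mulr1 normrM normC_lin_char // mulr1.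
  rewrite ger0_norm // natr_ge0 // Cnat_cfdot_char ?irr_char //.
  by rewrite cfRes_char ?irr_char.
have [indI _ surjI _ _] := constt_Inertia_bijection t nsNH.
have: i \in irr_constt ('Ind[H] 'chi_t) by rewrite constt_Ind_Res.
rewrite -surjI => /imsetP[s cs Ds].
have Di : 'chi_i = 'Ind[H] 'chi_s by rewrite Ds cfIirrE // indI.
have [||||L [lam [sLT Llam Dlam]]] := IHn _ T (T :&: C)%G s.
- by rewrite -ltnS (leq_trans _ leHn) // ltnS proper_card // properE sTH.
- exact: (normalGI sTH nsCH).
- exact: abelianS (finset.subsetIr _ _) abC.
- rewrite indexgI; apply: pnat_dvd pHC.
  have nCT : T \subset 'N(C) by apply: fintype.subset_trans sTH (normal_norm nsCH).
  rewrite -indexMg -norm_joinEr //; apply: indexSg; first exact: joing_subl.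
  by rewrite join_subG normal_sub.
exists L, lam; split=> //; first exact: fintype.subset_trans sLT sTH.
by rewrite Di Dlam cfIndInd.
Qed.

(** * Values of permutation characters *)

(** Let C be generated by the p'-part of g and N be the normalizer of C in G, and
let H be generated by C and a Sylow p-subgroup of N.  The value to be found is the
number of cosets of H fixed by g.  All of these lie in N, where C acts
trivially, so modulo p their number is the index of H in N. *)
Lemma Ind1_pprime_value (gT : finGroupType) (G : {group gT}) g (p : nat) :
    g \in G -> prime p ->
  exists H C : {group gT},
    [/\ H \subset G, C <| H, abelian C, p.-nat #|H : C|
      & exists2 n, ('Ind[G, H] 1) g = n%:R & ~~ (p %| n)%N].
Proof.
move=> Gg pr_p; pose z := g.`_p; pose w := g.`_p^'.
pose C := <[w]>%G; pose N := 'N_G(C)%G.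
have [P sylP] := Sylow_exists p N; have [sPN pP hallP] := and3P sylP.
have nCP : P \subset 'N(C) := fintype.subset_trans sPN (finset.subsetIr _ _).
have sNG : N \subset G := finset.subsetIl _ _.
have Gw : w \in G by rewrite groupX.
have sCN : C \subset N by rewrite finset.subsetI cycle_subG Gw normG.
pose H := (C <*> P)%G.
have defH : H :=: (C * P)%g by apply: norm_joinEr.
have sHN : H \subset N by rewrite join_subG sCN.
have sHG := fintype.subset_trans sHN sNG.
have nsCH : C <| H by rewrite /normal joing_subl join_subG normG.
have pHC : p.-nat #|H : C|.
  by rewrite defH indexMg; apply: pnat_dvd (dvdn_indexg _ _) pP.
exists H, C; split=> //; first exact: cycle_abelian.
have pC : p^'.-group C by apply: p_elt_constt.
have hallC : p^'.-Hall(H) C.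
  by rewrite /pHall normal_sub // pC pnatNK.
pose Y := [set y in N | (g ^ y^-1)%g \in H]%SET.
have NY y : y \in G -> (g ^ y)%g \in H -> y \in N.
  move=> Gy Hgy; rewrite finset.inE Gy.
  have Cwy : (w ^ y)%g \in C.
    rewrite (mem_normal_Hall hallC nsCH) ?p_eltJ ?p_elt_constt //.
    by rewrite -consttJ groupX.
  rewrite -groupV; apply/normP/eqP; rewrite eq_sym eqEcard cardJg leqnn andbT.
  by rewrite -sub_conjg -cycleJ cycle_subG.
have indE : ('Ind[G, H] 1) g = #|H|%:R^-1 * #|Y|%:R.
  rewrite cfIndE //; congr (_ * _).
  rewrite -sum1_card natr_sum [LHS](reindex_inj invg_inj) /=.
  rewrite (bigID (fun y => g ^ y^-1 \in H)%g) /= addrC big1 ?add0r; last first.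
    by move=> y /andP[_ /negPf HN]; rewrite cfun1E HN.
  apply: eq_big => [y | y /andP[_ Hgy]]; last by rewrite cfun1E Hgy.
  rewrite finset.inE groupV; apply: andb_id2r => Hgy.
  apply/idP/idP => [Gy | /(fintype.subsetP sNG)//].
  by rewrite -groupV NY ?groupV.
have NYz y : y \in N -> ((z ^ y^-1)%g \in H) = ((g ^ y^-1)%g \in H).
  move=> Ny; rewrite -[in RHS](consttC p g) conjMg [RHS]groupMr //.
  have Cw : (w ^ y^-1)%g \in C.
    by rewrite memJ_norm ?cycle_id // groupV; have /finset.setIP[] := Ny.
  exact: (fintype.subsetP (normal_sub nsCH)).
pose F := 'Fix_(rcosets H N | 'Rs)(<[z]>).
have FP y : y \in N -> (H :* y \in F)%g = (y \in Y).
  move=> Ny; rewrite [y \in Y]finset.inE Ny finset.in_setI afix_cycle mem_rcosets.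
  rewrite mulSGid // Ny /= -NYz // [LHS](sameP afix1P eqP) /= rcosetE.
  by rewrite -rcosetM (sameP eqP rcoset_eqP) mem_rcoset conjgE invgK mulgA.
have sFN : F \subset rcosets H N := finset.subsetIl _ _.
have partF : finset.partition F Y.
  have /and3P[_ tiN n0N] := rcosets_partition sHN.
  apply/and3P; split; last by apply: contra n0N; apply: (fintype.subsetP sFN).
    rewrite finset.eqEsubset; apply/andP; split; apply/fintype.subsetP=> y.
      case/finset.bigcupP=> A FA Ay; have /rcosetsP[x Nx DA] := fintype.subsetP sFN A FA.
      rewrite -FP; first by rewrite (_ : _ :* y = A)%g // DA; apply/rcoset_eqP; rewrite -DA.
      rewrite -[gval N](mulSGid sHN); apply/imset2P.
      by move: Ay; rewrite DA => /rcosetP[h Hh ->]; exists h x.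
    move=> Yy; have Ny : y \in N by move: Yy; rewrite finset.inE => /andP[].
    by apply/finset.bigcupP; exists (H :* y)%g; rewrite ?FP ?rcoset_refl.
  exact: finset.trivIsetS sFN tiN.
have cardY : #|Y| = (#|F| * #|H|)%N.
  apply: finset.card_uniform_partition partF => A /(fintype.subsetP sFN)/rcosetsP[x _ ->].
  exact: card_rcoset.
exists #|F|; first by rewrite indE cardY natrM mulrC mulfK // neq0CG.
have pz : p.-group <[z]> by apply: p_elt_constt.
have actz : [acts <[z]>, on rcosets H N | 'Rs].
  have Nz : z \in N.
    rewrite finset.inE groupX //=; apply: (fintype.subsetP (cent_sub _)).
    by rewrite cent_cycle; apply/cent1P; apply: commuteX2.
  by apply: fintype.subset_trans (actsRs_rcosets H N); rewrite cycle_subG.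
rewrite /dvdn -(pgroup_fix_mod pz actz) -/(dvdn p _) -prime_coprime //.
rewrite -[#|rcosets H N|]/#|N : H|; apply: (pnat_coprime (pi := p)); first exact: pnat_id.
by apply: pnat_dvd hallP; apply: indexgS; apply: joing_subr.
Qed.

(** * Realizability over Q^ab *)

Section Banaschewski.

Variables (gT : finGroupType) (G : {group gT}).

Let vreal (phi : 'CF(G)) := exists phi1 phi2,
  [/\ exists n, realizable n phi1, exists n, realizable n phi2 & phi = phi2 - phi1].

Let vrealB phi psi : vreal phi -> vreal psi -> vreal (phi - psi).
Proof.
move=> [a1 [a2 [[n1 Ra1] [n2 Ra2] ->]]] [b1 [b2 [[m1 Rb1] [m2 Rb2] ->]]].
exists (a1 + b2), (a2 + b1); split.
- by exists (n1 + m2)%N; apply: realizableD.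
- by exists (n2 + m1)%N; apply: realizableD.
by rewrite opprB addrACA opprD.
Qed.

(** The virtual characters carrying every character to a difference of
realizable ones form an ideal; the aim is to show that it contains 1. *)
Let J (f : 'CF(G)) :=
  f \in 'Z[irr G] /\ forall chi, chi \is a character -> vreal (f * chi).

Let JB f h : J f -> J h -> J (f - h).
Proof.
move=> [Zf Jf] [Zh Jh]; split=> [|chi Nchi]; first exact: rpredB.
by rewrite mulrBl; apply: vrealB; [apply: Jf | apply: Jh].
Qed.

Let JM f h : J f -> h \in 'Z[irr G] -> J (f * h).
Proof.
move=> [Zf Jf] Zh; split=> [|chi Nchi]; first exact: rpredM.
have [h1 [Nh1 [h2 Nh2 ->]]] := vcharP _ Zh.
rewrite -mulrA mulrBl mulrBr; apply: vrealB; apply: Jf; exact: rpredM.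
Qed.

(** The product with chi is induced from the restriction of chi to H, whose
constituents are monomial. *)
Let J_Ind1 (H C : {group gT}) (p : nat) :
    H \subset G -> C <| H -> abelian C -> p.-nat #|H : C| ->
  J ('Ind[G, H] 1).
Proof.
move=> sHG nsCH abC pHC; split=> [|chi Nchi].
  by rewrite char_vchar // cfInd_char ?rpred1.
exists 0, ('Ind[G, H] 1 * chi); split; last by rewrite subr0.
  by exists 0%N; apply: realizable0.
rewrite -cfIndM // mul1r; have [r ->] := char_sum_irr (cfRes_char H Nchi).
elim: r => [|i r [n IHr]]; first by exists 0%N; rewrite big_nil raddf0; apply: realizable0.
have [L [lam [sLH Llam Di]]] := abelian_by_pgroup_monomial i nsCH abC pHC.
have [m Rm] := realizable_Ind_lin (fintype.subset_trans sLH sHG) Llam.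
by exists (m + n)%N; rewrite big_cons raddfD /= Di cfIndInd //; apply: realizableD.
Qed.

(** For each prime p some member of the ideal takes at g an integer value
prime to p, so a combination of members takes the value 1. *)
Let J_at g : g \in G -> exists2 f, J f & f g = 1.
Proof.
move=> Gg; have Jp p : prime p -> exists f n, [/\ J f, f g = n%:R & ~~ (p %| n)%N].
  move=> pr_p; have [H [C [sHG nsCH abC pHC [n Dn npn]]]] := Ind1_pprime_value Gg pr_p.
  by exists ('Ind[G, H] 1), n; split=> //; apply: J_Ind1 pHC.
have [f [n [Jf Dn n2]]] := Jp 2%N isT.
have n_gt0 : (0 < n)%N by case: n n2 {Dn}.
elim/ltn_ind: n => n IHn in f Jf Dn n_gt0 {n2} *.
have [n1 | n1] := leqP n 1; first by exists f; rewrite // Dn (@anti_leq n 1) // n1.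
have [h [m [Jh Dm npm]]] := Jp _ (pdiv_prime n1).
case: (egcdnP m n_gt0) => u v Duv _.
have lt_gcd : (gcdn n m < n)%N.
  rewrite ltn_neqAle dvdn_leq ?dvdn_gcdl // andbT; apply: contraNneq npm => gcd_n.
  by rewrite (dvdn_trans (pdiv_dvd n)) // -gcd_n dvdn_gcdr.
apply: (IHn _ lt_gcd (f * u%:R - h * v%:R)); last by rewrite gcdn_gt0 n_gt0.
  by apply: JB; apply: JM; rewrite ?rpred_nat.
have nat_val k : (k%:R : 'CF(G)) g = k%:R by rewrite -scaler_nat cfunE cfun1E Gg mulr1.
rewrite !cfunE !nat_val Dn Dm -!natrM mulnC [(m * v)%N]mulnC Duv natrD addrC addKr.
by [].
Qed.

(** If f and h are 1 on two sets of elements, then 1 - (1 - f) (1 - h) is 1 on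
their union. *)
Let J1 : J 1.
Proof.
suff [f Jf f1] : exists2 f, J f & {in enum G, forall g, f g = 1}.
  suff <-: f = 1 by [].
  by apply/cfun_inP=> x Gx; rewrite cfun1E Gx f1 ?mem_enum.
have: {subset enum G <= G} by move=> x; rewrite mem_enum.
elim: (enum G) => [|g s IHs] sG.
  have [f Jf _] := J_at (group1 G); by exists f.
have [|f Jf f1] := IHs; first by move=> x sx; rewrite sG ?inE ?sx ?orbT.
have [|h Jh h1] := @J_at g; first by rewrite sG ?mem_head.
exists (f - (f * h - h)) => [|x]; first by do 2?apply: JB => //; apply: JM => //; case: Jh.
rewrite inE !cfunE => /predU1P[-> | /f1->].
  by rewrite h1 mulr1 opprB addrC subrK.
by rewrite mul1r subrr subr0.
Qed.

(** As 1 lies in the ideal, every character is a difference of realizable ones,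
and these may be cancelled. *)
Theorem char_realizable (chi : 'CF(G)) :
  chi \is a character -> exists n, realizable n chi.
Proof.
move=> Nchi; have [phi1 [phi2 [[n1 R1] [n2 R2] Dchi]]] := J1.2 chi Nchi.
apply: (realizable_cancel R1 R2 Nchi).
by rewrite -(mul1r chi) Dchi subrK.
Qed.

End Banaschewski.

(** * Clifford theory over a normal subgroup with abelian quotient *)

Definition lin_over (gT : finGroupType) (N K : {group gT}) (lam : 'CF(K)) :=
  lam \is a linear_char /\ N \subset cfker lam.

Definition lies_over (gT : finGroupType) (N K : {group gT}) (theta : 'CF(K))
  (chi : 'CF(N)) := '['Res[N] theta, chi] != 0.

Lemma lin_over_irr (gT : finGroupType) (T : {group gT}) (eta lam : 'CF(T)) :
  eta \in irr T -> lam \is a linear_char -> eta * lam \in irr T.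
Proof. by move=> /irrP[i ->] Llam; rewrite mulrC mul_lin_irr ?mem_irr. Qed.

Section Gallagher.

Variables (gT : finGroupType) (N T : {group gT}) (chi : 'CF(N)) (eta : 'CF(T)).
Hypotheses (nsNT : N <| T) (irr_chi : chi \in irr N) (irr_eta : eta \in irr T).
Hypothesis (res_eta : 'Res[N] eta = chi).

Lemma Gallagher_mod (eta' : 'CF(T)) : eta' \in irr T -> lies_over eta' chi ->
  exists b : Iirr (T / N)%g, eta' = ('chi_b %% N)%CF * eta.
Proof.
have [[t Dt] [c Dc]] := (irrP irr_chi, irrP irr_eta).
have ct : 'Res[N] 'chi_c = 'chi_t by rewrite -Dc res_eta.
have [irrm _ im _] := constt_Ind_ext nsNT ct.
case/irrP=> s -> s_over.
have: s \in irr_constt ('Ind[T] 'chi_t) by rewrite constt_Ind_Res irr_consttE -Dt.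
rewrite im => /codomP[b Ds]; exists b.
by rewrite -mod_IirrE // Dc Ds cfIirrE.
Qed.

Lemma mod_lin_over (b : Iirr (T / N)%g) : 'chi_b \is a linear_char ->
  lin_over N ('chi_b %% N)%CF.
Proof. by move=> Lb; split; [apply: cfMod_lin_char | apply: cfker_mod]. Qed.

Lemma Gallagher_abelian (eta' : 'CF(T)) : abelian (T / N)%g ->
    eta' \in irr T -> lies_over eta' chi ->
  exists2 mu : 'CF(T), lin_over N mu & eta' = eta * mu.
Proof.
move=> abTN irr_eta' /(Gallagher_mod irr_eta')[b ->].
exists ('chi_b %% N)%CF; last by rewrite mulrC.
by apply: mod_lin_over; apply/char_abelianP.
Qed.

Lemma ext_lies_over (eta' : 'CF(T)) : 'Res[N] eta' = chi -> lies_over eta' chi.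
Proof.
move=> res'; rewrite /lies_over res'; case/irrP: irr_chi => t ->.
by rewrite cfnorm_irr oner_eq0.
Qed.

Lemma Gallagher_ext (eta' : 'CF(T)) : eta' \in irr T -> 'Res[N] eta' = chi ->
  exists2 mu : 'CF(T), lin_over N mu & eta' = eta * mu.
Proof.
move=> irr_eta' res'; have [b Db] := Gallagher_mod irr_eta' (ext_lies_over res').
exists ('chi_b %% N)%CF; last by rewrite mulrC.
apply: mod_lin_over; rewrite qualifE /= irr_char /=.
have nz : eta 1%g != 0 by case/irrP: irr_eta => c ->; apply: irr1_neq0.
have: eta' 1%g = eta 1%g by rewrite -(cfRes1 N eta') -(cfRes1 N eta) res' res_eta.
rewrite Db cfunE cfMod1 => /eqP.
by rewrite -[X in _ == X]mul1r (inj_eq (mulIf nz)).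
Qed.

Lemma Gallagher_inj (mu1 mu2 : 'CF(T)) :
  lin_over N mu1 -> lin_over N mu2 -> eta * mu1 = eta * mu2 -> mu1 = mu2.
Proof.
have [[t Dt] [c Dc]] := (irrP irr_chi, irrP irr_eta).
have ct : 'Res[N] 'chi_c = 'chi_t by rewrite -Dc res_eta.
have [irrm inj _ _] := constt_Ind_ext nsNT ct.
move=> [L1 k1] [L2 k2].
have modE mu : mu \is a linear_char -> N \subset cfker mu ->
    exists b : Iirr (T / N)%g, mu = 'chi_(mod_Iirr b).
  move=> Lmu kmu; have /irrP[s Ds] := lin_char_irr Lmu.
  by exists (quo_Iirr N s); rewrite quo_IirrK -?Ds.
have [[b1 ->] [b2 ->]] := (modE _ L1 k1, modE _ L2 k2).
rewrite ![eta * _]mulrC Dc => E.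
suff -> : b1 = b2 by [].
by apply: inj; rewrite /mul_mod_Iirr /mul_Iirr E.
Qed.

End Gallagher.

(** A linear character of S trivial on S :&: N occurs in the restriction of the
character induced from the trivial one of N, all of whose constituents are
linear. *)
Lemma extend_lin_over (gT : finGroupType) (N K S : {group gT}) (mu : 'CF(S)) :
    N <| K -> abelian (K / N)%g -> S \subset K -> mu \is a linear_char ->
    S :&: N \subset cfker mu ->
  exists2 lam : 'CF(K), lin_over N lam & 'Res[S] lam = mu.
Proof.
move=> nsNK abKN sSK Lmu kmu; pose Theta := 'Ind[K, N] 1.
have sNK := normal_sub nsNK.
have: '['Res[S] Theta, mu] != 0.
  rewrite cfdotE mulf_neq0 ?invr_neq0 ?neq0CG //.
  rewrite (bigID (mem N)) /= addrC big1 ?add0r => [|x /andP[Sx notNx]]; last first.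
    rewrite cfResE // /Theta cfInd_cfun1 // cfunE cfuniE //.
    by rewrite (negPf notNx) mulr0 mul0r.
  rewrite (eq_bigr (fun _ => #|K : N|%:R)) => [|x /andP[Sx Nx]].
    rewrite sumr_const -mulrnA pnatr_eq0 -lt0n muln_gt0 indexg_gt0.
    by apply/card_gt0P; exists 1%g; rewrite [_ \in _]andbC !group1.
  rewrite cfResE // /Theta cfInd_cfun1 // cfunE cfuniE // Nx.
  rewrite (cfker1 (fintype.subsetP kmu x _)) ?finset.inE ?Sx //.
  by rewrite lin_char1 // conjC1 !mulr1.
move=> nz; have [i Ti nzi] : exists2 i, i \in irr_constt Theta & '['Res[S] 'chi_i, mu] != 0.
  apply/exists_inP; apply: contraR nz => /exists_inPn all0.
  rewrite [Theta]cfun_sum_constt raddf_sum /= cfdot_suml big1 // => i Ti.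
  by rewrite linearZ /= cfdotZl (eqP (negbNE (all0 i Ti))) mulr0.
have ki : N \subset cfker 'chi_i.
  by rewrite constt0_Res_cfker // -constt_Ind_Res irr0.
have Li : 'chi_i \is a linear_char.
  rewrite lin_irr_der1; apply: fintype.subset_trans ki.
  by apply: der1_min; rewrite ?normal_norm.
exists 'chi_i => //; move: nzi.
have /irrP[j ->] := lin_char_irr (cfRes_lin_char S Li).
have /irrP[k ->] := lin_char_irr Lmu.
by rewrite cfdot_irr pnatr_eq0 eqb0 negbK => /eqP->.
Qed.

Section Clifford.

Variables (gT : finGroupType) (N K : {group gT}) (chi : 'CF(N)).
Hypotheses (nsNK : N <| K) (irr_chi : chi \in irr N).
Local Notation T := 'I_K[chi]%G.

Let nsNT : N <| T. Proof. exact: normal_Inertia (normal_sub nsNK). Qed.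
Let sTK : T \subset K. Proof. exact: Inertia_sub. Qed.

Lemma Clifford_correspondent (theta : 'CF(K)) : theta \in irr K -> lies_over theta chi ->
  exists eta : 'CF(T), [/\ eta \in irr T, lies_over eta chi & theta = 'Ind[K] eta].
Proof.
case/irrP=> i -> over_i; case/irrP: irr_chi over_i => t -> over_i.
have [indI _ surjI _ _] := constt_Inertia_bijection t nsNK.
have: i \in irr_constt ('Ind[K] 'chi_t) by rewrite constt_Ind_Res irr_consttE.
rewrite -surjI => /imsetP[s cs Ds]; exists 'chi_s; split; first exact: mem_irr.
  by move: cs; rewrite constt_Ind_Res irr_consttE.
by rewrite Ds cfIirrE // indI.
Qed.

Lemma Clifford_Ind_inj (eta1 eta2 : 'CF(T)) :
    eta1 \in irr T -> lies_over eta1 chi -> eta2 \in irr T -> lies_over eta2 chi ->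
  'Ind[K] eta1 = 'Ind[K] eta2 -> eta1 = eta2.
Proof.
case/irrP=> s1 -> over1 /irrP[s2 ->] over2 E; congr 'chi_(_).
move: (s1) (s2) over1 over2 E; case/irrP: irr_chi => t -> {}s1 {}s2 over1 over2 E.
have [_ injI _ _ _] := constt_Inertia_bijection t nsNK.
by apply: injI; rewrite ?constt_Ind_Res ?irr_consttE // /Ind_Iirr E.
Qed.

Lemma lies_over_conj (theta : 'CF(K)) (chi' : 'CF(N)) : theta \in irr K ->
    chi' \in irr N -> lies_over theta chi -> lies_over theta chi' ->
  exists2 k, k \in K & chi' = (chi ^ k)%CF.
Proof.
case/irrP: irr_chi => t -> /irrP[i ->] /irrP[t' ->] over_t over_t'.
have:= over_t'; rewrite /lies_over.
rewrite (Clifford_Res_sum_cfclass nsNK (_ : t \in irr_constt _)) ?irr_consttE //.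
rewrite cfdotZl mulf_eq0 negb_or cfdot_suml => /andP[_ nz].
apply/cfclassP; apply: contraR nz => notin; rewrite big_seq big1 // => phi.
case/cfclassP=> k Kk Dphi; have /irrP[j Dj] : phi \in irr N.
  by rewrite Dphi cfConjg_irr ?mem_irr.
rewrite Dj cfdot_irr; case: eqP => // jt'; case/negP: notin.
by apply/cfclassP; exists k; rewrite // -Dphi Dj jt'.
Qed.

End Clifford.

Section AbelianQuotient.

Variables (gT : finGroupType) (N K : {group gT}) (chi : 'CF(N)).
Hypotheses (nsNK : N <| K) (abKN : abelian (K / N)%g) (irr_chi : chi \in irr N).
Local Notation T := 'I_K[chi]%G.
Variable eta0 : 'CF(T).
Hypotheses (irr_eta0 : eta0 \in irr T) (res_eta0 : 'Res[N] eta0 = chi).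

Let nsNT : N <| T. Proof. exact: normal_Inertia (normal_sub nsNK). Qed.
Let sTK : T \subset K. Proof. exact: Inertia_sub. Qed.
Let abTN : abelian (T / N)%g. Proof. exact: abelianS (quotientS _ sTK) abKN. Qed.

Lemma lin_over_Res (lam : 'CF(K)) : lin_over N lam -> lin_over N ('Res[T] lam).
Proof.
case=> Llam klam; split; first exact: cfRes_lin_char.
by rewrite cfker_Res ?lin_charW // finset.subsetI klam normal_sub.
Qed.

Lemma lies_over_ext (eta : 'CF(T)) : eta \in irr T -> lies_over eta chi ->
  'Res[N] eta = chi.
Proof.
move=> irr_eta over_eta.
have [mu [Lmu kmu] ->] := Gallagher_abelian nsNT irr_chi irr_eta0 res_eta0 abTN irr_eta over_eta.
rewrite rmorphM /= res_eta0 (cfRes_sub_ker kmu) lin_char1 // scale1r mulr1.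
by [].
Qed.

Lemma lies_over_lin (theta lam : 'CF(K)) : theta \in irr K -> lies_over theta chi ->
  lin_over N lam -> lam * theta \in irr K /\ lies_over (lam * theta) chi.
Proof.
move=> irr_th over_th [Llam klam]; split; first exact: mul_lin_irr.
rewrite /lies_over rmorphM /= (cfRes_sub_ker klam) lin_char1 // scale1r mul1r.
exact: over_th.
Qed.

(** The Clifford correspondents differ by a linear character of T / N, and this
one extends to K / N. *)
Lemma lies_over_orbit (theta theta' : 'CF(K)) : theta \in irr K -> lies_over theta chi ->
    theta' \in irr K -> lies_over theta' chi ->
  exists2 lam : 'CF(K), lin_over N lam & theta' = lam * theta.
Proof.
move=> irr_th over_th irr_th' over_th'.
have [eta [irr_eta over_eta ->]] := Clifford_correspondent nsNK irr_chi irr_th over_th.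
have [eta' [irr_eta' over_eta' ->]] := Clifford_correspondent nsNK irr_chi irr_th' over_th'.
have res_eta := lies_over_ext irr_eta over_eta.
have [mu [Lmu kmu] ->] := Gallagher_abelian nsNT irr_chi irr_eta res_eta abTN irr_eta' over_eta'.
have [|lam lin_lam <-] := extend_lin_over nsNK abKN sTK Lmu.
  by rewrite (finset.setIidPr (normal_sub nsNT)).
by exists lam; rewrite // cfIndM // mulrC.
Qed.

(** By the Clifford correspondence lam fixes theta if and only if its
restriction to T fixes the correspondent of theta, and the linear characters of
T / N act freely on the extensions of chi. *)
Lemma lin_stab_theta (theta lam : 'CF(K)) : theta \in irr K -> lies_over theta chi ->
  lin_over N lam -> (lam * theta = theta <-> 'Res[T] lam = 1).
Proof.
move=> irr_th over_th lin_lam.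
have [eta [irr_eta over_eta ->]] := Clifford_correspondent nsNK irr_chi irr_th over_th.
have res_eta := lies_over_ext irr_eta over_eta.
have lin_res := lin_over_Res lin_lam.
rewrite mulrC -cfIndM //; split=> [E | ->]; last by rewrite mulr1.
have lin1 : lin_over N (1 : 'CF(T)) by split; rewrite ?rpred1 // cfker_cfun1 normal_sub.
apply: (Gallagher_inj nsNT irr_chi irr_eta res_eta lin_res lin1); rewrite mulr1.
apply: (Clifford_Ind_inj nsNK irr_chi) => //; first exact: lin_over_irr lin_res.1.
apply: ext_lies_over => //.
rewrite rmorphM /= res_eta (cfRes_sub_ker lin_res.2) lin_char1 ?lin_res.1 //.
by rewrite scale1r mulr1.
Qed.

(** The linear characters fixing theta are those trivial on T, and their common
kernel is T since K / T is abelian.  Thus T is determined by the action of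
linear characters on theta, which is what passes from Gc to Mc below. *)
Lemma inertia_lin_stab (theta : 'CF(K)) k : theta \in irr K -> lies_over theta chi ->
    k \in K ->
  k \in T <-> forall lam : 'CF(K), lin_over N lam -> lam * theta = theta -> lam k = 1.
Proof.
move=> irr_th over_th Kk; split=> [Tk lam lin_lam | stab1].
  move/(lin_stab_theta irr_th over_th lin_lam) => res1.
  by rewrite -(cfResE _ sTK Tk) res1 cfun1E Tk.
apply/idPn=> notTk.
have sK'T : K^`(1)%g \subset T.
  apply: fintype.subset_trans (normal_sub nsNT).
  by apply: der1_min; rewrite ?normal_norm.
have nsTK : T <| K := sub_der1_normal sK'T sTK.
have abKT : abelian (K / T)%g := sub_der1_abelian sK'T.
have nTk : k \in 'N(T) := fintype.subsetP (normal_norm nsTK) k Kk.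
have ntk : coset T k \notin (1%g : {set coset_of T}).
  by apply: contra notTk => /finset.set1P/coset_idr; apply.
have [b kb] : exists b : Iirr (K / T)%g, coset T k \notin cfker 'chi_b.
  apply/existsP; apply: contraR ntk; rewrite negb_exists => /forallP all_k.
  rewrite -(TI_cfker_irr (K / T)%G); apply/finset.bigcapP=> b _.
  by rewrite -[_ \in _]negbK all_k.
have Lb : 'chi_b \is a linear_char by apply/char_abelianP.
case/negP: kb; have [Lm km] := mod_lin_over nsTK Lb.
have := stab1 ('chi_b %% T)%CF; rewrite cfModE // => kb1.
rewrite cfkerEirr finset.inE lin_char1 //; apply/eqP/kb1.
  by split=> //; apply: fintype.subset_trans km; apply: normal_sub.
apply/(lin_stab_theta irr_th over_th).
  by split=> //; apply: fintype.subset_trans km; apply: normal_sub.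
by rewrite (cfRes_sub_ker km) lin_char1 // scale1r.
Qed.

End AbelianQuotient.

(** * Schur's lemma and intertwiners *)

Section Schur.

Variables (gT : finGroupType) (G : {group gT}).

Lemma cfRepr_mx_irr n (rG : mx_representation algC G n) :
  cfRepr rG \in irr G -> mx_irreducible rG.
Proof.
case/irr_reprP=> rG' irr_rG' E; apply: mx_rsim_irr irr_rG'.
by apply/cfRepr_rsimP; rewrite E.
Qed.

Lemma cfRepr_Schur n (rG : mx_representation algC G n) A :
    cfRepr rG \in irr G -> {in G, forall g, A *m rG g = rG g *m A} ->
  exists a, A = a%:M.
Proof.
move/cfRepr_mx_irr=> irr_rG cA.
have absG := group_closure_closed_field irr_rG.
by apply/is_scalar_mxP; apply: (mx_abs_irr_cent_scalar absG); apply/centgmxP.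
Qed.

Lemma cfRepr_irr_gt0 n (rG : mx_representation algC G n) :
  cfRepr rG \in irr G -> (0 < n)%N.
Proof. by move/cfRepr_mx_irr/mx_irrP=> []. Qed.

Lemma irr_intertwiner_unit n (r1 r2 : mx_representation algC G n) X :
    cfRepr r1 \in irr G -> X != 0 -> {in G, forall g, r1 g *m X = X *m r2 g} ->
  X \in unitmx.
Proof.
move/cfRepr_mx_irr/mx_irrP=> [_ irr1] nzX hX.
rewrite -row_free_unit -kermx_eq0; apply: contraR nzX => nzK.
have modK : mxmodule r1 (kermx X).
  apply/mxmoduleP=> g Gg; apply/sub_kermxP.
  by rewrite -mulmxA hX // mulmxA mulmx_ker mul0mx.
have /row_fullP[Z ZK] := irr1 _ modK nzK.
by rewrite -[X]mul1mx -ZK -mulmxA mulmx_ker mulmx0.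
Qed.

Lemma cfRepr_similar n (r1 r2 : mx_representation algC G n) :
    cfRepr r1 = cfRepr r2 ->
  exists2 X : 'M_n, X \in unitmx & {in G, forall g, r1 g *m X = X *m r2 g}.
Proof.
move/eqP/cfRepr_rsimP=> [X _ freeX hX].
by exists X; rewrite -?row_free_unit.
Qed.

End Schur.

Lemma unit_mx_neq0 n (A : 'M[algC]_n) : (0 < n)%N -> A \in unitmx -> A != 0.
Proof.
by case: n A => // n A _; apply: contraTneq => ->; rewrite unitmxE det0 unitr0.
Qed.

Lemma cfRepr_Res (gT : finGroupType) (G X : {group gT}) n
    (D : mx_representation algC X n) (sGX : G \subset X) :
  cfRepr (subg_repr D sGX) = 'Res[G] (cfRepr D).
Proof.
apply/cfun_inP=> g Gg; rewrite cfResE // !cfunE Gg.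
by rewrite (fintype.subsetP sGX).
Qed.

(** Some B intertwines S and lam D on X.  On G, where lam is trivial, both B and
T intertwine S and the irreducible D, so they are proportional by Schur's
lemma. *)
Lemma Schur_lin (gT : finGroupType) (G X : {group gT}) n
    (S D : mx_representation algC X n) (lam : 'CF(X)) T :
    G \subset X -> 'Res[G] (cfRepr D) \in irr G -> lin_over G lam ->
    cfRepr S = cfRepr D * lam -> T \in unitmx ->
    {in G, forall g, S g *m T = T *m D g} ->
  {in X, forall x, S x *m T = lam x *: (T *m D x)}.
Proof.
move=> sGX irrD [Llam klam] SD uT hT.
have repL : mx_repr X (fun x => lam x *: D x).
  split=> [|x y Xx Xy]; first by rewrite lin_char1 // scale1r repr_mx1.
  by rewrite lin_charM // repr_mxM // -scalemxAl -scalemxAr scalerA.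
have [|B uB hB] := @cfRepr_similar _ _ _ S (MxRepresentation repL).
  rewrite SD; apply/cfun_inP=> x Xx.
  by rewrite !cfunE Xx !mulr1n /= mxtraceZ mulrC.
rewrite -(cfRepr_Res D sGX) in irrD.
have [|a Da] := cfRepr_Schur (A := invmx T *m B) irrD.
  move=> g Gg; have Xg := fintype.subsetP sGX g Gg.
  have := hB g Xg; rewrite /= (cfker1 (fintype.subsetP klam g Gg)) lin_char1 // scale1r => hBg.
  rewrite /= -mulmxA -hBg -[D g in RHS](mulKmx uT) -hT //.
  by rewrite -!mulmxA mulKVmx.
have DB : B = a *: T by rewrite -(mulKVmx uT B) Da mul_mx_scalar.
have nza : a != 0.
  by apply: contraNneq (unit_mx_neq0 (cfRepr_irr_gt0 irrD) uB) => a0; rewrite DB a0 scale0r.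
move=> x Xx; apply: (scalerI nza).
have := hB x Xx; rewrite DB -scalemxAr => ->.
by rewrite /= -scalemxAr -scalemxAl scalerA mulrC -scalerA.
Qed.

Lemma galC_aut_fin s (I : finType) (v : I -> algC) : (forall i, v i \in Qab) ->
  exists u : {rmorphism algC -> algC}, forall i, galC s (v i) = u (v i).
Proof.
move=> Qv; have [|u Du] := @galC_aut s [seq v i | i <- enum I].
  by move=> _ /mapP[i _ ->].
by exists u => i; apply/Du/map_f; rewrite mem_enum.
Qed.

Lemma cfactE (gT : finGroupType) (B : {group gT}) (a : gal_prod gT) (phi : 'CF(B)) x :
  a.1 \in 'N(B)%g -> cfact a phi x = galC a.2 (phi (x ^ a.1^-1)%g).
Proof. by move=> nB; rewrite cfunE /= cfConjgE. Qed.

(** * Gluing two extensions into a projective representation *)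

Section Glue.

Variables (gT : finGroupType) (G X Y K : {group gT}) (n : nat).
Variables (D1 : mx_representation algC X n) (D2 : mx_representation algC Y n).
Hypotheses (sGX : G \subset X) (sGY : G \subset Y) (tiXY : X :&: Y = G).
Hypothesis (defK : K :=: (X * Y)%g).
Hypothesis eqG : {in G, D1 =1 D2}.

(** A factorization k = x y with x in X and y in Y is unique up to G only; this
picks a possible x, and the glued matrix does not depend on the choice. *)
Definition glue_l (k : gT) := odflt 1%g [pick x in X | (x^-1 * k)%g \in Y].
Definition glue_repr (k : gT) : 'M[algC]_n := D1 (glue_l k) *m D2 ((glue_l k)^-1 * k)%g.

Lemma glue_lP (x y : gT) : x \in X -> y \in Y ->
  exists2 g, g \in G & glue_l (x * y) = (x * g)%g.
Proof.
move=> Xx Yy; rewrite /glue_l; case: pickP => [z /andP[Xz Yz] | /(_ x)]; last first.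
  by rewrite /= Xx mulKg Yy.
exists (x^-1 * z)%g; last by rewrite mulKVg.
rewrite -tiXY finset.inE groupM ?groupV //=.
by rewrite -groupV invMg invgK -(groupMr _ Yy) -mulgA.
Qed.

Lemma glueE (x y : gT) : x \in X -> y \in Y -> glue_repr (x * y) = D1 x *m D2 y.
Proof.
move=> Xx Yy; rewrite /glue_repr; have [g Gg ->] := glue_lP Xx Yy.
have [Xg Yg] := (fintype.subsetP sGX g Gg, fintype.subsetP sGY g Gg).
have -> : ((x * g)^-1 * (x * y) = g^-1 * y)%g by rewrite invMg -mulgA mulKg.
by rewrite repr_mxM // (eqG Gg) -mulmxA -repr_mxM ?groupM ?groupV // mulKVg.
Qed.

Lemma glue_mem (k : gT) : k \in K -> exists x y : gT, [/\ x \in X, y \in Y & k = (x * y)%g].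
Proof. by rewrite defK => /mulsgP[x y Xx Yy ->]; exists x, y. Qed.

Lemma glue_lE (x : gT) : x \in X -> glue_repr x = D1 x.
Proof. by move=> Xx; rewrite -[x in LHS]mulg1 glueE ?repr_mx1 ?mulmx1. Qed.

Lemma glue_rE (y : gT) : y \in Y -> glue_repr y = D2 y.
Proof. by move=> Yy; rewrite -[y in LHS]mul1g glueE ?repr_mx1 ?mul1mx. Qed.

Lemma glue_unit (k : gT) : k \in K -> glue_repr k \in unitmx.
Proof.
by case/glue_mem=> x [y [Xx Yy ->]]; rewrite glueE // unitmx_mul !repr_mx_unit.
Qed.

Lemma glue_assoc (chi : 'CF(G)) : 'Res[G] (cfRepr D1) = chi -> proj_assoc K chi glue_repr.
Proof.
move=> res1; split.
  exists (subg_repr D1 sGX) => [g Gg /=|]; last by rewrite cfRepr_Res.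
  by rewrite glue_lE ?(fintype.subsetP sGX).
move=> g k Gg /glue_mem[x [y [Xx Yy ->]]].
have [Xg Yg] := (fintype.subsetP sGX g Gg, fintype.subsetP sGY g Gg).
split; first by rewrite mulgA !glueE ?groupM // repr_mxM // mulmxA glue_lE.
by rewrite -mulgA !glueE ?groupM // repr_mxM // mulmxA glue_rE.
Qed.

(** Moving D1 x2 past D2 y1 is the only obstruction to multiplicativity. *)
Lemma glue_factor (x1 y1 x2 y2 : gT) c : x1 \in X -> y1 \in Y -> x2 \in X -> y2 \in Y ->
    (x2 ^ y1^-1)%g \in X ->
    D2 y1 *m D1 x2 = c *: (D1 (x2 ^ y1^-1)%g *m D2 y1) ->
  glue_repr (x1 * y1) *m glue_repr (x2 * y2) = c *: glue_repr (x1 * y1 * (x2 * y2)).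
Proof.
move=> Xx1 Yy1 Xx2 Yy2 Xx2y1 E; rewrite (glueE Xx1 Yy1) (glueE Xx2 Yy2) -mulmxA (mulmxA (D2 y1)) E.
have -> : (x1 * y1 * (x2 * y2) = (x1 * x2 ^ y1^-1) * (y1 * y2))%g.
  by rewrite conjgE invgK !mulgA mulgKV.
rewrite (glueE (groupM Xx1 Xx2y1) (groupM Yy1 Yy2)).
rewrite (repr_mxM D1 Xx1 Xx2y1) (repr_mxM D2 Yy1 Yy2).
by rewrite -scalemxAl -scalemxAr !mulmxA.
Qed.

(** The images of D1 and D2 under a are similar to lam1 D1 and lam2 D2.  As D1
and D2 agree on G, where lam1 and lam2 are trivial, one matrix T provides both
similarities, by Schur's lemma. *)
Lemma glue_bracket (a : gal_prod gT) (mu : gT -> algC) (lam1 : 'CF(X)) (lam2 : 'CF(Y)) :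
    G \subset K -> 'Res[G] (cfRepr D1) \in irr G ->
    (forall x i j, D1 x i j \in Qab) -> (forall y i j, D2 y i j \in Qab) ->
    a.1 \in 'N(G)%g -> a.1 \in 'N(X)%g -> a.1 \in 'N(Y)%g ->
    lin_over G lam1 -> lin_over G lam2 ->
    cfact a (cfRepr D1) = cfRepr D1 * lam1 ->
    cfact a (cfRepr D2) = cfRepr D2 * lam2 ->
    {in X & Y, forall x y, mu (x * y)%g = lam1 x * lam2 y} ->
  is_proj_bracket K G glue_repr a mu.
Proof.
move=> sGK irrG Q1 Q2 nG nX nY lin1 lin2 act1 act2 muE.
pose t := (a.1^-1)%g.
(* The automorphism of Q^ab is replaced by one of the algebraic numbers, so that
it maps complex representations to complex representations. *)
have [u Du] : exists u : {rmorphism algC -> algC},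
    [/\ forall k, map_mx (galC a.2) (glue_repr k) = map_mx u (glue_repr k),
        forall x, galC a.2 (\tr (D1 x)) = u (\tr (D1 x))
      & forall y, galC a.2 (\tr (D2 y)) = u (\tr (D2 y))].
  pose v (i : ((gT * 'I_n * 'I_n) + (gT + gT))%type) : algC := match i with
    | inl j => glue_repr j.1.1 j.1.2 j.2
    | inr (inl x) => \tr (D1 x)
    | inr (inr y) => \tr (D2 y) end.
  have [|u Du] := @galC_aut_fin a.2 _ v.
    case=> [[[k i] j]|[x|y]] /=; rewrite ?mxE rpred_sum // => m _.
    by rewrite rpredM.
  exists u; split=> [k|x|y]; last exact: (Du (inr (inr y))).
    by apply/matrixP=> i j; rewrite [LHS]mxE [RHS]mxE; apply: (Du (inl (k, i, j))).
  exact: (Du (inr (inl x))).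
case: Du => Dglue Dtr1 Dtr2.
have twist (Z : {group gT}) (D : mx_representation algC Z n) : a.1 \in 'N(Z)%g ->
    mx_repr Z (fun z => map_mx u (D (z ^ t)%g)).
  move=> nZ; split=> [|x y Zx Zy]; first by rewrite /= conj1g (repr_mx1 D) map_mx1.
  by rewrite /= conjMg (repr_mxM D) ?memJ_norm ?groupV // map_mxM.
pose S1 := MxRepresentation (twist _ D1 nX); pose S2 := MxRepresentation (twist _ D2 nY).
have twistE (Z : {group gT}) (D : mx_representation algC Z n) (nZ : a.1 \in 'N(Z)%g) :
    (forall x, galC a.2 (\tr (D x)) = u (\tr (D x))) ->
  cfRepr (MxRepresentation (twist _ D nZ)) = cfact a (cfRepr D).
  move=> Dtr; apply/cfun_inP=> x Zx; rewrite cfactE // !cfunE Zx mulr1n.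
  by rewrite memJ_norm ?groupV // Zx mulr1n Dtr -trace_map_mx.
have res_lin (Z : {group gT}) (lam : 'CF(Z)) : lin_over G lam -> 'Res[G] lam = 1.
  by case=> Llam klam; rewrite (cfRes_sub_ker klam) lin_char1 // scale1r.
have resD : 'Res[G] (cfRepr D2) = 'Res[G] (cfRepr D1).
  apply/cfun_inP=> g Gg; rewrite !cfResE // !cfunE.
  by rewrite (fintype.subsetP sGX) // (fintype.subsetP sGY) // eqG.
have [|T uT hT] := @cfRepr_similar _ _ _ (subg_repr S1 sGX) (subg_repr D1 sGX).
  by rewrite !cfRepr_Res twistE // act1 rmorphM /= (res_lin _ _ lin1) mulr1.
have S1T : {in X, forall x, S1 x *m T = lam1 x *: (T *m D1 x)}.
  by apply: Schur_lin irrG lin1 _ uT hT => //; rewrite twistE.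
have S2T : {in Y, forall y, S2 y *m T = lam2 y *: (T *m D2 y)}.
  apply: Schur_lin lin2 _ uT _ => //; rewrite ?twistE ?resD // => g Gg.
  by rewrite -eqG // -hT //= eqG // memJ_norm ?groupV.
split=> [k /glue_mem[x [y [Xx Yy ->]]] | k g /glue_mem[x [y [Xx Yy ->]]] Gg |].
- by rewrite muE // mulf_neq0 // lin_char_neq0 //; [case: lin1 | case: lin2].
- have Yg := fintype.subsetP sGY g Gg; have [L2 k2] := lin2.
  rewrite -mulgA !muE ?groupM // lin_charM //.
  by rewrite (cfker1 (fintype.subsetP k2 g Gg)) lin_char1 ?mulr1.
exists (invmx T); rewrite ?unitmx_inv // => k /glue_mem[x [y [Xx Yy ->]]].
rewrite invmxK muE // -[LHS](mulmxK uT) scalemxAl; congr (_ *m _).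
have [Xxt Yyt] : (x ^ t)%g \in X /\ (y ^ t)%g \in Y by rewrite !memJ_norm ?groupV.
rewrite /proj_act Dglue conjMg (glueE Xxt Yyt) map_mxM.
rewrite -[map_mx u _]/(S1 x) -[map_mx u _]/(S2 y) -mulmxA S2T // -scalemxAr mulmxA S1T //.
by rewrite -scalemxAl scalerA mulrC -mulmxA glueE.
Qed.

End Glue.

(** * Brackets of projective representations *)

(** Both characters are realizable over Q^ab.  The restrictions to G are
irreducible and equal, so there is an intertwiner over Q^ab between them, which
is invertible; conjugating by it makes the two representations coincide on
G. *)
Lemma common_realization (gT : finGroupType) (G X Y : {group gT})
    (etaX : 'CF(X)) (etaY : 'CF(Y)) :
    G \subset X -> G \subset Y -> etaX \is a character -> etaY \is a character ->
    'Res[G] etaX \in irr G -> 'Res[G] etaX = 'Res[G] etaY ->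
  exists n (D1 : mx_representation algC X n) (D2 : mx_representation algC Y n),
    [/\ cfRepr D1 = etaX, cfRepr D2 = etaY,
        forall x i j, D1 x i j \in Qab, forall y i j, D2 y i j \in Qab
      & {in G, D1 =1 D2}].
Proof.
move=> sGX sGY NX NY irrX eqXY.
have [n1 [r1 D1]] := char_realizable NX; have [n2 [r2 D2]] := char_realizable NY.
have en : n1 = n2.
  apply/eqP; rewrite -(eqr_nat algC) -(cfRepr1 (map_repr iota r1)) D1.
  by rewrite -(cfRepr1 (map_repr iota r2)) D2 -(cfRes1 G etaX) eqXY cfRes1.
case: n2 / en r2 D2 => r2 D2.
have [|X0 nzX hX] := @nonzero_intertwiner _ _ _ _ _ (subg_repr r1 sGX) (subg_repr r2 sGY).
  apply: contraTneq (irrX) => /(congr1 iota); rewrite rmorph0 (rmorph_sum iota) => s0.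
  apply/negP => /irrP[i Di]; have := cfnorm_irr i; rewrite -Di [X in '[_, X]]eqXY cfdotC.
  rewrite cfdotE [X in _ * X](_ : _ = 0) ?mulr0 ?conjC0; first by move/esym/eqP; rewrite oner_eq0.
  apply: etrans s0; apply: eq_bigr => g Gg.
  rewrite -char_inv ?cfRes_char // (rmorphM iota) mulrC !cfResE ?groupV //.
  rewrite -D1 -D2 !realizableE ?groupV ?(fintype.subsetP sGX) ?(fintype.subsetP sGY) //.
pose T := map_mx iota X0.
have hT : {in G, forall g, map_repr iota r1 g *m T = T *m map_repr iota r2 g}.
  by move=> g Gg; have /(congr1 (map_mx iota)) := hX g Gg; rewrite !map_mxM.
have uT : T \in unitmx.
  apply: (@irr_intertwiner_unit _ _ _ (subg_repr (map_repr iota r1) sGX)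
           (subg_repr (map_repr iota r2) sGY)) => //.
    by rewrite cfRepr_Res D1.
  by rewrite map_mx_eq0.
have uX : X0 \in unitmx by rewrite -(map_unitmx iota).
have repD : mx_repr Y (fun y => map_mx iota (X0 *m r2 y *m invmx X0)).
  split=> [|x y Yx Yy]; first by rewrite repr_mx1 mulmx1 mulmxV // map_mx1.
  rewrite -map_mxM repr_mxM //; congr (map_mx _ _).
  by rewrite !mulmxA mulmxKV.
exists n1, (map_repr iota r1), (MxRepresentation repD); split=> //.
- rewrite -D2; apply/cfun_inP=> y Yy; rewrite realizableE // cfunE Yy mulr1n.
  rewrite -[MxRepresentation repD y]/(map_mx iota (X0 *m r2 y *m invmx X0)).
  by rewrite trace_map_mx mxtrace_mulC mulKmx.
- by move=> x i j; rewrite mxE; apply: valP.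
- by move=> x i j; rewrite mxE; apply: valP.
move=> g Gg /=; congr (map_mx _ _).
by have /= <- := hX g Gg; rewrite mulmxK.
Qed.

Section BracketMul.

Variables (gT : finGroupType) (G K : {group gT}) (chi : 'CF(G)) (n : nat).
Variables (P : gT -> 'M[algC]_n) (f : gT -> gT -> algC).
Hypotheses (nsGK : G <| K) (irr_chi : chi \in irr G).
Hypotheses (assP : proj_assoc K chi P) (repP : proj_repr K f P).

Let sGK := fintype.subsetP (normal_sub nsGK).

Lemma proj_assoc_gt0 : (0 < n)%N.
Proof.
by have [[rG _ DrG] _] := assP; apply: (@cfRepr_irr_gt0 _ _ _ rG); rewrite DrG.
Qed.

Lemma proj_repr_cancel (x : gT) : x \in K -> injective (fun c => c *: P x).
Proof.
move=> Kx c d /= /eqP; rewrite -subr_eq0 -scalerBl scaler_eq0 => /orP[].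
  by rewrite subr_eq0 => /eqP.
have [uP _] := repP.
by rewrite (negPf (unit_mx_neq0 proj_assoc_gt0 (uP x Kx))).
Qed.

Lemma factor_neq0 (x y : gT) : x \in K -> y \in K -> f x y != 0.
Proof.
move=> Kx Ky; have [uP fP] := repP.
have: P x *m P y != 0.
  by apply: (unit_mx_neq0 proj_assoc_gt0); rewrite unitmx_mul !uP.
by apply: contraNneq => f0; rewrite fP // f0 scale0r.
Qed.

Lemma factor_mulr (x y g : gT) : x \in K -> y \in K -> g \in G -> f x (y * g)%g = f x y.
Proof.
move=> Kx Ky Gg; have Kg := sGK Gg; have [uP fP] := repP; have [_ aP] := assP.
apply: (@proj_repr_cancel (x * (y * g))%g); rewrite ?groupM //= -fP ?groupM //.
rewrite (aP g y Gg Ky).2 mulmxA fP // -scalemxAl.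
by rewrite -(aP g _ Gg (groupM Kx Ky)).2 mulgA.
Qed.

Lemma factor_mull (x y g : gT) : x \in K -> y \in K -> g \in G -> f (x * g)%g y = f x y.
Proof.
move=> Kx Ky Gg; have Kg := sGK Gg; have [uP fP] := repP; have [_ aP] := assP.
have Ggy : (g ^ y)%g \in G by rewrite memJ_norm // (fintype.subsetP (normal_norm nsGK)).
apply: (@proj_repr_cancel (x * g * y)%g); rewrite ?groupM //= -fP ?groupM //.
rewrite (aP g x Gg Kx).2 -mulmxA -(aP g y Gg Ky).1 [(g * y)%g]conjgC (aP _ y Ggy Ky).2.
by rewrite mulmxA fP // -scalemxAl -(aP _ _ Ggy (groupM Kx Ky)).2 -!mulgA -conjgC.
Qed.

Lemma proj_repr_conj (m x : gT) : m \in K -> x \in K ->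
  P (x ^ m^-1)%g *m P m = (f (x ^ m^-1)%g m / f m x) *: (P m *m P x).
Proof.
move=> Km Kx; have [uP fP] := repP.
rewrite !fP ?groupJ ?groupV // scalerA divfK ?factor_neq0 //.
by rewrite -conjgCV.
Qed.

(** Conjugation by P m realizes conjugation by m up to a quotient of values of
the factor set, so the change of the bracket depends on the factor set only,
not on P. *)
Lemma proj_bracket_mul (a b : gal_prod gT) (m : gT) (mu : gT -> algC) (u : {rmorphism algC -> algC}) :
    m \in K -> b.1 = (m * a.1)%g -> b.2 = a.2 -> a.1 \in 'N(K)%g -> a.1 \in 'N(G)%g ->
    {in K, forall x, map_mx (galC a.2) (P x) = map_mx u (P x)} ->
    is_proj_bracket K G P a mu ->
  is_proj_bracket K G P b
    (fun x => u (f ((x ^ a.1^-1) ^ m^-1)%g m / f m (x ^ a.1^-1)%g) * mu x).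
Proof.
move=> Km b1 b2 nK nG galP [nz_mu mu_G [T uT DT]].
have Kt (x : gT) : x \in K -> (x ^ a.1^-1)%g \in K by rewrite memJ_norm ?groupV.
have [uP fP] := repP.
have Ktm (x : gT) : x \in K -> ((x ^ a.1^-1) ^ m^-1)%g \in K.
  by move=> Kx; apply: groupJ; rewrite ?groupV ?Kt.
split=> [x Kx | x g Kx Gg |].
- by rewrite mulf_neq0 ?nz_mu // fmorph_eq0 mulf_neq0 ?invr_eq0 ?factor_neq0 ?Ktm ?Kt.
- have Gga : (g ^ a.1^-1)%g \in G by rewrite memJ_norm ?groupV.
  have Ggm : ((g ^ a.1^-1) ^ m^-1)%g \in G.
    by rewrite memJ_norm // groupV (fintype.subsetP (normal_norm nsGK)).
  rewrite mu_G // (conjMg x g) (conjMg (x ^ a.1^-1)%g); congr (u (_ / _) * _).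
    exact: (factor_mull (Ktm x Kx) Km Ggm).
  exact: (factor_mulr Km (Kt x Kx) Gga).
exists (T *m invmx (map_mx u (P m))).
  by rewrite unitmx_mul uT unitmx_inv map_unitmx uP.
move=> x Kx; have uuP : map_mx u (P m) \in unitmx by rewrite map_unitmx uP.
have -> : invmx (T *m invmx (map_mx u (P m))) = map_mx u (P m) *m invmx T.
  have uT' : T *m invmx (map_mx u (P m)) \in unitmx by rewrite unitmx_mul uT unitmx_inv.
  by rewrite -[RHS](mulKmx uT') -mulmxA (mulKmx uuP) mulmxV // mulmx1.
rewrite -[LHS](mulmxK uuP) /proj_act b1 b2 invMg conjgM.
have Kxt := Kt x Kx; have := DT x Kx; rewrite /proj_act (galP _ Kxt) => DTx.
rewrite (galP _ (Ktm x Kx)).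
rewrite -map_mxM proj_repr_conj // map_mxZ map_mxM DTx -!scalemxAl -scalemxAr -scalerA.
by rewrite -scalemxAl -!mulmxA.
Qed.

End BracketMul.

(** * Gluing over G and over M with the same factor set *)

Lemma central_scalar (gT : finGroupType) (G Z : {group gT}) n
    (D : mx_representation algC Z n) (z : gT) :
    G \subset Z -> 'Res[G] (cfRepr D) \in irr G -> z \in Z -> z \in 'C(G)%g ->
  D z = (cfRepr D z / cfRepr D 1%g)%:M.
Proof.
move=> sGZ irrD Zz cGz; rewrite -(cfRepr_Res D sGZ) in irrD.
have [|c Dc] := cfRepr_Schur (A := D z) irrD.
  move=> g Gg; have Zg := fintype.subsetP sGZ g Gg.
  by rewrite /= -!repr_mxM // (centP cGz g Gg).
rewrite cfRepr1 cfunE Zz mulr1n Dc mxtrace_scalar -[c *+ n]mulr_natr mulfK //.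
by rewrite pnatr_eq0 -lt0n (cfRepr_irr_gt0 irrD).
Qed.

Section TwoSided.

Variables (gT : finGroupType) (G X Y K M X' Y' K' : {group gT}).
Variables (chi : 'CF(G)) (psi : 'CF(M)).
Variables (etaX : 'CF(X)) (etaY : 'CF(Y)) (etaX' : 'CF(X')) (etaY' : 'CF(Y')).
Hypotheses (irr_chi : chi \in irr G) (irr_psi : psi \in irr M).
Hypotheses (nsGK : G <| K) (nsMK' : M <| K') (sMG : M \subset G).
Hypotheses (sGX : G \subset X) (sGY : G \subset Y) (tiXY : X :&: Y = G).
Hypotheses (sMX' : M \subset X') (sMY' : M \subset Y') (tiXY' : X' :&: Y' = M).
Hypotheses (defK : K :=: (X * Y)%g) (defK' : K' :=: (X' * Y')%g).
Hypotheses (nXY : Y \subset 'N(X)) (nXY' : Y' \subset 'N(X')).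
Hypotheses (sX'X : X' \subset X) (sY'Y : Y' \subset Y).
Hypotheses (NX : etaX \is a character) (NY : etaY \is a character).
Hypotheses (NX' : etaX' \is a character) (NY' : etaY' \is a character).
Hypotheses (resX : 'Res[G] etaX = chi) (resY : 'Res[G] etaY = chi).
Hypotheses (resX' : 'Res[M] etaX' = psi) (resY' : 'Res[M] etaY' = psi).
Hypothesis (twist : forall y : gT, y \in Y ->
  exists2 lam : 'CF(X), lin_over G lam & (etaX ^ y)%CF = etaX * lam).
Hypothesis (twist' : forall y : gT, y \in Y' ->
  exists lam : 'CF(X), [/\ lin_over G lam, (etaX ^ y)%CF = etaX * lam
    & (etaX' ^ y)%CF = etaX' * 'Res[X'] lam]).
Hypothesis (lin_res : forall lam : 'CF(X), lin_over G lam -> lin_over M ('Res[X'] lam)).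
Hypothesis (central : forall c : gT, c \in 'C_K(G)%g ->
  exists z e : gT, [/\ c = (z * e)%g, z \in X' :&: 'C(G), e \in Y' :&: 'C(G),
    etaX z / etaX 1%g = etaX' z / etaX' 1%g & etaY e / etaY 1%g = etaY' e / etaY' 1%g]).

(** The brackets of both glued representations with a are determined by these
linear characters, hence agree. *)
Definition joint_twist (a : gal_prod gT) :=
  exists (lam1 : 'CF(X)) (lam2 : 'CF(Y)) (lam2' : 'CF(Y')),
    [/\ lin_over G lam1, lin_over G lam2 & lin_over M lam2'] /\
    [/\ cfact a etaX = etaX * lam1, cfact a etaY = etaY * lam2,
        cfact a etaX' = etaX' * 'Res[X'] lam1, cfact a etaY' = etaY' * lam2'
      & {in Y', lam2 =1 lam2'}].

Definition normalizes_all (a : gal_prod gT) :=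
  [/\ a.1 \in 'N(G)%g, a.1 \in 'N(X)%g & a.1 \in 'N(Y)%g] /\
  [/\ a.1 \in 'N(M)%g, a.1 \in 'N(X')%g & a.1 \in 'N(Y')%g].

(** On A, where D1 and D2 agree, D2 y intertwines D1 and its conjugate by y; so
Schur's lemma applies to the conjugate of D1 on all of U. *)
Let twist_mx (n : nat) (A U V : {group gT}) (D1 : mx_representation algC U n)
    (D2 : mx_representation algC V n) (lam : 'CF(U)) (y : gT) :
    A \subset U -> A \subset V -> A <| V -> {in A, D1 =1 D2} -> V \subset 'N(U) -> y \in V ->
    'Res[A] (cfRepr D1) \in irr A -> lin_over A lam ->
    (cfRepr D1 ^ y)%CF = cfRepr D1 * lam ->
  {in U, forall x, D2 y *m D1 x = (lam x)^-1 *: (D1 (x ^ y^-1)%g *m D2 y)}.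
Proof.
move=> sAU sAV nsAV eqA nUV Vy irrD lin_lam E.
have nUy := fintype.subsetP nUV y Vy.
have repS : mx_repr U (fun x => D1 (x ^ y^-1)%g).
  split=> [|x z Ux Uz]; first by rewrite conj1g repr_mx1.
  by rewrite conjMg (repr_mxM D1) ?memJ_norm ?groupV.
move=> x Ux; have [Llam _] := lin_lam.
have := Schur_lin (S := MxRepresentation repS) (T := D2 y) sAU irrD lin_lam.
move=> ->; rewrite ?scalerA ?mulVf ?scale1r ?lin_char_neq0 //.
- by rewrite -E; apply/cfun_inP=> z Uz; rewrite cfConjgE // !cfunE Uz memJ_norm ?groupV // Uz.
- exact: repr_mx_unit.
move=> g Ag /=; have Agy : (g ^ y^-1)%g \in A.
  by rewrite memJ_norm // groupV (fintype.subsetP (normal_norm nsAV)).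
have [Vg Vgy] := (fintype.subsetP sAV _ Ag, fintype.subsetP sAV _ Agy).
by rewrite !eqA // -!repr_mxM // -conjgCV.
Qed.

(** The factor sets and brackets of the glued representations are given by
linear characters; by the hypotheses [twist'] and [joint_twist] those over M are
restrictions of those over G.  An automorphism b in K' a reduces to a by
[proj_bracket_mul]. *)
Theorem two_sided_glue :
  exists n n' (P : gT -> 'M[algC]_n) (P' : gT -> 'M[algC]_n'),
    [/\ forall k i j, P k i j \in Qab, forall k i j, P' k i j \in Qab,
        gives_gec K chi K' psi P P'
      & forall (a b : gal_prod gT) (m : gT), joint_twist a -> normalizes_all a -> m \in K' ->
          b.1 = (m * a.1)%g -> b.2 = a.2 ->
        exists mu mu', [/\ is_proj_bracket K G P b mu,
          is_proj_bracket K' M P' b mu' & {in K', mu =1 mu'}]].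
Proof.
have sGK := normal_sub nsGK; have sMK' := normal_sub nsMK'.
have [sXK sYK] : X \subset K /\ Y \subset K by rewrite defK mulG_subl mulG_subr.
have [sX'K' sY'K'] : X' \subset K' /\ Y' \subset K' by rewrite defK' mulG_subl mulG_subr.
have sK'K : K' \subset K by rewrite defK defK' mulgSS.
have [||n [D1 [D2 [D1E D2E Q1 Q2 eqG]]]] := common_realization sGX sGY NX NY;
  rewrite ?resX ?resY //.
have [||n' [D1' [D2' [D1'E D2'E Q1' Q2' eqM]]]] := common_realization sMX' sMY' NX' NY';
  rewrite ?resX' ?resY' //.
pose P := glue_repr D1 D2; pose P' := glue_repr D1' D2'.
have QP k i j : P k i j \in Qab.
  rewrite mxE; apply: rpred_sum => l _; apply: rpredM; [exact: Q1 | exact: Q2].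
have QP' k i j : P' k i j \in Qab.
  rewrite mxE; apply: rpred_sum => l _; apply: rpredM; [exact: Q1' | exact: Q2'].
have irr1 : 'Res[G] (cfRepr D1) \in irr G by rewrite D1E resX.
have irr1' : 'Res[M] (cfRepr D1') \in irr M by rewrite D1'E resX'.
have nsGY : G <| Y := normalS sGY sYK nsGK.
have nsMY' : M <| Y' := normalS sMY' sY'K' nsMK'.
have mulK := glueE sGX sGY tiXY eqG; have mulK' := glueE sMX' sMY' tiXY' eqM.
have assP : proj_assoc K chi P by apply: glue_assoc; rewrite ?D1E.
have assP' : proj_assoc K' psi P' by apply: glue_assoc; rewrite ?D1'E.
(* One scalar must serve both sides.  For k1 and k2 in K' it is obtained from
[twist'], otherwise from [twist]. *)
have factor k1 k2 : exists c,
    (k1 \in K -> k2 \in K -> P k1 *m P k2 = c *: P (k1 * k2)%g) /\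
    (k1 \in K' -> k2 \in K' -> P' k1 *m P' k2 = c *: P' (k1 * k2)%g).
  have inK : k1 \in K -> k2 \in K -> exists c, P k1 *m P k2 = c *: P (k1 * k2)%g.
    case/(glue_mem defK)=> x1 [y1 [Xx1 Yy1 ->]] /(glue_mem defK)[x2 [y2 [Xx2 Yy2 ->]]].
    have [lam lin_lam E] := twist Yy1; exists (lam x2)^-1.
    apply: (glue_factor sGX sGY tiXY eqG) => //; first by rewrite memJ_norm // groupV (fintype.subsetP nXY).
    by apply: (twist_mx sGX sGY) => //; rewrite D1E.
  have [K'k1 | K'k1] := boolP (k1 \in K'); last first.
    have [Kk1 | Kk1] := boolP (k1 \in K); last by exists 0.
    have [Kk2 | Kk2] := boolP (k2 \in K); last by exists 0.
    by have [c Dc] := inK Kk1 Kk2; exists c.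
  have [K'k2 | K'k2] := boolP (k2 \in K'); last first.
    have [Kk2 | Kk2] := boolP (k2 \in K); last by exists 0.
    by have [c Dc] := inK (fintype.subsetP sK'K _ K'k1) Kk2; exists c.
  case/(glue_mem defK'): K'k1 => x1 [y1 [Xx1 Yy1 ->]].
  case/(glue_mem defK'): K'k2 => x2 [y2 [Xx2 Yy2 ->]].
  have [lam [lin_lam E E']] := twist' Yy1; exists (lam x2)^-1; split=> _ _.
    have nXy1 := groupVr (fintype.subsetP nXY _ (fintype.subsetP sY'Y _ Yy1)).
    have Xx1' := fintype.subsetP sX'X _ Xx1; have Xx2' := fintype.subsetP sX'X _ Xx2.
    have Yy1' := fintype.subsetP sY'Y _ Yy1; have Yy2' := fintype.subsetP sY'Y _ Yy2.
    apply: (glue_factor sGX sGY tiXY eqG) => //; first by rewrite (memJ_norm _ nXy1).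
    by apply: (twist_mx sGX sGY) => //; rewrite D1E.
  apply: (glue_factor sMX' sMY' tiXY' eqM) => //.
    by rewrite memJ_norm ?groupV ?(fintype.subsetP nXY').
  rewrite -(cfResE _ sX'X Xx2).
  by apply: (twist_mx sMX' sMY') => //; rewrite ?D1'E //; apply: lin_res.
have [F FE] := choice (fun kk : gT * gT => factor kk.1 kk.2).
pose f k1 k2 := F (k1, k2).
have repP : proj_repr K f P.
  split=> [k | k1 k2 Kk1 Kk2]; first exact: (glue_unit sGX sGY tiXY defK eqG).
  by have [->] := FE (k1, k2).
have repP' : proj_repr K' f P'.
  split=> [k | k1 k2 Kk1 Kk2]; first exact: (glue_unit sMX' sMY' tiXY' defK' eqM).
  by have [_ ->] := FE (k1, k2).
exists n, n', P, P'; split=> //.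
  split=> //; first by exists f, f.
  move=> c /central[z [e [-> /finset.setIP[X'z cGz] /finset.setIP[Y'e cGe] Ez Ee]]].
  have [Xz Ye] := (fintype.subsetP sX'X z X'z, fintype.subsetP sY'Y e Y'e).
  have sCC := fintype.subsetP (centS sMG).
  exists ((etaX z / etaX 1%g) * (etaY e / etaY 1%g)).
  rewrite /P mulK // /P' mulK' //; split.
    rewrite (central_scalar sGX irr1 Xz cGz) (central_scalar sGY _ Ye cGe) ?D2E ?resY //.
    by rewrite D1E -scalar_mxM.
  rewrite (central_scalar sMX' irr1' X'z (sCC z cGz)).
  rewrite (central_scalar sMY' _ Y'e (sCC e cGe)) ?D2'E ?resY' //.
  by rewrite D1'E -scalar_mxM Ez Ee.
move=> a b m [lam1 [lam2 [lam2' [[lin1 lin2 lin2'] [a1 a2 a1' a2' eq2]]]]].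
move=> [[nG nX nY] [nM nX' nY']] K'm b1 b2.
(* By [glue_bracket] this is the bracket with a on both sides. *)
pose mu0 k := lam1 (glue_l X Y k) * lam2 ((glue_l X Y k)^-1 * k)%g.
have mu0E : {in X & Y, forall x y, mu0 (x * y)%g = lam1 x * lam2 y}.
  move=> x y Xx Yy; rewrite /mu0; have [g Gg ->] := glue_lP tiXY Xx Yy.
  have [Xg Yg] := (fintype.subsetP sGX g Gg, fintype.subsetP sGY g Gg).
  have -> : ((x * g)^-1 * (x * y) = g^-1 * y)%g by rewrite invMg -mulgA mulKg.
  have [[L1 k1] [L2 k2]] := (lin1, lin2).
  rewrite !lin_charM ?groupV //.
  rewrite (cfker1 (fintype.subsetP k1 g Gg)) (cfker1 (fintype.subsetP k2 _ (groupVr Gg))).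
  by rewrite !lin_char1 // mulr1 mul1r.
have mu0E' : {in X' & Y', forall x y, mu0 (x * y)%g = ('Res[X'] lam1) x * lam2' y}.
  move=> x y Xx Yy; rewrite mu0E ?(fintype.subsetP sX'X) ?(fintype.subsetP sY'Y) //.
  by rewrite cfResE // eq2.
have br : is_proj_bracket K G P a mu0.
  by apply: (glue_bracket sGX sGY tiXY defK eqG sGK irr1 Q1 Q2 nG nX nY lin1 lin2 _ _ mu0E);
    rewrite ?D1E ?D2E.
have br' : is_proj_bracket K' M P' a mu0.
  by apply: (glue_bracket sMX' sMY' tiXY' defK' eqM sMK' irr1' Q1' Q2' nM nX' nY'
    (lin_res lin1) lin2' _ _ mu0E'); rewrite ?D1'E ?D2'E.
have [u [uP uP']] : exists u : {rmorphism algC -> algC},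
    (forall k, map_mx (galC a.2) (P k) = map_mx u (P k)) /\
    (forall k, map_mx (galC a.2) (P' k) = map_mx u (P' k)).
  pose v (i : ((gT * 'I_n * 'I_n) + (gT * 'I_n' * 'I_n'))%type) : algC := match i with
    | inl j => P j.1.1 j.1.2 j.2 | inr j => P' j.1.1 j.1.2 j.2 end.
  have [|u Du] := @galC_aut_fin a.2 _ v; first by case=> j; [apply: QP | apply: QP'].
  exists u; split=> k; apply/matrixP=> i j; rewrite [LHS]mxE [RHS]mxE.
    exact: (Du (inl (k, i, j))).
  exact: (Du (inr (k, i, j))).
have nK : a.1 \in 'N(K)%g by rewrite defK -cycle_subG normsM ?cycle_subG.
have nK' : a.1 \in 'N(K')%g by rewrite defK' -cycle_subG normsM ?cycle_subG.
have Km := fintype.subsetP sK'K m K'm.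
exists (fun x => u (f ((x ^ a.1^-1) ^ m^-1)%g m / f m (x ^ a.1^-1)%g) * mu0 x).
exists (fun x => u (f ((x ^ a.1^-1) ^ m^-1)%g m / f m (x ^ a.1^-1)%g) * mu0 x).
split=> //.
  exact: (proj_bracket_mul nsGK irr_chi assP repP Km b1 b2 nK nG (fun x _ => uP x) br).
exact: (proj_bracket_mul nsMK' irr_psi assP' repP' K'm b1 b2 nK' nM (fun x _ => uP' x) br').
Qed.

End TwoSided.

(** * The action on characters *)

Lemma galCD s : {in Qab &, {morph galC s : x y / x + y}}.
Proof.
move=> x y Qx Qy; rewrite -[x](insubdK (0 : qab) Qx) -[y](insubdK (0 : qab) Qy).
by rewrite -[X in galC s X]/(val (insubd (0 : qab) x + insubd 0 y)) !galC_val rmorphD.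
Qed.

(** Character values are sums of roots of unity of order dividing that of the
ambient group, so one automorphism of the algebraic numbers represents s on
the characters of all its subgroups. *)
Lemma galC_char (gT : finGroupType) s : exists u : {rmorphism algC -> algC},
  forall (B : {group gT}) (phi : 'CF(B)) x, phi \is a character ->
    galC s (phi x) = u (phi x).
Proof.
have [u Du] := galC_aut_unity s (cardG_gt0 [set: gT]%G).
exists u => B phi x Nphi.
have [Bx | notBx] := boolP (x \in B); last by rewrite cfun0 // galC0 rmorph0.
have sXB : <[x]>%g \subset B by rewrite cycle_subG.
rewrite -(cfResE phi sXB (cycle_id x)).
have [r ->] := char_sum_irr (cfRes_char <[x]>%G Nphi).
have Qi (i : Iirr <[x]>%G) : 'chi_i x \in Qab by rewrite char_Qab ?irr_char.
elim: r => [|i r IHr]; first by rewrite big_nil cfunE galC0 rmorph0.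
rewrite big_cons cfunE galCD ?Qi //; last first.
  by rewrite sum_cfunE rpred_sum // => j _; apply: Qi.
rewrite rmorphD IHr; congr (_ + _); apply: Du.
have Li : 'chi_i \is a linear_char by apply/char_abelianP; apply: cycle_abelian.
rewrite -lin_charX ?cycle_id // (_ : x ^+ _ = 1)%g ?lin_char1 //.
by apply/eqP; rewrite -order_dvdn order_dvdG ?finset.inE.
Qed.

Section Action.

Variable gT : finGroupType.
Implicit Types (B : {group gT}) (a b : gal_prod gT).

Lemma cfact_aut a : exists u : {rmorphism algC -> algC},
  forall B (phi : 'CF(B)), phi \is a character -> cfact a phi = cfAut u (phi ^ a.1)%CF.
Proof.
have [u Du] := galC_char gT a.2; exists u => B phi Nphi.
by apply/cfunP=> x; rewrite !cfunE Du ?cfConjg_char.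
Qed.

Lemma cfact_char B a (phi : 'CF(B)) : phi \is a character -> cfact a phi \is a character.
Proof.
by have [u Du] := cfact_aut a; move=> Nphi; rewrite Du // cfAut_char cfConjg_char.
Qed.

Lemma cfact_irr B a (phi : 'CF(B)) : phi \in irr B -> cfact a phi \in irr B.
Proof.
have [u Du] := cfact_aut a; case/irrP=> i ->; rewrite Du ?irr_char //.
by rewrite cfAut_irr cfConjg_irr ?mem_irr.
Qed.

Lemma cfact_mulg B a b c (phi : 'CF(B)) :
    a.1 \in 'N(B)%g -> b.1 \in 'N(B)%g -> c.1 = (a.1 * b.1)%g -> c.2 = (a.2 * b.2)%g ->
  cfact c phi = cfact b (cfact a phi).
Proof.
move=> nBa nBb c1 c2; apply/cfunP=> x.
by rewrite !cfactE ?c1 ?groupM // c2 invMg conjgM galC_M.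
Qed.

Lemma cfact_conj B (y : gT) (phi : 'CF(B)) : phi \is a character ->
  cfact (y, 1%g) phi = (phi ^ y)%CF.
Proof. by move=> Nphi; apply/cfunP=> x; rewrite cfunE galC_1 ?char_Qab ?cfConjg_char. Qed.

Lemma cfact_one B (phi : 'CF(B)) : phi \is a character -> cfact (1%g, 1%g) phi = phi.
Proof. by move=> Nphi; rewrite cfact_conj // cfConjgJ1. Qed.

Lemma cfact_inj B a (phi psi : 'CF(B)) : phi \is a character -> psi \is a character ->
  a.1 \in 'N(B)%g -> cfact a phi = cfact a psi -> phi = psi.
Proof.
move=> Nphi Npsi nBa E; pose b : gal_prod gT := (a.1^-1, a.2^-1)%g.
have nBb : b.1 \in 'N(B)%g by rewrite groupV.
have invE (xi : 'CF(B)) : xi \is a character -> cfact b (cfact a xi) = xi.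
  move=> Nxi; rewrite -(cfact_mulg (c := (1%g, 1%g))) /= ?mulgV //.
  exact: cfact_one.
by rewrite -[LHS]invE // E invE.
Qed.

Lemma cfact_Res B (H : {group gT}) a (phi : 'CF(B)) : H \subset B ->
    a.1 \in 'N(B)%g -> a.1 \in 'N(H)%g ->
  cfact a ('Res[H] phi) = 'Res[H] (cfact a phi).
Proof.
move=> sHB nB nH; apply/cfun_inP=> x Hx.
by rewrite cfResE // !cfactE // cfResE ?memJ_norm ?groupV.
Qed.

Lemma cfact_Ind B (H : {group gT}) a (phi : 'CF(H)) : phi \is a character ->
    a.1 \in 'N(B)%g -> a.1 \in 'N(H)%g ->
  cfact a ('Ind[B] phi) = 'Ind[B] (cfact a phi).
Proof.
have [u Du] := cfact_aut a; move=> Nphi nB nH.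
by rewrite !Du ?cfInd_char // cfConjgInd_norm // cfAutInd.
Qed.

Lemma cfact_lies_over (N K : {group gT}) a (theta : 'CF(K)) (chi : 'CF(N)) :
    theta \is a character -> chi \is a character -> N \subset K ->
    a.1 \in 'N(N)%g -> a.1 \in 'N(K)%g ->
  lies_over theta chi -> lies_over (cfact a theta) (cfact a chi).
Proof.
move=> Nth Nchi sNK nN nK; rewrite /lies_over -cfact_Res //.
have [u Du] := cfact_aut a; rewrite !Du ?cfRes_char //.
by rewrite cfdot_aut_char ?cfConjg_char // cfConjg_iso fmorph_eq0.
Qed.

(** The field automorphism in a commutes with conjugation, so a carries phi ^ x
to the conjugate by x ^ a.1 of the image of phi. *)
Lemma norm_inertia_cfact B a (phi : 'CF(B)) : phi \is a character -> a.1 \in 'N(B)%g ->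
  cfact a phi = phi -> a.1 \in 'N('I[phi])%g.
Proof.
move=> Nphi nB fixa; rewrite finset.inE; apply/fintype.subsetP=> _ /imsetP[x Ix ->].
have nBx : x \in 'N(B)%g := fintype.subsetP (norm_inertia phi) x Ix.
rewrite finset.inE groupJ //=; apply/eqP.
rewrite -[in LHS]fixa -cfact_conj ?cfact_char //.
rewrite -(cfact_mulg (c := ((x * a.1)%g, a.2))) /= ?mulg1 ?groupJ // -?conjgC //.
rewrite (cfact_mulg (a := (x, 1%g)) (b := a)) /= ?mul1g //.
by rewrite cfact_conj // inertiaJ.
Qed.

End Action.

(** Where N acts irreducibly, its centralizer acts by scalars. *)
Lemma central_constt (gT : finGroupType) (N K C : {group gT}) (eta : 'CF(K)) (i : Iirr C) :
    N \subset K -> eta \is a character -> 'Res[N] eta \in irr N -> C \subset 'C_K(N)%g ->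
    i \in irr_constt ('Res[C] eta) ->
  {in C, forall c, eta c / eta 1%g = 'chi_i c}.
Proof.
move=> sNK Neta irrN; rewrite finset.subsetI => /andP[sCK cNC] Ci.
have [rG DrG] := char_reprP Neta; move: DrG irrN Ci Neta => -> irrN Ci Neta.
have nz1 : cfRepr rG 1%g != 0.
  rewrite cfRepr1 pnatr_eq0 -lt0n.
  by rewrite -(cfRepr_Res rG sNK) in irrN; apply: cfRepr_irr_gt0 irrN.
have sCZ : C \subset 'Z(cfRepr rG)%CF.
  rewrite cfcenter_repr; apply/fintype.subsetP=> c Cc; rewrite finset.inE.
  rewrite (fintype.subsetP sCK) //=; apply/is_scalar_mxP.
  exists (cfRepr rG c / cfRepr rG 1%g).
  by apply: (central_scalar sNK irrN); rewrite ?(fintype.subsetP sCK) ?(fintype.subsetP cNC).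
have [lam Llam Dlam] := cfcenter_Res (cfRepr rG).
have sZK : 'Z(cfRepr rG)%CF \subset K by apply: cfcenter_sub.
have DC : 'Res[C] (cfRepr rG) = cfRepr rG 1%g *: 'Res[C] lam.
  by rewrite -(cfResRes _ sCZ sZK) Dlam linearZ.
have /irrP[j Dj] := lin_char_irr (cfRes_lin_char C Llam).
move: Ci; rewrite irr_consttE DC Dj cfdotZl cfdot_irr => nz.
have <- : j = i by apply: contraNeq nz => /negPf->; rewrite mulr0.
move=> c Cc; rewrite -(cfResE _ sCK Cc) DC Dj cfunE mulrAC divff ?mul1r //.
Qed.

(** * The configuration of groups *)

Section Groups.

Variables (gT : finGroupType) (ell : nat) (G Q M Gc E A GE Mc Mh : {group gT}).
Hypotheses (sylQ : ell.-Sylow(G) Q) (properM : M \proper G).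
Hypotheses (defA : Gc ><| E = A) (defGE : GE :=: (G <*> E)%g).
Hypotheses (defMc : Mc :=: 'N_Gc(M)%g) (defMh : Mh :=: 'N_GE(M)%g).
Hypotheses (nsGGc : G <| Gc) (nsGA : G <| A).
Hypotheses (M_stable : 'N_A(Q)%g \subset 'N(M)%g) (sNQM : 'N_G(Q)%g \subset M).

Local Notation J := (Mc <*> Mh)%G.

Let sMG : M \subset G. Proof. exact: proper_sub. Qed.
Let sGGc := normal_sub nsGGc.
Let sGA := normal_sub nsGA.

Let sGcA : Gc \subset A.
Proof. by case/sdprod_context: defA => /andP[]. Qed.
Let sEA : E \subset A. Proof. by case/sdprod_context: defA. Qed.

Lemma conf_normal_Gc : Gc <| A.
Proof. by case/sdprod_context: defA. Qed.

Lemma conf_GE : GE :=: (G * E)%g.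
Proof.
by rewrite defGE norm_joinEr // (fintype.subset_trans sEA) ?normal_norm.
Qed.

Lemma conf_sGGE : G \subset GE. Proof. by rewrite conf_GE mulG_subl. Qed.
Lemma conf_sEGE : E \subset GE. Proof. by rewrite conf_GE mulG_subr. Qed.
Lemma conf_sGEA : GE \subset A. Proof. by rewrite conf_GE mul_subG. Qed.

Lemma conf_A : A :=: (Gc * GE)%g.
Proof.
by rewrite conf_GE mulgA (mulGSid sGGc); case/sdprodP: defA => _ <-.
Qed.

Lemma conf_tiGcGE : Gc :&: GE = G.
Proof.
rewrite conf_GE finset.setIC -group_modl // finset.setIC.
by case/sdprod_context: defA => _ _ _ _ ->; rewrite mulg1.
Qed.

Lemma conf_sQM : Q \subset M.
Proof.
apply: fintype.subset_trans sNQM; rewrite finset.subsetI normG andbT.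
by have /and3P[] := sylQ.
Qed.

(** M is self-normalizing in G, as a conjugate of Q in M is conjugate to Q
within M. *)
Lemma conf_NGM : 'N_G(M)%g = M.
Proof.
apply/eqP; rewrite finset.eqEsubset finset.subsetI sMG normG !andbT.
have nsMN : M <| 'N_G(M)%g by rewrite normalSG.
have sylQM : ell.-Sylow(M) Q := pHall_subl conf_sQM sMG sylQ.
rewrite -{1}(Frattini_arg nsMN sylQM) mul_subG //.
by apply: fintype.subset_trans sNQM; rewrite finset.setSI ?finset.subsetIl.
Qed.

(** The Frattini argument for Q, whose normalizer in A normalizes M. *)
Lemma conf_frattini : (G * 'N_A(M))%g = A.
Proof.
apply/eqP; rewrite finset.eqEsubset mul_subG ?finset.subsetIl //=.
rewrite -{1}(Frattini_arg nsGA sylQ) mulgS // finset.subsetI finset.subsetIl.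
exact: M_stable.
Qed.

Lemma conf_McG : Mc :&: G = M.
Proof.
rewrite defMc -[RHS]conf_NGM; apply/finset.setP=> x; rewrite !finset.in_setI.
by case: (boolP (x \in G)) => [/(fintype.subsetP sGGc)->|_]; rewrite ?andbT ?andbF.
Qed.

Lemma conf_sMMc : M \subset Mc. Proof. by rewrite -conf_McG finset.subsetIl. Qed.
Lemma conf_sMcGc : Mc \subset Gc. Proof. by rewrite defMc finset.subsetIl. Qed.
Lemma conf_sMhGE : Mh \subset GE. Proof. by rewrite defMh finset.subsetIl. Qed.

Lemma conf_sMMh : M \subset Mh.
Proof. by rewrite defMh finset.subsetI normG (fintype.subset_trans sMG conf_sGGE). Qed.

Lemma conf_nsMMc : M <| Mc.
Proof. by rewrite /normal conf_sMMc defMc finset.subsetIr. Qed.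

Lemma conf_nsMMh : M <| Mh.
Proof. by rewrite /normal conf_sMMh defMh finset.subsetIr. Qed.

Lemma conf_Gc : (G * Mc)%g = Gc.
Proof.
have -> : Mc :=: 'N_A(M) :&: Gc.
  rewrite defMc; apply/finset.setP=> x; rewrite !finset.in_setI.
  by case: (boolP (x \in Gc)) => [/(fintype.subsetP sGcA)->|_]; rewrite ?andbT ?andbF.
by rewrite group_modl // conf_frattini (finset.setIidPr sGcA).
Qed.

Lemma conf_defGE : (G * Mh)%g = GE.
Proof.
have -> : Mh :=: 'N_A(M) :&: GE.
  rewrite defMh; apply/finset.setP=> x; rewrite !finset.in_setI.
  by case: (boolP (x \in GE)) => [/(fintype.subsetP conf_sGEA)->|_]; rewrite ?andbT ?andbF.
by rewrite group_modl ?conf_sGGE // conf_frattini (finset.setIidPr conf_sGEA).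
Qed.

Lemma conf_tiMcMh : Mc :&: Mh = M.
Proof.
rewrite -[RHS]conf_NGM -conf_tiGcGE defMc defMh; apply/finset.setP=> x.
by rewrite !finset.in_setI; case: (x \in 'N(M)%g); rewrite ?andbT ?andbF.
Qed.

Lemma conf_nMcMh : Mh \subset 'N(Mc).
Proof.
rewrite defMc normsI //; last by rewrite defMh finset.subIset // normG orbT.
apply: fintype.subset_trans (normal_norm conf_normal_Gc).
exact: fintype.subset_trans conf_sMhGE conf_sGEA.
Qed.

Lemma conf_defJ : J :=: (Mc * Mh)%g.
Proof. by rewrite /= norm_joinEr // conf_nMcMh. Qed.

Lemma conf_J : J :=: 'N_A(M)%g.
Proof.
apply/eqP; rewrite finset.eqEsubset; apply/andP; split.
  rewrite join_subG !finset.subsetI (fintype.subset_trans conf_sMcGc sGcA) /=.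
  rewrite (fintype.subset_trans conf_sMhGE conf_sGEA) /=.
  by rewrite {1}defMc defMh !finset.subsetIr.
have AE : A :=: (G * J)%g.
  have comm : (Mc * G = G * Mc)%g.
    by apply: normC; apply: fintype.subset_trans conf_sMcGc (normal_norm nsGGc).
  rewrite conf_A -conf_Gc -conf_defGE conf_defJ -mulgA (mulgA Mc) comm -mulgA.
  by rewrite mulgA mulGid.
have sJN : J \subset 'N(M).
  by rewrite join_subG {1}defMc defMh !finset.subsetIr.
rewrite {1}AE finset.setIC -group_modr // finset.setIC conf_NGM mul_subG //.
by rewrite (fintype.subset_trans conf_sMMc) // joing_subl.
Qed.

Lemma conf_mem_A (x : gT) : x \in A -> exists g j : gT, [/\ g \in G, j \in J & x = (g * j)%g].
Proof.
by rewrite -[gval A]conf_frattini -conf_J => /mulsgP[g j Gg Jj ->]; exists g, j.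
Qed.

Lemma conf_mem_J (x : gT) : x \in J -> exists m y : gT, [/\ m \in Mc, y \in Mh & x = (m * y)%g].
Proof. by rewrite conf_defJ => /mulsgP[m y Mm My ->]; exists m, y. Qed.

(** Only these consequences of the hypotheses on the groups matter for
characters: A is the product of G and of the normalizer Mc <*> Mh of M in A, and
Gc / G, GE / G are identified with Mc / M, Mh / M. *)
Record configuration : Prop := Configuration {
  cf_nsGGc : G <| Gc; cf_nsGA : G <| A; cf_nsGcA : Gc <| A;
  cf_sGGE : G \subset GE; cf_sEGE : E \subset GE; cf_sGEA : GE \subset A;
  cf_tiGcGE : Gc :&: GE = G; cf_sMG : M \subset G; cf_McG : Mc :&: G = M;
  cf_nsMMc : M <| Mc; cf_nsMMh : M <| Mh;
  cf_sMcGc : Mc \subset Gc; cf_sMhGE : Mh \subset GE;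
  cf_Mc : Mc :=: 'N_Gc(M)%g; cf_Mh : Mh :=: 'N_GE(M)%g;
  cf_Gc : (G * Mc)%g = Gc; cf_GE : (G * Mh)%g = GE;
  cf_tiMcMh : Mc :&: Mh = M; cf_nMcMh : Mh \subset 'N(Mc);
  cf_J : J :=: 'N_A(M)%g; cf_GM : G :&: J = M;
  cf_mem_A : forall x : gT, x \in A ->
    exists g j : gT, [/\ g \in G, j \in J & x = (g * j)%g];
  cf_mem_J : forall x : gT, x \in J ->
    exists m y : gT, [/\ m \in Mc, y \in Mh & x = (m * y)%g]
}.

Lemma conf_GJ : G :&: J = M.
Proof.
rewrite conf_J -[RHS]conf_NGM; apply/finset.setP=> x; rewrite !finset.in_setI.
by case: (boolP (x \in G)) => [/(fintype.subsetP sGA)->|_]; rewrite ?andbT ?andbF.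
Qed.

Lemma configurationP : configuration.
Proof.
split=> //; [ exact: conf_normal_Gc | exact: conf_sGGE | exact: conf_sEGE
  | exact: conf_sGEA | exact: conf_tiGcGE | exact: conf_McG | exact: conf_nsMMc
  | exact: conf_nsMMh | exact: conf_sMcGc | exact: conf_sMhGE | exact: conf_Gc
  | exact: conf_defGE | exact: conf_tiMcMh | exact: conf_nMcMh | exact: conf_J
  | exact: conf_GJ | exact: conf_mem_A | exact: conf_mem_J ].
Qed.

End Groups.

(** * Orbit sums under a group of field automorphisms *)

Section GalSum.

Variables (gT : finGroupType) (N : {group gT}) (HH : set galQab) (phi : 'CF(N)).
Hypotheses (HH_one : HH 1%g) (HH_inv : forall s, HH s -> HH s^-1%g)
  (HH_mul : forall s t, HH s -> HH t -> HH (s * t)%g).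
Hypothesis irr_phi : phi \in irr N.

Let P (i : Iirr N) := `[< exists2 s, HH s & 'chi_i = cfGal s phi >].

Let sumE : gal_orbit_sum HH phi = \sum_(i | P i) 'chi_i.
Proof. by rewrite /gal_orbit_sum big_tuple. Qed.

Let dotE j : '[gal_orbit_sum HH phi, 'chi_j] = (P j)%:R.
Proof.
rewrite sumE cfdot_suml (bigID (pred1 j)) /= addrC big1 ?add0r => [|i /andP[_ nij]].
  have [Pj | nPj] := boolP (P j).
    rewrite (eq_bigl (pred1 j)) ?big_pred1_eq ?cfnorm_irr // => i /=.
    by case: eqP => [->|_]; rewrite ?andbF ?Pj.
  by rewrite big1 // => i /andP[Pi /eqP E]; rewrite -E Pi in nPj.
by rewrite cfdot_irr (negPf nij).
Qed.

Let Nphi : phi \is a character. Proof. exact: irrWchar. Qed.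

Lemma cfGal_act s (x : gT) : x \in 'N(N)%g ->
  (phi ^ x)%CF = cfGal s phi <-> cfact (x, s^-1%g) phi = phi.
Proof.
move=> nNx; pose b : gal_prod gT := (x, s^-1%g); pose c : gal_prod gT := (1%g, s).
have cGal (xi : 'CF(N)) : cfact c xi = cfGal s xi by rewrite /cfact cfConjgJ1.
have bc (xi : 'CF(N)) : xi \is a character -> cfact c (cfact b xi) = (xi ^ x)%CF.
  move=> Nxi; rewrite -cfact_conj //; apply/esym/cfact_mulg; rewrite ?group1 //= ?mulg1 //.
  by rewrite mulVg.
split=> [E | E]; last by rewrite -bc // -/b E cGal.
apply: (cfact_inj (a := c)); rewrite ?group1 ?cfact_char //.
by rewrite bc // E cGal.
Qed.

(** All multiplicities in the orbit sum are 0 or 1, so x fixes the sum if and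
only if it carries phi to one of the summands. *)
Lemma gal_sum_stab (x : gT) : x \in 'N(N)%g ->
  x \in 'I[gal_orbit_sum HH phi]%g <->
  exists2 s, HH s & cfact (x, s) phi = phi.
Proof.
move=> nNx; have [j Dj] := irrP irr_phi.
rewrite finset.inE nNx /=; split=> [/eqP E | [s HHs E]].
  have Pj : P j by apply/asboolP; exists 1%g; rewrite // -Dj; have := cfact_one Nphi;
    rewrite /cfact cfConjgJ1 => ->.
  have: '[gal_orbit_sum HH phi, (phi ^ x)%CF] != 0.
    by rewrite -{1}E cfConjg_iso [X in '[_, X]]Dj dotE Pj oner_eq0.
  have /irrP[k Dk] : (phi ^ x)%CF \in irr N by rewrite cfConjg_irr.
  rewrite Dk dotE pnatr_eq0 eqb0 negbK => /asboolP[s HHs]; rewrite -Dk.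
  by move/(cfGal_act s nNx) => E'; exists s^-1%g; first exact: HH_inv.
have Ex : (phi ^ x)%CF = cfGal s^-1%g phi by apply/cfGal_act; rewrite ?invgK.
have PJ i : P i -> P (conjg_Iirr i x).
  case/asboolP=> t HHt Di; apply/asboolP; exists (s^-1 * t)%g; first by apply: HH_mul => //; apply: HH_inv.
  rewrite conjg_IirrE Di.
  have -> : (cfGal t phi ^ x)%CF = cfGal t (phi ^ x)%CF.
    by apply/cfunP=> y; rewrite cfConjgE // !cfunE cfConjgE.
  by rewrite Ex; apply/cfunP=> y; rewrite !cfunE galC_M.
have PJE i : P i = P (conjg_Iirr i x).
  apply/idP/idP; first exact: PJ.
  have inj := @conjg_Iirr_inj _ N x.
  have subP : [set conjg_Iirr i x | i in [set i | P i]]%SET \subset [set i | P i]%SET.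
    by apply/fintype.subsetP=> _ /imsetP[k Pk ->]; rewrite finset.inE in Pk; rewrite finset.inE PJ.
  have := (subset_leqif_cards subP).2; rewrite card_imset // eqxx => /esym/eqP eqS Pi.
  have : conjg_Iirr i x \in [set i | P i]%SET by rewrite finset.inE.
  by rewrite -eqS => /imsetP[k Pk /inj->]; rewrite finset.inE in Pk.
apply/eqP; rewrite sumE raddf_sum /= [RHS](reindex_inj (@conjg_Iirr_inj _ N x)) /=.
by apply: eq_big => [i | i _]; rewrite ?conjg_IirrE -?PJE.
Qed.

Lemma inertia_gal_sum : 'I[phi] \subset 'I[gal_orbit_sum HH phi].
Proof.
apply/fintype.subsetP=> x Ix; have nNx := fintype.subsetP (norm_inertia phi) x Ix.
by apply/gal_sum_stab => //; exists 1%g; rewrite // cfact_conj // inertiaJ.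
Qed.

End GalSum.

(** * The character correspondence *)

Lemma transversalP (gT : finGroupType) (B Y : {group gT}) (X X0 : set 'CF(B)) :
    transversal_in Y X X0 ->
  (forall phi, X phi -> exists2 y, y \in Y & X0 (phi ^ y)%CF) /\
  (forall phi y, X0 phi -> y \in Y -> X0 (phi ^ y)%CF -> (phi ^ y)%CF = phi).
Proof.
case=> sX0 tr; split=> [phi /tr[phi0 [[X0phi0 [y Yy D]] _]] | phi y X0phi Yy X0phiy].
  by exists y; rewrite -?D.
have [phi0 [_ uni]] := tr _ (sX0 _ X0phi).
rewrite -(uni (phi ^ y)%CF); last by split=> //; exists y.
by apply: uni; split=> //; exists 1%g; rewrite ?cfConjgJ1.
Qed.

Section Correspondence.

Variables (gT : finGroupType) (G M Gc E A GE Mc Mh : {group gT}).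
Hypothesis cf : configuration G M Gc E A GE Mc Mh.
Hypothesis abGc : abelian (Gc / G)%g.
Local Notation J := (Mc <*> Mh)%G.

Variables (HH : set galQab) (B : set (gal_prod gT)).
Hypotheses (B_one : B (1%g, 1%g))
  (B_inv : forall b, B b -> exists b', [/\ B b', b'.1 = b.1^-1%g & b'.2 = b.2^-1%g]).
Hypotheses (B_J : forall b, B b -> b.1 \in J)
  (B_normalizes : forall b, B b -> b.1 \in 'N(Mh)%g).
Local Notation S := (mul_set Mh B).
Hypothesis factor_MhB : forall a : gal_prod gT, a.1 \in J -> HH a.2 ->
  exists (m : gT) (a' : gal_prod gT), [/\ m \in Mc, S a', a.1 = (m * a'.1)%g & a.2 = a'.2].

Variables (GG GG0 : set 'CF(G)) (MM MM0 : set 'CF(M)).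
Hypotheses (GG_irr : GG `<=` [set chi | chi \in irr G])
  (MM_irr : MM `<=` [set psi | psi \in irr M]).
Hypotheses (maxext_glo : maximal_extendibility Gc GG)
  (maxext_loc : maximal_extendibility Mc MM).
Hypotheses (GG0_transversal : transversal_in Mc GG GG0)
  (MM0_transversal : transversal_in Mc MM MM0).
Hypotheses (GG0_stable : conj_stable Mh GG0) (MM0_stable : conj_stable Mh MM0).
Hypotheses (B_GG0 : gal_stable B GG0) (B_MM0 : gal_stable B MM0).

Variables (GGc : set 'CF(Gc)) (MMc : set 'CF(Mc)) (Omc : 'CF(Gc) -> 'CF(Mc)).
Hypotheses (defGGc : GGc = Irr_over Gc GG) (defMMc : MMc = Irr_over Mc MM).
Hypothesis Omc_bij : set_bij GGc MMc Omc.
Hypothesis Omc_lin : forall (lambda : 'CF(Gc)) (mu : 'CF(Mc)) (theta : 'CF(Gc)),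
  lambda \is a linear_char -> G \subset cfker lambda ->
  mu \is a linear_char -> M \subset cfker mu ->
  'Res[Mc] lambda = mu -> GGc theta -> Omc (lambda * theta) = mu * Omc theta.
Hypothesis Omc_equiv : forall (a : gal_prod gT) (theta : 'CF(Gc)),
  S a -> GGc theta -> Omc (cfact a theta) = cfact a (Omc theta).

Hypotheses (GG_conj : conj_stable Mc GG) (MM_conj : conj_stable Mc MM).

Let sJA : J \subset A. Proof. by rewrite (cf_J cf) finset.subsetIl. Qed.
Let sMcJ : Mc \subset J. Proof. exact: joing_subl. Qed.
Let sMhJ : Mh \subset J. Proof. exact: joing_subr. Qed.

Lemma norm_J (x : gT) : x \in J ->
  [/\ x \in 'N(G)%g, x \in 'N(M)%g, x \in 'N(Gc)%g & x \in 'N(Mc)%g].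
Proof.
move=> Jx; have Ax := fintype.subsetP sJA x Jx.
have nMx : x \in 'N(M)%g by move: Jx; rewrite (cf_J cf) => /finset.setIP[].
have nGcx := fintype.subsetP (normal_norm (cf_nsGcA cf)) x Ax.
split=> //; first exact: (fintype.subsetP (normal_norm (cf_nsGA cf))).
rewrite (cf_Mc cf) -cycle_subG normsI ?cycle_subG //.
by rewrite -cycle_subG norms_norm ?cycle_subG.
Qed.

Lemma abMc : abelian (Mc / M)%g.
Proof.
rewrite -(cf_McG cf) /abelian; apply: quotient_cents2r.
rewrite finset.subsetI; apply/andP; split.
  by rewrite commg_subl normG.
apply: fintype.subset_trans (der1_min (normal_norm (cf_nsGGc cf)) abGc).
by apply: commgSS; apply: (cf_sMcGc cf).
Qed.

Lemma S_J a : S a -> a.1 \in J.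
Proof.
case=> y My [b Bb ->].
exact: (groupM (fintype.subsetP sMhJ y My) (B_J Bb)).
Qed.

Lemma S_norm_Mh a : S a -> a.1 \in 'N(Mh)%g.
Proof.
case=> y My [b Bb ->].
exact: (groupM (fintype.subsetP (normG _) y My) (B_normalizes Bb)).
Qed.

Lemma S_norm_GE a : S a -> a.1 \in 'N(GE)%g.
Proof.
move=> Sa; have [nG _ _ _] := norm_J (S_J Sa).
by rewrite -(cf_GE cf) -cycle_subG normsM ?cycle_subG ?S_norm_Mh.
Qed.

Lemma S_Mh (y : gT) : y \in Mh -> S (y, 1%g).
Proof. by move=> My; exists y => //; exists (1%g, 1%g) => //; congr (_, _); rewrite mulg1. Qed.

Lemma GG0_sub chi : GG0 chi -> GG chi. Proof. by case: GG0_transversal => + _; apply. Qed.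
Lemma MM0_sub psi : MM0 psi -> MM psi. Proof. by case: MM0_transversal => + _; apply. Qed.

Lemma GG_char chi : GG chi -> chi \is a character.
Proof. by move/GG_irr=> irr_chi; apply: irrWchar. Qed.
Lemma MM_char psi : MM psi -> psi \is a character.
Proof. by move/MM_irr=> irr_psi; apply: irrWchar. Qed.

Lemma S_act (N : {group gT}) (a : gal_prod gT) (phi : 'CF(N)) :
    S a -> J \subset 'N(N)%g -> phi \is a character ->
  exists y b, [/\ y \in Mh, B b, a.1 = (y * b.1)%g, a.2 = b.2
                 & cfact a phi = cfact b (phi ^ y)%CF].
Proof.
case=> y My [b Bb ->] nNJ Nphi; exists y, b; split=> //=; first by rewrite mul1g.
rewrite (cfact_mulg (a := (y, 1%g)) (b := b)) ?cfact_conj //=.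
  exact: (fintype.subsetP nNJ _ (fintype.subsetP sMhJ _ My)).
exact: (fintype.subsetP nNJ _ (B_J Bb)).
Qed.

Let nGJ : J \subset 'N(G)%g. Proof. by apply/fintype.subsetP=> x /norm_J[]. Qed.
Let nMJ : J \subset 'N(M)%g. Proof. by apply/fintype.subsetP=> x /norm_J[]. Qed.

Lemma S_GG0 a chi : S a -> GG0 chi -> GG0 (cfact a chi).
Proof.
move=> Sa GGchi; have [y [b [My Bb _ _ ->]]] := S_act Sa nGJ (GG_char (GG0_sub GGchi)).
by apply: B_GG0 => //; apply: GG0_stable.
Qed.

Lemma S_MM0 a psi : S a -> MM0 psi -> MM0 (cfact a psi).
Proof.
move=> Sa MMpsi; have [y [b [My Bb _ _ ->]]] := S_act Sa nMJ (MM_char (MM0_sub MMpsi)).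
by apply: B_MM0 => //; apply: MM0_stable.
Qed.
Lemma GGcP theta : GGc theta <->
  theta \in irr Gc /\ exists2 chi, GG chi & lies_over theta chi.
Proof.
rewrite defGGc; split=> [[irr_th [i Ci GGi]] | [irr_th [chi GGchi over]]].
  by split=> //; exists 'chi_i; rewrite // /lies_over -irr_consttE.
split=> //; have /irrP[i Di] := GG_irr GGchi.
by exists i; rewrite ?irr_consttE -Di.
Qed.

Lemma MMcP theta : MMc theta <->
  theta \in irr Mc /\ exists2 psi, MM psi & lies_over theta psi.
Proof.
rewrite defMMc; split=> [[irr_th [i Ci MMi]] | [irr_th [psi MMpsi over]]].
  by split=> //; exists 'chi_i; rewrite // /lies_over -irr_consttE.
split=> //; have /irrP[i Di] := MM_irr MMpsi.
by exists i; rewrite ?irr_consttE -Di.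
Qed.

Lemma lies_over_conjg (N K : {group gT}) (theta : 'CF(K)) (chi : 'CF(N)) y :
  y \in K -> lies_over theta chi -> lies_over theta (chi ^ y)%CF.
Proof. by move=> Ky; rewrite /lies_over cfdot_Res_conjg. Qed.

Lemma irr_over (N K : {group gT}) (chi : 'CF(N)) : N \subset K -> chi \in irr N ->
  exists2 theta : 'CF(K), theta \in irr K & lies_over theta chi.
Proof.
move=> sNK /irrP[t ->]; have [i] := constt_cfInd_irr t sNK.
by rewrite constt_Ind_Res => it; exists 'chi_i; rewrite ?mem_irr // /lies_over -irr_consttE.
Qed.

Let nsGGc := cf_nsGGc cf.
Let nsMMc := cf_nsMMc cf.
Let sMcGc := cf_sMcGc cf.

(** The choice of theta does not matter: two choices differ by a linear
character of Gc / G, and their images under Omc by its restriction to Mc. *)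
Definition matched0 chi psi := [/\ GG0 chi, MM0 psi
  & exists2 theta, theta \in irr Gc & lies_over theta chi /\ lies_over (Omc theta) psi].

Lemma Omc_irr theta : GGc theta -> Omc theta \in irr Mc.
Proof. by case: Omc_bij => hom _ _ /hom /MMcP[]. Qed.

Lemma lin_over_Mc (lam : 'CF(Gc)) : lin_over G lam -> lin_over M ('Res[Mc] lam).
Proof.
case=> Llam klam; split; first exact: cfRes_lin_char.
rewrite cfker_Res ?lin_charW // finset.subsetI (normal_sub nsMMc).
exact: fintype.subset_trans (cf_sMG cf) klam.
Qed.

(** Linear characters of Mc / M come from Gc / G, since Mc :&: G = M. *)
Lemma lin_over_Gc (mu : 'CF(Mc)) : lin_over M mu ->
  exists2 lam : 'CF(Gc), lin_over G lam & 'Res[Mc] lam = mu.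
Proof.
by case=> Lmu kmu; apply: extend_lin_over nsGGc abGc sMcGc Lmu _; rewrite (cf_McG cf).
Qed.

Lemma Omc_mul (lam theta : 'CF(Gc)) : lin_over G lam -> GGc theta ->
  Omc (lam * theta) = 'Res[Mc] lam * Omc theta.
Proof.
move=> lin_lam GGth; have [[L k] [L' k']] := (lin_lam, lin_over_Mc lin_lam).
by apply: Omc_lin.
Qed.

Lemma GGc_mul (lam theta : 'CF(Gc)) : lin_over G lam -> GGc theta -> GGc (lam * theta).
Proof.
move=> lin_lam /GGcP[irr_th [chi GGchi over]]; apply/GGcP.
have [irr_lth over_l] := lies_over_lin irr_th over lin_lam.
by split=> //; exists chi.
Qed.

Lemma Omc_orbit_glo chi theta theta' : GG chi -> theta \in irr Gc -> lies_over theta chi ->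
    theta' \in irr Gc -> lies_over theta' chi ->
  exists2 lam, lin_over G lam & theta' = lam * theta.
Proof.
move=> GGchi; have [L Lext] := maxext_glo; have [irrL resL] := Lext chi GGchi.
exact: (lies_over_orbit nsGGc abGc (GG_irr GGchi) irrL resL).
Qed.

Lemma Omc_orbit_loc psi theta theta' : MM psi -> theta \in irr Mc -> lies_over theta psi ->
    theta' \in irr Mc -> lies_over theta' psi ->
  exists2 mu, lin_over M mu & theta' = mu * theta.
Proof.
move=> MMpsi; have [L Lext] := maxext_loc; have [irrL resL] := Lext psi MMpsi.
exact: (lies_over_orbit nsMMc abMc (MM_irr MMpsi) irrL resL).
Qed.

Lemma matched0_total chi : GG0 chi -> exists psi, matched0 chi psi.
Proof.
move=> GG0chi; have GGchi := GG0_sub GG0chi.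
have [theta irr_th over] := irr_over (normal_sub nsGGc) (GG_irr GGchi).
have GGth : GGc theta by apply/GGcP; split=> //; exists chi.
have /MMcP[irr_Oth [psi1 MMpsi1 over1]] : MMc (Omc theta) by case: Omc_bij => + _ _; apply.
have [tr _] := transversalP MM0_transversal; have [y Mcy MM0psi] := tr _ MMpsi1.
exists (psi1 ^ y)%CF; split=> //; exists theta => //; split=> //.
exact: lies_over_conjg.
Qed.

Lemma matched0_surj psi : MM0 psi -> exists chi, matched0 chi psi.
Proof.
move=> MM0psi; have MMpsi := MM0_sub MM0psi.
have [theta' irr_th' over'] := irr_over (normal_sub nsMMc) (MM_irr MMpsi).
have MMth' : MMc theta' by apply/MMcP; split=> //; exists psi.
have [theta GGth Dth'] : (Omc @` GGc) theta' by case: Omc_bij => _ _; apply.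
have /GGcP[irr_th [chi1 GGchi1 over1]] := GGth.
have [tr _] := transversalP GG0_transversal; have [y Mcy GG0chi] := tr _ GGchi1.
exists (chi1 ^ y)%CF; split=> //; exists theta => //; split; last by rewrite Dth'.
by apply: lies_over_conjg => //; apply: (fintype.subsetP sMcGc).
Qed.

Lemma matched0_fun chi psi psi' : matched0 chi psi -> matched0 chi psi' -> psi' = psi.
Proof.
move=> [GG0chi MM0psi [th irr_th [over over_psi]]] [_ MM0psi' [th' irr_th' [over' over_psi']]].
have GGchi := GG0_sub GG0chi.
have [lam lin_lam Dth'] := Omc_orbit_glo GGchi irr_th over irr_th' over'.
have GGth : GGc th by apply/GGcP; split=> //; exists chi.
rewrite Dth' (Omc_mul lin_lam GGth) in over_psi'.
have [irr_lOth over_l] := lies_over_lin (Omc_irr GGth) over_psi (lin_over_Mc lin_lam).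
have [y Mcy Dpsi'] := lies_over_conj nsMMc (MM_irr (MM0_sub MM0psi)) irr_lOth
  (MM_irr (MM0_sub MM0psi')) over_l over_psi'.
have [_ uni] := transversalP MM0_transversal.
by rewrite Dpsi'; apply: uni; rewrite -?Dpsi'.
Qed.

Lemma matched0_inj chi chi' psi : matched0 chi psi -> matched0 chi' psi -> chi' = chi.
Proof.
move=> [GG0chi MM0psi [th irr_th [over over_psi]]] [GG0chi' _ [th' irr_th' [over' over_psi']]].
have GGchi := GG0_sub GG0chi; have GGchi' := GG0_sub GG0chi'.
have GGth : GGc th by apply/GGcP; split=> //; exists chi.
have GGth' : GGc th' by apply/GGcP; split=> //; exists chi'.
have [mu lin_mu Dth'] := Omc_orbit_loc (MM0_sub MM0psi) (Omc_irr GGth) over_psi (Omc_irr GGth') over_psi'.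
have [lam lin_lam Dmu] := lin_over_Gc lin_mu.
have Eth' : th' = lam * th.
  case: Omc_bij => _ inj _; apply: inj; rewrite ?mem_setE ?inE //.
    exact: GGc_mul.
  by rewrite Omc_mul // Dmu.
rewrite Eth' in over'.
have [irr_lth over_l] := lies_over_lin irr_th over lin_lam.
have [k Gck Dchi'] := lies_over_conj nsGGc (GG_irr GGchi) irr_lth (GG_irr GGchi') over_l over'.
move: Gck Dchi'; rewrite -(cf_Gc cf) => /mulsgP[g m Gg Mcm ->].
have [nGm _ _ _] := norm_J (fintype.subsetP sMcJ m Mcm).
rewrite (cfConjgMnorm chi (fintype.subsetP (normG G) g Gg) nGm) (cfConjg_id chi Gg) => Dchi'.
have [_ uni] := transversalP GG0_transversal.
by rewrite Dchi'; apply: uni; rewrite -?Dchi'.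
Qed.

(** Both stabilizers are determined by the linear characters fixing theta or
Omc theta, and these correspond to each other under restriction. *)
Lemma matched0_stab chi psi (m : gT) : matched0 chi psi -> m \in Mc ->
  (chi ^ m)%CF = chi <-> (psi ^ m)%CF = psi.
Proof.
move=> [GG0chi MM0psi [th irr_th [over over_psi]]] Mcm.
have [GGchi MMpsi] := (GG0_sub GG0chi, MM0_sub MM0psi).
have [L Lext] := maxext_glo; have [irrL resL] := Lext chi GGchi.
have [L' Lext'] := maxext_loc; have [irrL' resL'] := Lext' psi MMpsi.
have GGth : GGc th by apply/GGcP; split=> //; exists chi.
have Gcm := fintype.subsetP sMcGc m Mcm.
have [nGm nMm _ _] := norm_J (fintype.subsetP sMcJ m Mcm).
have stabG := inertia_lin_stab nsGGc abGc (GG_irr GGchi) irrL resL irr_th over Gcm.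
have stabM := inertia_lin_stab nsMMc abMc (MM_irr MMpsi) irrL' resL' (Omc_irr GGth) over_psi Mcm.
have inI (N K : {group gT}) (phi : 'CF(N)) : m \in 'N(N)%g -> m \in K ->
    (phi ^ m)%CF = phi <-> m \in 'I_K[phi]%G.
  by move=> nN Km; rewrite finset.in_setI Km finset.inE nN /=; split=> [->|/eqP].
rewrite (inI G Gc) // (inI M Mc) // stabG stabM; split=> stab mu lin_mu.
  have [lam lin_lam <-] := lin_over_Gc lin_mu; rewrite cfResE // => fixOth.
  apply: stab => //; case: Omc_bij => _ inj _; apply: inj; rewrite ?mem_setE ?inE //.
    exact: GGc_mul.
  by rewrite Omc_mul.
move=> fixth; rewrite -(cfResE _ sMcGc Mcm); apply: stab; first exact: lin_over_Mc.
by rewrite -Omc_mul // fixth.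
Qed.

Lemma matched0_act chi psi a : matched0 chi psi -> S a ->
  matched0 (cfact a chi) (cfact a psi).
Proof.
move=> [GG0chi MM0psi [th irr_th [over over_psi]]] Sa.
have [GGchi MMpsi] := (GG0_sub GG0chi, MM0_sub MM0psi).
have GGth : GGc th by apply/GGcP; split=> //; exists chi.
have [nG nM nGc nMc] := norm_J (S_J Sa).
split; [exact: S_GG0 | exact: S_MM0 | exists (cfact a th); first exact: cfact_irr].
split; first exact: (cfact_lies_over (irrWchar irr_th) (GG_char GGchi) (normal_sub nsGGc) nG nGc over).
rewrite Omc_equiv //.
exact: (cfact_lies_over (irrWchar (Omc_irr GGth)) (MM_char MMpsi) (normal_sub nsMMc) nM nMc).
Qed.

(** The extension of [matched0] by Mc-equivariance, consistent because matched
members of the transversals have the same stabilizer in Mc. *)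
Definition matched chi psi := exists chi0 psi0 (m : gT),
  [/\ matched0 chi0 psi0, m \in Mc, chi = (chi0 ^ m)%CF & psi = (psi0 ^ m)%CF].

Lemma matched_GG chi psi : matched chi psi -> GG chi /\ MM psi.
Proof.
move=> [chi0 [psi0 [m [[GG0chi MM0psi _] Mcm -> ->]]]].
by split; [apply: GG_conj => //; apply: GG0_sub | apply: MM_conj => //; apply: MM0_sub].
Qed.

Lemma matched_total chi : GG chi -> exists psi, matched chi psi.
Proof.
have [tr _] := transversalP GG0_transversal; move=> /tr[y Mcy GG0chi].
have [psi Mpsi] := matched0_total GG0chi.
exists (psi ^ y^-1)%CF, (chi ^ y)%CF, psi, y^-1%g.
by split; rewrite ?groupV // cfConjgK.
Qed.

Lemma matched_surj psi : MM psi -> exists chi, matched chi psi.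
Proof.
have [tr _] := transversalP MM0_transversal; move=> /tr[y Mcy MM0psi].
have [chi Mchi] := matched0_surj MM0psi.
exists (chi ^ y^-1)%CF, chi, (psi ^ y)%CF, y^-1%g.
by split; rewrite ?groupV // cfConjgK.
Qed.

Let Mc_act (N : {group gT}) (phi : 'CF(N)) (x y : gT) : J \subset 'N(N)%g ->
  x \in Mc -> y \in Mc -> (phi ^ (x * y))%CF = ((phi ^ x) ^ y)%CF.
Proof.
move=> nNJ Mx My; have nNM := fintype.subset_trans sMcJ nNJ.
exact: (cfConjgMnorm phi (fintype.subsetP nNM x Mx) (fintype.subsetP nNM y My)).
Qed.

Let Mc_eq (N : {group gT}) (phi phi' : 'CF(N)) (x y : gT) : J \subset 'N(N)%g ->
  x \in Mc -> y \in Mc -> (phi ^ x)%CF = (phi' ^ y)%CF <-> (phi ^ (x * y^-1))%CF = phi'.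
Proof.
move=> nNJ Mx My; rewrite Mc_act ?groupV //; split=> [-> | <-]; first exact: cfConjgK.
by rewrite cfConjgKV.
Qed.

Lemma matched_fun chi psi psi' : matched chi psi -> matched chi psi' -> psi' = psi.
Proof.
move=> [chi1 [psi1 [x [M1 Mx -> ->]]]] [chi2 [psi2 [y [M2 My]]]].
have [_ uni] := transversalP GG0_transversal.
have [[GG1 _ _] [GG2 _ _]] := (M1, M2).
move/(Mc_eq _ _ nGJ Mx My) => D2 ->.
have E12 : chi2 = chi1 by rewrite -D2; apply: uni; rewrite ?D2 ?groupM ?groupV.
rewrite E12 in D2 M2; have -> := matched0_fun M1 M2.
apply/esym/(Mc_eq _ _ nMJ Mx My); apply/(matched0_stab M1) => //.
by rewrite groupM ?groupV.
Qed.

Lemma matched_inj chi chi' psi : matched chi psi -> matched chi' psi -> chi' = chi.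
Proof.
move=> [chi1 [psi1 [x [M1 Mx -> ->]]]] [chi2 [psi2 [y [M2 My ->]]]].
have [_ uni] := transversalP MM0_transversal.
have [[_ MM1 _] [_ MM2 _]] := (M1, M2).
move/(Mc_eq _ _ nMJ Mx My) => D2.
have E12 : psi2 = psi1 by rewrite -D2; apply: uni; rewrite ?D2 ?groupM ?groupV.
rewrite E12 in D2 M2; have -> := matched0_inj M1 M2.
apply/esym/(Mc_eq _ _ nGJ Mx My); apply/(matched0_stab M1) => //.
by rewrite groupM ?groupV.
Qed.

Let act_conj (N : {group gT}) (phi : 'CF(N)) (a a' : gal_prod gT) (m m1 : gT) :
    J \subset 'N(N)%g -> phi \is a character -> m \in Mc -> m1 \in Mc -> a'.1 \in J ->
    a.1 = (m1 * a'.1)%g -> a.2 = a'.2 ->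
  cfact a (phi ^ m)%CF = (cfact a' phi ^ ((m * m1) ^ a'.1))%CF.
Proof.
move=> nNJ Nphi Mm Mm1 Ja' a1 a2.
have JN (x : gT) : x \in J -> x \in 'N(N)%g by apply: (fintype.subsetP nNJ).
have McJ (x : gT) : x \in Mc -> x \in J by apply: (fintype.subsetP sMcJ).
have Mm2 : ((m * m1) ^ a'.1)%g \in Mc.
  by have [_ _ _ nMc] := norm_J Ja'; rewrite memJ_norm // groupM.
rewrite -cfact_conj // -[RHS]cfact_conj ?cfact_char //.
rewrite -(cfact_mulg (c := ((m * a.1)%g, a.2))) /= ?mul1g //.
- rewrite -(cfact_mulg (c := ((m * a.1)%g, a.2))) /= ?mulg1 //.
  + by rewrite JN.
  + by rewrite JN // McJ.
  by rewrite a1 mulgA conjgC.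
- by rewrite JN // McJ.
by rewrite JN // a1 groupM // McJ.
Qed.

Lemma matched_act chi psi (a : gal_prod gT) : matched chi psi -> a.1 \in J -> HH a.2 ->
  matched (cfact a chi) (cfact a psi).
Proof.
move=> [chi0 [psi0 [m [M0 Mcm -> ->]]]] Ja HHa.
have [m1 [a' [Mm1 Sa' a1 a2]]] := factor_MhB Ja HHa.
have Ja' := S_J Sa'; have [[GG0chi MM0psi _] [_ _ _ nMc]] := (M0, norm_J Ja').
exists (cfact a' chi0), (cfact a' psi0), ((m * m1) ^ a'.1)%g; split.
- exact: matched0_act.
- by rewrite memJ_norm // groupM.
- by apply: act_conj => //; apply/GG_char/GG0_sub.
by apply: act_conj => //; apply/MM_char/MM0_sub.
Qed.

Lemma matched_stab chi psi (a : gal_prod gT) : matched chi psi -> a.1 \in J -> HH a.2 ->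
  cfact a chi = chi <-> cfact a psi = psi.
Proof.
move=> Mcp Ja HHa; have Mcpa := matched_act Mcp Ja HHa.
split=> E'; rewrite E' in Mcpa; first exact: matched_fun Mcp Mcpa.
exact: matched_inj Mcp Mcpa.
Qed.

Lemma matched0_matched chi psi : matched0 chi psi -> matched chi psi.
Proof. by move=> M0; exists chi, psi, 1%g; rewrite !cfConjgJ1 group1. Qed.

Let norm_Inertia_cfact (N K : {group gT}) (phi : 'CF(N)) (a : gal_prod gT) :
    phi \is a character -> a.1 \in 'N(N)%g -> a.1 \in 'N(K)%g -> cfact a phi = phi ->
  a.1 \in 'N('I_K[phi])%g.
Proof.
move=> Nphi nN nK fixa; rewrite -cycle_subG normsI ?cycle_subG //.
exact: norm_inertia_cfact.
Qed.

(** Equivariance of the bijection between the characters of Gc and Mc under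
multiplication by linear characters forces a to multiply matching extensions
by the same linear character. *)
Lemma matched0_twist chi psi theta (a : gal_prod gT) (eta : 'CF('I_Gc[chi]))
    (eta' : 'CF('I_Mc[psi])) :
    GG chi -> MM psi -> GGc theta ->
    eta \in irr 'I_Gc[chi] -> 'Res[G] eta = chi -> theta = 'Ind[Gc] eta ->
    eta' \in irr 'I_Mc[psi] -> 'Res[M] eta' = psi -> Omc theta = 'Ind[Mc] eta' ->
    S a -> cfact a chi = chi -> cfact a psi = psi ->
  exists2 lam : 'CF(Gc), lin_over G lam &
    cfact a eta = eta * 'Res['I_Gc[chi]] lam /\
    cfact a eta' = eta' * 'Res['I_Mc[psi]] ('Res[Mc] lam).
Proof.
move=> GGchi MMpsi GGth irr_eta res_eta Dth irr_eta' res_eta' DOth Sa fix_chi fix_psi.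
have [nG nM nGc nMc] := norm_J (S_J Sa).
have [Nchi Npsi] := (GG_char GGchi, MM_char MMpsi).
have [sGGc sMMc] := (normal_sub nsGGc, normal_sub nsMMc).
have nX := norm_Inertia_cfact Nchi nG nGc fix_chi.
have nX' := norm_Inertia_cfact Npsi nM nMc fix_psi.
have nsGX : G <| 'I_Gc[chi] := normal_Inertia chi sGGc.
have nsMX' : M <| 'I_Mc[psi] := normal_Inertia psi sMMc.
have sXGc : 'I_Gc[chi] \subset Gc := Inertia_sub _ _.
have sX'Mc : 'I_Mc[psi] \subset Mc := Inertia_sub _ _.
have res_a : 'Res[G] (cfact a eta) = chi by rewrite -cfact_Res ?normal_sub // res_eta.
have [|mu [Lmu kmu] Dmu] := Gallagher_ext nsGX (GG_irr GGchi) irr_eta res_eta _ res_a.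
  exact: cfact_irr.
have [|lam lin_lam Dlam] := extend_lin_over nsGGc abGc sXGc Lmu.
  by rewrite (finset.setIidPr (normal_sub nsGX)).
exists lam => //; split; first by rewrite Dlam.
have Eth : cfact a theta = lam * theta.
  rewrite Dth cfact_Ind ?irrWchar // Dmu -Dlam.
  by rewrite cfIndM // mulrC.
have lin_res := lin_over_Mc lin_lam.
have [L' k'] := lin_over_Res psi nsMMc lin_res.
have res_a' : 'Res[M] (cfact a eta') = psi by rewrite -cfact_Res ?normal_sub // res_eta'.
have irr_psi := MM_irr MMpsi.
apply: (Clifford_Ind_inj nsMMc irr_psi).
- exact: cfact_irr.
- exact: ext_lies_over.
- exact: lin_over_irr.
- apply: ext_lies_over => //.
  by rewrite rmorphM /= res_eta' (cfRes_sub_ker k') lin_char1 // scale1r mulr1.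
rewrite cfIndM // -DOth -cfact_Ind ?irrWchar // -DOth -Omc_equiv //.
by rewrite Eth Omc_mul // mulrC.
Qed.

Hypothesis HH_one : HH 1%g.
Variables (Phi_glo : forall chi : 'CF(G), 'CF('I_GE[chi]))
  (Phi_loc : forall psi : 'CF(M), 'CF('I_Mh[psi])).
Hypotheses (Phi_glo_ext : extension_map GG0 Phi_glo)
  (Phi_loc_ext : extension_map MM0 Phi_loc).
Hypothesis Phi_central : forall chi psi, GG0 chi -> MM0 psi ->
  Irr_under 'C_E(G)%G (Phi_glo chi) = Irr_under 'C_E(G)%G (Phi_loc psi).
Hypothesis centG : 'C_A(G)%g = ('Z(Gc) * 'C_E(G))%g.
Hypothesis Omc_central : forall nu : 'CF('Z(Gc)), nu \in irr 'Z(Gc) ->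
  Omc @` (GGc `&` Irr_over Gc [set nu]) = MMc `&` Irr_over Mc [set nu].
Hypothesis Phi_bracket : forall (chi : 'CF(G)) (psi : 'CF(M)) (a : gal_prod gT),
  GG0 chi -> MM0 psi -> Omc @` Irr_over Gc [set chi] = Irr_over Mc [set psi] ->
  S a -> cfact a psi = psi ->
  'Res['I_Mh[chi]] (ext_bracket G (Phi_glo chi) a) =1 ext_bracket M (Phi_loc psi) a.

Lemma mem_Inertia (N K : {group gT}) (phi : 'CF(N)) (x : gT) : x \in 'N(N)%g ->
  (x \in 'I_K[phi]%g) = (x \in K) && ((phi ^ x)%CF == phi).
Proof. by move=> nN; rewrite finset.in_setI [x \in 'I[phi]%g]finset.inE nN. Qed.

Lemma matched_stab_J chi psi (x : gT) : matched chi psi -> x \in J ->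
  (chi ^ x)%CF = chi <-> (psi ^ x)%CF = psi.
Proof.
move=> Mcp Jx; have [GGchi MMpsi] := matched_GG Mcp.
have := matched_stab (a := (x, 1%g)) Mcp Jx HH_one.
by rewrite !cfact_conj ?GG_char ?MM_char.
Qed.

(** Both sets are orbits under the linear characters of Gc / G and Mc / M, which
Omc intertwines. *)
Lemma Omc_Irr_over chi psi : matched0 chi psi ->
  Omc @` Irr_over Gc [set chi] = Irr_over Mc [set psi].
Proof.
move=> [GG0chi MM0psi [th irr_th [over over_psi]]].
have [GGchi MMpsi] := (GG0_sub GG0chi, MM0_sub MM0psi).
have GGth : GGc th by apply/GGcP; split=> //; exists chi.
rewrite eqEsubset; split=> [_ [th' [irr_th' [i Ci /= Dchi]] <-] | th' [irr_th' [i Ci /= Dpsi]]].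
  have over' : lies_over th' chi by rewrite /lies_over -Dchi -irr_consttE.
  have [lam lin_lam ->] := Omc_orbit_glo GGchi irr_th over irr_th' over'.
  rewrite Omc_mul //.
  have [irr_l over_l] := lies_over_lin (Omc_irr GGth) over_psi (lin_over_Mc lin_lam).
  split=> //; have /irrP[j Dj] := MM_irr MMpsi.
  by exists j; rewrite ?irr_consttE -?Dj.
have over' : lies_over th' psi by rewrite /lies_over -Dpsi -irr_consttE.
have [mu lin_mu ->] := Omc_orbit_loc MMpsi (Omc_irr GGth) over_psi irr_th' over'.
have [lam lin_lam <-] := lin_over_Gc lin_mu.
exists (lam * th); last by rewrite Omc_mul.
have [irr_l over_l] := lies_over_lin irr_th over lin_lam.
split=> //; have /irrP[j Dj] := GG_irr GGchi.
by exists j; rewrite ?irr_consttE -?Dj.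
Qed.

(** As the transversals are stable under Mh, an element of Mc Mh fixing a member
of one of them is a product of factors fixing it. *)
Lemma stab_factor (N : {group gT}) (X0 X1 : set 'CF(N)) phi (m y : gT) :
    transversal_in Mc X1 X0 -> conj_stable Mh X0 -> J \subset 'N(N)%g ->
    X0 phi -> m \in Mc -> y \in Mh -> (phi ^ (m * y))%CF = phi ->
  (phi ^ m)%CF = phi /\ (phi ^ y)%CF = phi.
Proof.
move=> tr st nNJ X0phi Mm My.
have nm := fintype.subsetP nNJ _ (fintype.subsetP sMcJ _ Mm).
have ny := fintype.subsetP nNJ _ (fintype.subsetP sMhJ _ My).
rewrite (cfConjgMnorm phi nm ny) => fixmy.
have fixm : (phi ^ m)%CF = phi.
  have [_ uni] := transversalP tr; apply: uni => //.
  by rewrite -[(phi ^ m)%CF](cfConjgK y) fixmy; apply: st; rewrite ?groupV.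
by split=> //; rewrite fixm in fixmy.
Qed.

Lemma Inertia_A chi psi : matched0 chi psi ->
  'I_A[chi] = ('I_Gc[chi] * 'I_GE[chi])%g.
Proof.
move=> M0; have [GG0chi _ _] := M0.
have nGA := normal_norm (cf_nsGA cf).
have [sGcA sGEA] := (normal_sub (cf_nsGcA cf), cf_sGEA cf).
have nG (x : gT) : x \in A -> x \in 'N(G)%g by apply: (fintype.subsetP nGA).
apply/eqP; rewrite finset.eqEsubset mul_subG ?finset.setSI // andbT.
apply/fintype.subsetP=> x Ix; have Ax : x \in A by case/finset.setIP: Ix.
move: Ix; rewrite mem_Inertia ?nG // Ax /= => /eqP fixx.
have [g [j [Gg Jj Dx]]] := cf_mem_A cf Ax; have [m [y [Mm My Dj]]] := cf_mem_J cf Jj.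
have Gcg := fintype.subsetP (normal_sub nsGGc) g Gg.
have Gcm := fintype.subsetP sMcGc m Mm; have GEy := fintype.subsetP (cf_sMhGE cf) y My.
have nj := fintype.subsetP nGJ j Jj.
have fixj : (chi ^ (m * y))%CF = chi.
  rewrite -Dj -[RHS]fixx Dx (cfConjgMnorm chi (fintype.subsetP (normG G) g Gg) nj).
  by rewrite (cfConjg_id chi Gg).
have [fixm fixy] := stab_factor GG0_transversal GG0_stable nGJ GG0chi Mm My fixj.
have Ag := fintype.subsetP sGcA g Gcg; have Am := fintype.subsetP sGcA m Gcm.
have X1 : (g * m)%g \in 'I_Gc[chi]%g.
  rewrite mem_Inertia; last by rewrite nG // groupM.
  by rewrite groupM //= (cfConjgMnorm chi (nG g Ag) (nG m Am)) (cfConjg_id chi Gg) fixm.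
have Y1 : y \in 'I_GE[chi]%g.
  by rewrite mem_Inertia ?GEy ?fixy ?eqxx //; apply/nG/(fintype.subsetP sGEA).
by rewrite Dx Dj mulgA mem_mulg.
Qed.

Lemma Inertia_J chi psi : matched0 chi psi ->
  'I_J[psi] = ('I_Mc[psi] * 'I_Mh[psi])%g.
Proof.
move=> M0; have [_ MM0psi _] := M0.
have nM (x : gT) : x \in J -> x \in 'N(M)%g by apply: (fintype.subsetP nMJ).
apply/eqP; rewrite finset.eqEsubset mul_subG ?finset.setSI // andbT.
apply/fintype.subsetP=> x Ix; have Jx : x \in J by case/finset.setIP: Ix.
move: Ix; rewrite mem_Inertia ?nM // => /andP[_ /eqP fixx].
have [m [y [Mm My Dx]]] := cf_mem_J cf Jx; rewrite Dx in fixx.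
have [fixm fixy] := stab_factor MM0_transversal MM0_stable nMJ MM0psi Mm My fixx.
have X1 : m \in 'I_Mc[psi]%g.
  by rewrite mem_Inertia ?Mm ?fixm ?eqxx //; apply/nM/(fintype.subsetP sMcJ).
have Y1 : y \in 'I_Mh[psi]%g.
  by rewrite mem_Inertia ?My ?fixy ?eqxx //; apply/nM/(fintype.subsetP sMhJ).
by rewrite Dx mem_mulg.
Qed.

Lemma cfInd_central_ratio (K T : {group gT}) (eta : 'CF(T)) (z : gT) :
    T \subset K -> eta 1%g != 0 -> z \in 'C(K)%g ->
  ('Ind[K] eta) z / ('Ind[K] eta) 1%g = eta z / eta 1%g.
Proof.
move=> sTK nz1 cz.
have IndE x : x \in 'C(K)%g -> ('Ind[K] eta) x = (#|T|%:R^-1 * #|K|%:R) * eta x.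
  move=> cx; rewrite cfIndE // -mulrA; congr (_ * _).
  rewrite (eq_bigr (fun _ => eta x)) => [|y Ky]; first by rewrite sumr_const mulr_natl.
  by rewrite conjgE (centP cx y Ky) mulKg.
have nzc : #|T|%:R^-1 * #|K|%:R != 0 :> algC.
  by rewrite mulf_neq0 ?invr_eq0 ?neq0CG.
by rewrite !IndE ?group1 // -mulf_div divff // mul1r.
Qed.

Lemma ext_bracketP (N T : {group gT}) (eta : 'CF(T)) chi (a : gal_prod gT) :
    N <| T -> chi \in irr N -> eta \in irr T -> 'Res[N] eta = chi ->
    a.1 \in 'N(N)%g -> a.1 \in 'N(T)%g -> cfact a chi = chi ->
  lin_over N (ext_bracket N eta a) /\ cfact a eta = eta * ext_bracket N eta a.
Proof.
move=> nsNT irr_chi irr_eta res_eta nN nT fixa; rewrite /ext_bracket.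
have res_a : 'Res[N] (cfact a eta) = chi by rewrite -cfact_Res ?normal_sub // res_eta.
have [|mu [Lmu kmu] Dmu] := Gallagher_ext nsNT irr_chi irr_eta res_eta _ res_a.
  exact: cfact_irr.
case: pickP => [i /andP[/andP[Li ki] /eqP Di] | none]; first by split.
have /irrP[i Di] := lin_char_irr Lmu.
by have := none i; rewrite -Di Lmu kmu Dmu eqxx.
Qed.

(** One such pair serves for both relations to be proved, because chi has the
same inertia group in A and in the stabilizer of its orbit sum. *)
Definition projective_pair (chi : 'CF(G)) (psi : 'CF(M)) :=
  exists n n' (P : gT -> 'M[algC]_n) (P' : gT -> 'M[algC]_n'),
    [/\ forall k i j, P k i j \in Qab, forall k i j, P' k i j \in Qab,
        gives_gec 'I_A[chi]%G chi 'I_J[psi]%G psi P P'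
      & forall a : gal_prod gT, a.1 \in J -> HH a.2 -> cfact a psi = psi ->
        exists mu mu', [/\ is_proj_bracket 'I_A[chi]%G G P a mu,
          is_proj_bracket 'I_J[psi]%G M P' a mu' & {in 'I_J[psi], mu =1 mu'}]].

(** An element of the centralizer is a product z e with z in 'Z(Gc) and e in
'C_E(G).  The scalar by which z acts is that of theta, since inducing does not
change the central character; by [Omc_central] it is also that of Omc theta.
For e the hypothesis on Phi_glo and Phi_loc gives the same scalar. *)
Lemma central_element chi psi theta (eta : 'CF('I_Gc[chi])) (eta' : 'CF('I_Mc[psi])) :
    matched0 chi psi -> GGc theta ->
    eta \in irr 'I_Gc[chi] -> theta = 'Ind[Gc] eta ->
    eta' \in irr 'I_Mc[psi] -> Omc theta = 'Ind[Mc] eta' ->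
  forall c : gT, c \in 'C_('I_A[chi])(G)%g ->
  exists z e : gT, [/\ c = (z * e)%g, z \in 'I_Mc[psi] :&: 'C(G), e \in 'I_Mh[psi] :&: 'C(G),
    eta z / eta 1%g = eta' z / eta' 1%g
    & Phi_glo chi e / Phi_glo chi 1%g = Phi_loc psi e / Phi_loc psi 1%g].
Proof.
move=> M0 GGth irr_eta Dth irr_eta' DOth c Cc; have [GG0chi MM0psi _] := M0.
have sCM : 'C(G)%g \subset 'C(M)%g := centS (cf_sMG cf).
have CM (x : gT) : x \in 'C(G)%g -> x \in 'C(M)%g by apply: (fintype.subsetP sCM).
have CI (x : gT) : x \in 'C(G)%g -> x \in 'I[psi]%g.
  by move/CM; apply: (fintype.subsetP (cent_sub_inertia psi)).
have nz1 (K : {group gT}) (phi : 'CF(K)) : phi \in irr K -> phi 1%g != 0.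
  by case/irrP=> i ->; apply: irr1_neq0.
have : c \in 'C_A(G)%g.
  by case/finset.setIP: Cc => /finset.setIP[Ac _] Cc; rewrite finset.inE Ac.
rewrite centG => /mulsgP[z e Zz Ce Dc]; exists z, e.
have [Gcz cz] := finset.setIP Zz; have [Ee ce] := finset.setIP Ce.
have czG : z \in 'C(G)%g := fintype.subsetP (centS (normal_sub nsGGc)) z cz.
have sZMc : 'Z(Gc)%g \subset Mc.
  apply/fintype.subsetP=> x /finset.setIP[Gcx cx]; rewrite (cf_Mc cf) finset.inE Gcx /=.
  apply: (fintype.subsetP (cent_sub M)); apply: CM.
  exact: (fintype.subsetP (centS (normal_sub nsGGc))).
have Mcz : z \in Mc := fintype.subsetP sZMc z Zz.
have sCMh : 'C_E(G)%g \subset Mh.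
  apply/fintype.subsetP=> x /finset.setIP[Ex cx]; rewrite (cf_Mh cf) finset.inE.
  rewrite (fintype.subsetP (cf_sEGE cf)) //=.
  exact/(fintype.subsetP (cent_sub M))/CM.
split=> //; try by rewrite finset.inE czG finset.inE Mcz CI.
- by rewrite finset.inE ce finset.inE CI // (fintype.subsetP sCMh).
- have cMz : z \in 'C(Mc)%g := fintype.subsetP (centS sMcGc) z cz.
  rewrite -(cfInd_central_ratio (Inertia_sub _ _) (nz1 _ _ irr_eta) cz) -Dth.
  rewrite -(cfInd_central_ratio (Inertia_sub _ _) (nz1 _ _ irr_eta') cMz) -DOth.
  have /GGcP[irr_th _] := GGth; have irr_Oth := Omc_irr GGth.
  have [t Dt] := irrP irr_th; have [i Zi] := constt_cfRes_irr 'Z(Gc)%G t.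
  rewrite -Dt in Zi.
  have : (MMc `&` Irr_over Mc [set 'chi[('Z(Gc))%G]_i]) (Omc theta).
    rewrite -Omc_central ?mem_irr //; exists theta => //; split=> //.
    by split=> //; exists i.
  case=> _ [_ [k Zk /= /irr_inj Dk]]; rewrite {}Dk in Zk.
  rewrite (central_constt (subxx Gc) (irrWchar irr_th) _ _ Zi Zz) ?cfRes_id //.
  rewrite (central_constt (subxx Mc) (irrWchar irr_Oth) _ _ Zk Zz) ?cfRes_id //.
  rewrite finset.subsetI sZMc; apply: fintype.subset_trans (centS sMcGc).
  exact: finset.subsetIr.
have [irr_Phi res_Phi] := Phi_glo_ext GG0chi; have [irr_Phi' res_Phi'] := Phi_loc_ext MM0psi.
have sGY : G \subset 'I_GE[chi] := sub_Inertia chi (cf_sGGE cf).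
have sMY' : M \subset 'I_Mh[psi] := sub_Inertia psi (normal_sub (cf_nsMMh cf)).
have [t Dt] := irrP irr_Phi; have [i Ci] := constt_cfRes_irr 'C_E(G)%G t; rewrite -Dt in Ci.
have : Irr_under 'C_E(G)%G (Phi_loc psi) 'chi_i by rewrite -(Phi_central GG0chi MM0psi); exists i.
case=> k Ck /irr_inj Dk; rewrite -{}Dk in Ck.
rewrite (central_constt sGY (irrWchar irr_Phi) _ _ Ci Ce) ?res_Phi ?(GG_irr (GG0_sub GG0chi)) //.
  rewrite (central_constt sMY' (irrWchar irr_Phi') _ _ Ck Ce) ?res_Phi' ?(MM_irr (MM0_sub MM0psi)) //.
  apply/fintype.subsetP=> x Cx; have /finset.setIP[Ex cx] := Cx.
  by rewrite finset.inE CM // finset.inE CI // (fintype.subsetP sCMh).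
apply/fintype.subsetP=> x Cx; have /finset.setIP[Ex cx] := Cx.
rewrite finset.inE cx finset.inE (fintype.subsetP (cf_sEGE cf)) //=.
by rewrite andbT; apply: (fintype.subsetP (cent_sub_inertia chi)).
Qed.

Let S_stab a chi psi : S a -> matched0 chi psi -> cfact a psi = psi -> cfact a chi = chi.
Proof.
move=> Sa M0 fix_psi; have := matched0_act M0 Sa; rewrite fix_psi => M0a.
exact: matched0_inj M0 M0a.
Qed.

Let stab_Inertia chi psi (K K' : {group gT}) : matched0 chi psi -> K \subset J -> K \subset K' ->
  'I_K[psi] \subset 'I_K'[chi].
Proof.
move=> M0 sKJ sKK'; apply/fintype.subsetP=> x Ix.
have Kx : x \in K by case/finset.setIP: Ix.
have Jx := fintype.subsetP sKJ x Kx; have [nG nM _ _] := norm_J Jx.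
rewrite mem_Inertia // (fintype.subsetP sKK') //=; apply/eqP.
apply/(matched_stab_J (matched0_matched M0) Jx).
by move: Ix; rewrite mem_Inertia // => /andP[_ /eqP].
Qed.

(** The extensions to be glued are the Clifford correspondents of theta and
Omc theta and the values of Phi_glo and Phi_loc. *)
Theorem matched0_projective_pair chi psi : matched0 chi psi -> projective_pair chi psi.
Proof.
move=> M0; have [GG0chi MM0psi [theta irr_th [over over_psi]]] := M0.
have [GGchi MMpsi] := (GG0_sub GG0chi, MM0_sub MM0psi).
have [irr_chi irr_psi] := (GG_irr GGchi, MM_irr MMpsi).
have [Nchi Npsi] := (GG_char GGchi, MM_char MMpsi).
have GGth : GGc theta by apply/GGcP; split=> //; exists chi.
have [sGGc sMMc] := (normal_sub nsGGc, normal_sub nsMMc).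
have [sGA sMMh] := (normal_sub (cf_nsGA cf), normal_sub (cf_nsMMh cf)).
have sMJ : M \subset J := fintype.subset_trans sMMc sMcJ.
have [L Lext] := maxext_glo; have [irrL resL] := Lext chi GGchi.
have [L' Lext'] := maxext_loc; have [irrL' resL'] := Lext' psi MMpsi.
have [eta [irr_eta over_eta Dth]] := Clifford_correspondent nsGGc irr_chi irr_th over.
have res_eta := lies_over_ext nsGGc abGc irr_chi irrL resL irr_eta over_eta.
have [eta' [irr_eta' over_eta' DOth]] :=
  Clifford_correspondent nsMMc irr_psi (Omc_irr GGth) over_psi.
have res_eta' := lies_over_ext nsMMc abMc irr_psi irrL' resL' irr_eta' over_eta'.
have [irr_Phi res_Phi] := Phi_glo_ext GG0chi; have [irr_Phi' res_Phi'] := Phi_loc_ext MM0psi.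
have sX'X : 'I_Mc[psi] \subset 'I_Gc[chi] := stab_Inertia M0 sMcJ sMcGc.
have sY'Y : 'I_Mh[psi] \subset 'I_GE[chi] := stab_Inertia M0 sMhJ (cf_sMhGE cf).
have nsGK : G <| 'I_A[chi] := normal_Inertia chi sGA.
have nsMK' : M <| 'I_J[psi] := normal_Inertia psi sMJ.
have nsGX : G <| 'I_Gc[chi] := normal_Inertia chi sGGc.
have nsGY : G <| 'I_GE[chi] := normal_Inertia chi (cf_sGGE cf).
have nsMX' : M <| 'I_Mc[psi] := normal_Inertia psi sMMc.
have nsMY' : M <| 'I_Mh[psi] := normal_Inertia psi sMMh.
have tiXY : 'I_Gc[chi] :&: 'I_GE[chi] = G.
  apply/eqP; rewrite finset.eqEsubset finset.subsetI (normal_sub nsGX) (normal_sub nsGY) /= andbT.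
  by move: (finset.setISS (Inertia_sub Gc chi) (Inertia_sub GE chi)); rewrite (cf_tiGcGE cf).
have tiXY' : 'I_Mc[psi] :&: 'I_Mh[psi] = M.
  apply/eqP; rewrite finset.eqEsubset finset.subsetI (normal_sub nsMX') (normal_sub nsMY') /= andbT.
  by move: (finset.setISS (Inertia_sub Mc psi) (Inertia_sub Mh psi)); rewrite (cf_tiMcMh cf).
have nXY : 'I_GE[chi] \subset 'N('I_Gc[chi]).
  rewrite normsI //; last by rewrite finset.subIset // normG orbT.
  rewrite finset.subIset //; apply/orP; left.
  exact: fintype.subset_trans (cf_sGEA cf) (normal_norm (cf_nsGcA cf)).
have nXY' : 'I_Mh[psi] \subset 'N('I_Mc[psi]).
  rewrite normsI //; last by rewrite finset.subIset // normG orbT.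
  by rewrite finset.subIset // (cf_nMcMh cf).
have twist (y : gT) : y \in 'I_GE[chi]%g ->
    exists2 lam : 'CF('I_Gc[chi]), lin_over G lam & (eta ^ y)%CF = eta * lam.
  move=> Yy; have nXy := fintype.subsetP nXY y Yy.
  have /finset.setIP[_ Iy] := Yy.
  have nGy := fintype.subsetP (norm_inertia chi) y Iy.
  apply: (Gallagher_ext nsGX irr_chi irr_eta res_eta); first exact: cfConjg_irr.
  by rewrite -cfConjgRes_norm // res_eta inertiaJ.
have lin_res (lam : 'CF('I_Gc[chi])) : lin_over G lam -> lin_over M ('Res['I_Mc[psi]] lam).
  case=> Llam klam; split; first exact: cfRes_lin_char.
  rewrite cfker_Res ?lin_charW // finset.subsetI (normal_sub nsMX').
  exact: fintype.subset_trans (cf_sMG cf) klam.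
have resres (lam : 'CF(Gc)) : 'Res['I_Mc[psi]] ('Res['I_Gc[chi]] lam) = 'Res['I_Mc[psi]] ('Res[Mc] lam).
  by rewrite !cfResRes // Inertia_sub.
have twist' (y : gT) : y \in 'I_Mh[psi]%g -> exists lam : 'CF('I_Gc[chi]),
    [/\ lin_over G lam, (eta ^ y)%CF = eta * lam & (eta' ^ y)%CF = eta' * 'Res['I_Mc[psi]] lam].
  move=> Yy; have [My Iy] := finset.setIP Yy; have Sy := S_Mh My.
  have fix_psi : cfact (y, 1%g) psi = psi by rewrite cfact_conj // inertiaJ.
  have fix_chi := S_stab Sy M0 fix_psi.
  have [lam lin_lam [D1 D2]] := matched0_twist GGchi MMpsi GGth irr_eta res_eta Dth
    irr_eta' res_eta' DOth Sy fix_chi fix_psi.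
  exists ('Res['I_Gc[chi]] lam); split; first exact: lin_over_Res.
    by rewrite -D1 cfact_conj ?irrWchar.
  by rewrite resres -D2 cfact_conj ?irrWchar.
have central := central_element M0 GGth irr_eta Dth irr_eta' DOth.
have [n [n' [P [P' [QP QP' gives br]]]]] := two_sided_glue irr_chi irr_psi nsGK nsMK'
  (cf_sMG cf) (normal_sub nsGX) (normal_sub nsGY) tiXY (normal_sub nsMX') (normal_sub nsMY')
  tiXY' (Inertia_A M0) (Inertia_J M0) nXY nXY' sX'X sY'Y (irrWchar irr_eta) (irrWchar irr_Phi)
  (irrWchar irr_eta') (irrWchar irr_Phi') res_eta res_Phi res_eta' res_Phi' twist twist'
  lin_res central.
exists n, n', P, P'; split=> // a Ja HHa fix_psi.
have [m [a' [Mm Sa' a1 a2]]] := factor_MhB Ja HHa.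
have Ja' := S_J Sa'; have [nG nM nGc nMc] := norm_J Ja'.
have Jm := fintype.subsetP sMcJ m Mm; have [_ nMm _ _] := norm_J Jm.
have Da (N : {group gT}) (phi : 'CF(N)) : J \subset 'N(N)%g -> phi \is a character ->
    cfact a phi = cfact a' (phi ^ m)%CF.
  move=> nNJ Nphi; rewrite -cfact_conj //.
  by apply: cfact_mulg; rewrite ?(fintype.subsetP nNJ) //= ?a2 ?mul1g.
(* The conjugate psi ^ m is the image of psi under the inverse of a', hence lies
in the transversal. *)
have fixm : (psi ^ m)%CF = psi.
  have Npm : (psi ^ m)%CF \is a character by rewrite cfConjg_char.
  have [y [b [My Bb _ _ Da']]] := S_act Sa' nMJ Npm.
  have [b' [Bb' b'1 b'2]] := B_inv Bb.
  have nMb : b.1 \in 'N(M)%g := fintype.subsetP nMJ _ (B_J Bb).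
  have Ey : ((psi ^ m) ^ y)%CF = cfact b' psi.
    have nMb' : b'.1 \in 'N(M)%g by rewrite b'1 groupV.
    have Nxi : ((psi ^ m) ^ y)%CF \is a character by rewrite cfConjg_char.
    rewrite -[in RHS]fix_psi (Da M) // Da' -[LHS](cfact_one Nxi).
    by apply: cfact_mulg; rewrite //= ?b'1 ?b'2 ?mulgV.
  have [_ uni] := transversalP MM0_transversal; apply: uni => //.
  rewrite -[(psi ^ m)%CF](cfConjgK y) Ey.
  by apply: MM0_stable; [rewrite groupV | apply: B_MM0].
have fix_psi' : cfact a' psi = psi by rewrite -{1}fixm -Da.
have fix_chi' := S_stab Sa' M0 fix_psi'.
have nGE := S_norm_GE Sa'; have nMh := S_norm_Mh Sa'.
apply: (br a' a m) => //; last by rewrite mem_Inertia // Jm fixm eqxx.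
  have [lam lin_lam [D1 D2]] := matched0_twist GGchi MMpsi GGth irr_eta res_eta Dth
    irr_eta' res_eta' DOth Sa' fix_chi' fix_psi'.
  have [lin2 D3] := ext_bracketP nsGY irr_chi irr_Phi res_Phi nG
    (norm_Inertia_cfact Nchi nG nGE fix_chi') fix_chi'.
  have [lin2' D4] := ext_bracketP nsMY' irr_psi irr_Phi' res_Phi' nM
    (norm_Inertia_cfact Npsi nM nMh fix_psi') fix_psi'.
  exists ('Res['I_Gc[chi]] lam), (ext_bracket G (Phi_glo chi) a').
  exists (ext_bracket M (Phi_loc psi) a'); split; first by split=> //; apply: lin_over_Res.
  split=> //; first by rewrite resres.
  move=> y Yy; have := Phi_bracket GG0chi MM0psi (Omc_Irr_over M0) Sa' fix_psi' y.
  have sMhI : 'I_Mh[chi] \subset 'I_GE[chi] by rewrite finset.setSI ?(cf_sMhGE cf).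
  rewrite cfResE //.
  exact: (fintype.subsetP (stab_Inertia M0 sMhJ (subxx Mh))).
split; split=> //; exact: norm_Inertia_cfact.
Qed.

Lemma projective_pair_conj chi psi (m : gT) : GG chi -> MM psi -> m \in Mc ->
  projective_pair chi psi -> projective_pair (chi ^ m)%CF (psi ^ m)%CF.
Proof.
move=> GGchi MMpsi Mm [n [n' [P [P' [QP QP' [assP assP' [f [f' [repP repP' eqf]]] scalP] br]]]]].
have Jm := fintype.subsetP sMcJ m Mm; have [nG nM _ _] := norm_J Jm.
have Am := fintype.subsetP sJA m Jm.
have [Nchi Npsi] := (GG_char GGchi, MM_char MMpsi).
pose c := m^-1%g.
have [nGc nMc] : c \in 'N(G)%g /\ c \in 'N(M)%g by rewrite !groupV.
have memI (N K : {group gT}) (phi : 'CF(N)) (x : gT) : m \in 'N(N)%g -> m \in K ->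
    (x \in 'I_K[(phi ^ m)%CF]%g) = ((x ^ c)%g \in 'I_K[phi]%g).
  by move=> nN Km; rewrite -conjg_inertia // -mem_conjg conjIg (conjGid Km).
have assoc_conj (N K : {group gT}) (phi : 'CF(N)) d (R : gT -> 'M[algC]_d) :
    m \in 'N(N)%g -> m \in K -> proj_assoc 'I_K[phi]%G phi R ->
  proj_assoc 'I_K[(phi ^ m)%CF]%G (phi ^ m)%CF (fun x => R (x ^ c)%g).
  move=> nN Km [[rN rNE DrN] mulR].
  have nNc : c \in 'N(N)%g by rewrite groupV.
  have repc : mx_repr N (fun x => rN (x ^ c)%g).
    split=> [|x y Nx Ny]; first by rewrite conj1g repr_mx1.
    by rewrite conjMg (repr_mxM rN) ?memJ_norm.
  split; first exists (MxRepresentation repc).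
  - by move=> g Ng /=; rewrite rNE ?memJ_norm.
  - apply/cfun_inP=> x Nx; rewrite cfConjgE // -DrN !cfunE Nx.
    by rewrite memJ_norm ?Nx // groupV.
  move=> g x Ng; rewrite memI // => Ix; have Ngc : (g ^ c)%g \in N by rewrite memJ_norm.
  by rewrite !conjMg; apply: mulR.
have memA (x : gT) : (x \in 'I_A[(chi ^ m)%CF]%g) = ((x ^ c)%g \in 'I_A[chi]%g).
  exact: memI.
have memJ (x : gT) : (x \in 'I_J[(psi ^ m)%CF]%g) = ((x ^ c)%g \in 'I_J[psi]%g).
  exact: memI.
exists n, n', (fun x => P (x ^ c)%g), (fun x => P' (x ^ c)%g); split=> //.
  split; [exact: assoc_conj | exact: assoc_conj | | ].
    exists (fun x y => f (x ^ c)%g (y ^ c)%g), (fun x y => f' (x ^ c)%g (y ^ c)%g); split.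
    - have [uP fP] := repP; split=> [x | x y]; rewrite memA; first exact: uP.
      by move=> Ix; rewrite memA => Iy; rewrite fP // conjMg.
    - have [uP fP] := repP'; split=> [x | x y]; rewrite memJ; first exact: uP.
      by move=> Ix; rewrite memJ => Iy; rewrite fP // conjMg.
    by move=> x y; rewrite memJ => Ix; rewrite memJ => Iy; apply: eqf.
  move=> x /finset.setIP[]; rewrite memA => Ix cx; apply: scalP.
  rewrite finset.inE Ix memJ_norm //.
  exact: (fintype.subsetP (norms_cent (subxx 'N(G)%g)) c nGc).
move=> a Ja HHa fixa; pose a0 : gal_prod gT := ((m * a.1 * c)%g, a.2).
have Ja0 : a0.1 \in J by rewrite /= !groupM ?groupV.
have [_ nMa _ _] := norm_J Ja; have [_ nMa0 _ _] := norm_J Ja0.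
have fixa0 : cfact a0 psi = psi.
  apply: (can_inj (cfConjgK m)); rewrite -[in RHS]fixa.
  rewrite -[LHS]cfact_conj ?cfact_char // -[(psi ^ m)%CF]cfact_conj //.
  rewrite -(cfact_mulg (c := ((m * a.1)%g, a.2))) //= ?mulg1 ?mulgKV //.
  by apply: cfact_mulg; rewrite //= ?mul1g.
have [mu [mu' [brP brP' eqmu]]] := br a0 Ja0 HHa fixa0.
have br_conj (N K : {group gT}) (phi : 'CF(N)) d (R : gT -> 'M[algC]_d) nu :
    m \in 'N(N)%g -> m \in K -> is_proj_bracket 'I_K[phi]%G N R a0 nu ->
  is_proj_bracket 'I_K[(phi ^ m)%CF]%G N (fun x => R (x ^ c)%g) a (fun x => nu (x ^ c)%g).
  move=> nN Km [nz inv [T uT RT]]; have nNc : c \in 'N(N)%g by rewrite groupV.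
  split=> [x | x g | ]; first by rewrite memI //; apply: nz.
    rewrite memI // => Ix Ng; rewrite conjMg.
    by apply: inv => //; rewrite memJ_norm.
  exists T => // x; rewrite memI // => /RT <-; rewrite /proj_act /=.
  by rewrite -!conjgM !invMg mulKVg.
exists (fun x => mu (x ^ c)%g), (fun x => mu' (x ^ c)%g); split.
- exact: br_conj.
- exact: br_conj.
by move=> x; rewrite memJ => Ix; apply: eqmu.
Qed.

Lemma matched_projective_pair chi psi : matched chi psi -> projective_pair chi psi.
Proof.
move=> [chi0 [psi0 [m [M0 Mm -> ->]]]]; have [GG0chi MM0psi _] := M0.
apply: projective_pair_conj => //; [exact: GG0_sub | exact: MM0_sub |].
exact: matched0_projective_pair.
Qed.

Hypotheses (HH_inv : forall s, HH s -> HH s^-1%g)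
  (HH_mul : forall s t, HH s -> HH t -> HH (s * t)%g).

Lemma gec_groups_stab (sigma : 'CF(G)) (tau : 'CF(M)) :
    (forall x : gT, x \in J -> (x \in 'I[sigma]%g) = (x \in 'I[tau]%g)) ->
  gec_groups 'I_A[sigma]%G G 'I_J[tau]%G M.
Proof.
move=> eqI; have sGA := normal_sub (cf_nsGA cf).
have sMJ : M \subset J := fintype.subset_trans (normal_sub nsMMc) sMcJ.
have sHA : 'I_J[tau] \subset 'I_A[sigma].
  apply/fintype.subsetP=> x /finset.setIP[Jx Ix].
  by rewrite finset.inE (fintype.subsetP sJA) //= eqI.
have nsGI : G <| 'I_A[sigma] := normal_Inertia sigma sGA.
split=> //.
- apply/eqP; rewrite finset.eqEsubset mul_subG ?(normal_sub nsGI) // andbT.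
  apply/fintype.subsetP=> x /finset.setIP[Ax Ix].
  have [g [j [Gg Jj Dx]]] := cf_mem_A cf Ax; rewrite Dx mem_mulg //.
  have Ig : g \in 'I[sigma]%g := fintype.subsetP (sub_inertia sigma) g Gg.
  rewrite finset.inE Jj -eqI //=.
  by rewrite -(groupMl _ Ig) -Dx.
- apply/fintype.subsetP=> x /finset.setIP[/finset.setIP[Ax _] cx].
  have cMx : x \in 'C(M)%g := fintype.subsetP (centS (cf_sMG cf)) x cx.
  rewrite finset.inE (fintype.subsetP (cent_sub_inertia tau)) // andbT.
  rewrite [gval _](cf_J cf) finset.inE Ax.
  exact: (fintype.subsetP (cent_sub M)).
apply/eqP; rewrite finset.eqEsubset !finset.subsetI (cf_sMG cf) sMJ sub_inertia /=.
apply/fintype.subsetP=> x /finset.setIP[Gx /finset.setIP[Jx _]].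
by have : x \in G :&: J by [rewrite finset.inE Gx]; rewrite (cf_GM cf).
Qed.

Theorem matched_gec chi psi : matched chi psi ->
  gec 'I_A[chi]%G chi 'I_J[psi]%G psi /\
  gecH HH 'I_A[gal_orbit_sum HH chi]%G chi 'I_J[gal_orbit_sum HH psi]%G psi.
Proof.
move=> Mcp; have [GGchi MMpsi] := matched_GG Mcp.
have [irr_chi irr_psi] := (GG_irr GGchi, MM_irr MMpsi).
have [n [n' [P [P' [QP QP' gives br]]]]] := matched_projective_pair Mcp.
have sGA := normal_sub (cf_nsGA cf).
have sMJ : M \subset J := fintype.subset_trans (normal_sub nsMMc) sMcJ.
have grp : gec_groups 'I_A[chi]%G G 'I_J[psi]%G M.
  apply: gec_groups_stab => x Jx; have [nG nM _ _] := norm_J Jx.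
  rewrite [x \in 'I[chi]%g]finset.inE [x \in 'I[psi]%g]finset.inE nG nM /=; have E' := matched_stab_J Mcp Jx.
  by apply/eqP/eqP => /E'.
have grpH : gec_groups 'I_A[gal_orbit_sum HH chi]%G G 'I_J[gal_orbit_sum HH psi]%G M.
  apply: gec_groups_stab => x Jx; have [nG nM _ _] := norm_J Jx.
  have stG := gal_sum_stab HH_one HH_inv HH_mul irr_chi nG.
  have stM := gal_sum_stab HH_one HH_inv HH_mul irr_psi nM.
  apply/idP/idP => [/stG[s HHs fix_s] | /stM[s HHs fix_s]].
    by apply/stM; exists s => //; apply/(matched_stab (a := (x, s)) Mcp).
  by apply/stG; exists s => //; apply/(matched_stab (a := (x, s)) Mcp).
have triples : gec_triples 'I_A[chi]%G chi 'I_J[psi]%G psi.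
  by split=> //; apply: finset.subsetIr.
have InnerI (N K : {group gT}) (phi : 'CF(N)) : phi \in irr N ->
    'I_('I_K[gal_orbit_sum HH phi]%G)[phi]%G = 'I_K[phi]%G.
  move=> irr_phi; apply: val_inj => /=.
  rewrite -finset.setIA; congr (_ :&: _).
  by apply/finset.setIidPr; apply: inertia_gal_sum.
split; first by split=> //; exists n, n', P, P'.
split=> //.
- by split=> //; [apply: normal_Inertia | apply: finset.subsetIr].
- by split=> //; [apply: normal_Inertia | apply: finset.subsetIr].
- by move=> a [/finset.setIP[Ja _] HHa]; apply: matched_stab.
rewrite !InnerI //; split=> //; exists n, n', P, P'; split=> //.
- by move=> x _; apply/mxOverP=> i j; apply: QP.
- by move=> x _; apply/mxOverP=> i j; apply: QP'.
move=> a [/finset.setIP[Ja _] HHa] fixa; have [mu [mu' [b1 b2 b3]]] := br a Ja HHa fixa.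
exists mu, mu'; split=> // x /finset.setIP[/finset.setIP[Jx _] Ix]; apply: b3.
by rewrite finset.inE Jx.
Qed.

Theorem correspondence : exists Om : 'CF(G) -> 'CF(M),
  [/\ set_bij GG MM Om,
      forall (a : gal_prod gT) (chi : 'CF(G)), a.1 \in J -> HH a.2 -> GG chi ->
        Om (cfact a chi) = cfact a (Om chi)
    & forall chi, GG chi -> gec 'I_A[chi]%G chi 'I_J[Om chi]%G (Om chi) /\
        gecH HH 'I_A[gal_orbit_sum HH chi]%G chi
                'I_J[gal_orbit_sum HH (Om chi)]%G (Om chi)].
Proof.
have [chi | Om OmP] := @choice _ _ (fun chi psi => GG chi -> matched chi psi).
  have [GGchi | nGGchi] := pselect (GG chi); last by exists 0 => /nGGchi.
  by have [psi Mcp] := matched_total GGchi; exists psi.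
exists Om; split.
- split=> [chi /OmP/matched_GG[]// | chi chi' | psi MMpsi].
    rewrite !inE => /OmP M1 /OmP M2 E'; rewrite -E' in M2.
    exact: matched_inj M2 M1.
  have [chi Mcp] := matched_surj MMpsi; have [GGchi _] := matched_GG Mcp.
  by exists chi => //; apply: matched_fun Mcp (OmP _ GGchi).
- move=> a chi Ja HHa GGchi; have Ma := matched_act (OmP _ GGchi) Ja HHa.
  have [GGa _] := matched_GG Ma; exact: matched_fun Ma (OmP _ GGa).
by move=> chi /OmP/matched_gec.
Qed.

End Correspondence.

(* All groups live in the ambient gT; A is the semidirect product of Gc by E  *)
(* and GE is the product G E.  The suffixes c and h stand for the accents     *)
(* check and hat. Since Mh normalizes Mc, Mc <*> Mh is the product Mc Mh.     *)
Theorem corollary3p5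
  (gT : finGroupType) (ell : nat) (G Q M : {group gT})
  (HH : set galQab) (GG : set 'CF(G)) (MM : set 'CF(M))
  (Gc E A GE Mc Mh : {group gT})
  (GG0 : set 'CF(G)) (MM0 : set 'CF(M))
  (Phi_glo : forall chi : 'CF(G), 'CF('I_GE[chi]))
  (Phi_loc : forall psi : 'CF(M), 'CF('I_Mh[psi]))
  (B : set (gal_prod gT))
  (GGc : set 'CF(Gc)) (MMc : set 'CF(Mc)) (Omc : 'CF(Gc) -> 'CF(Mc))
  (ell_prime : prime ell) (ell_dvd : (ell %| #|G|)%N)
  (sylQ : ell.-Sylow(G) Q) (properM : M \proper G)
  (subgroup_HH : subgroup HH)
  (GG_irr : GG `<=` [set chi | chi \in irr G])
  (MM_irr : MM `<=` [set psi | psi \in irr M])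
  (* (i) *)
  (defA : Gc ><| E = A)
  (defGE : GE :=: (G <*> E)%g)
  (defMc : Mc :=: 'N_Gc(M)%g)
  (defMh : Mh :=: 'N_GE(M)%g)
  (nGGc : G <| Gc) (abGc : abelian (Gc / G)%g)
  (centG : 'C_A(G)%g = ('Z(Gc) * 'C_E(G))%g)
  (nGA : G <| A)
  (GG_stable : gal_stable (dprod_set Mc HH) GG)
  (MM_stable : gal_stable (dprod_set Mc HH) MM)
  (* (ii) *)
  (M_stable : 'N_A(Q)%g \subset 'N(M)%g)
  (sNQM : 'N_G(Q)%g \subset M)
  (* (iii) *)
  (maxext_glo : maximal_extendibility Gc GG)
  (maxext_loc : maximal_extendibility Mc MM)
  (* (iv) *)
  (GG0_transversal : transversal_in Mc GG GG0)
  (MM0_transversal : transversal_in Mc MM MM0)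
  (GG0_stable : conj_stable Mh GG0)
  (MM0_stable : conj_stable Mh MM0)
  (Phi_glo_ext : extension_map GG0 Phi_glo)
  (Phi_loc_ext : extension_map MM0 Phi_loc)
  (Phi_glo_equiv : equivariant_extension_map Mh GG0 Phi_glo)
  (Phi_loc_equiv : equivariant_extension_map Mh MM0 Phi_loc)
  (Phi_central : forall chi psi, GG0 chi -> MM0 psi ->
     Irr_under 'C_E(G)%G (Phi_glo chi) = Irr_under 'C_E(G)%G (Phi_loc psi))
  (* (v) *)
  (subgroup_B : subgroup B)
  (sBA : B `<=` dprod_set A HH)
  (defNB : mul_set 'N_A(Q)%g B = dprod_set 'N_A(Q)%g HH)
  (B_GG0 : gal_stable B GG0) (B_MM0 : gal_stable B MM0)
  (* (vi) *)
  (defGGc : GGc = Irr_over Gc GG) (defMMc : MMc = Irr_over Mc MM)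
  (Omc_bij : set_bij GGc MMc Omc)
  (Omc_lin : forall (lambda : 'CF(Gc)) (mu : 'CF(Mc)) (theta : 'CF(Gc)),
     lambda \is a linear_char -> G \subset cfker lambda ->
     mu \is a linear_char -> M \subset cfker mu ->
     'Res[Mc] lambda = mu -> GGc theta ->
     Omc (lambda * theta) = mu * Omc theta)
  (Omc_equiv : forall (a : gal_prod gT) (theta : 'CF(Gc)),
     mul_set Mh B a -> GGc theta -> Omc (cfact a theta) = cfact a (Omc theta))
  (Omc_central : forall nu : 'CF('Z(Gc)), nu \in irr 'Z(Gc) ->
     Omc @` (GGc `&` Irr_over Gc [set nu]) = MMc `&` Irr_over Mc [set nu])
  (* (vii) *)
  (B_normalizes : forall b, B b -> b.1 \in 'N(Mh)%g)
  (Phi_bracket : forall (chi : 'CF(G)) (psi : 'CF(M)) (a : gal_prod gT),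
     GG0 chi -> MM0 psi ->
     Omc @` Irr_over Gc [set chi] = Irr_over Mc [set psi] ->
     mul_set Mh B a -> cfact a psi = psi ->
     'Res['I_Mh[chi]] (ext_bracket G (Phi_glo chi) a)
       =1 ext_bracket M (Phi_loc psi) a) :
  exists Om : 'CF(G) -> 'CF(M),
    [/\ set_bij GG MM Om,
        forall (a : gal_prod gT) (chi : 'CF(G)),
          dprod_set (Mh <*> Mc)%g HH a -> GG chi ->
          Om (cfact a chi) = cfact a (Om chi)
      & forall chi, GG chi ->
          let psi := Om chi in
          gec 'I_A[chi]%G chi 'I_(Mc <*> Mh)[psi]%G psi /\
          gecH HH 'I_A[gal_orbit_sum HH chi]%G chi
                  'I_(Mc <*> Mh)[gal_orbit_sum HH psi]%G psi].
Proof.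
have cf := configurationP sylQ properM defA defGE defMc defMh nGGc nGA M_stable sNQM.
have sQJ : 'N_A(Q)%g \subset (Mc <*> Mh)%g.
  by rewrite [(_ <*> _)%g](cf_J cf) finset.subsetI finset.subsetIl.
have [HH1 HHB] := subgroup_HH; have [B1 BB] := subgroup_B.
have inHH s : (s \in [pred x | x \in HH]) -> HH s by rewrite !inE.
have HHin s : HH s -> (s \in [pred x | x \in HH]) by rewrite !inE.
have inB b : (b \in [pred x | x \in B]) -> B b by rewrite !inE.
have Bin b : B b -> (b \in [pred x | x \in B]) by rewrite !inE.
have HH_one : HH 1%g by apply: inHH.
have HH_inv s : HH s -> HH s^-1%g.
  by move=> HHs; rewrite -[s^-1%g]mul1g; apply: inHH; apply: HHB; apply: HHin.
have HH_mul s t : HH s -> HH t -> HH (s * t)%g.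
  move=> HHs HHt; rewrite -[t]invgK; apply: inHH; apply: HHB; apply: HHin => //.
  exact: HH_inv.
have B_one : B (1%g, 1%g) by apply: inB.
have B_inv b : B b -> exists b', [/\ B b', b'.1 = b.1^-1%g & b'.2 = b.2^-1%g].
  move=> Bb; exists ((1 : gal_prod gT) * b^-1)%g.
  split; first by apply/inB/BB; apply: Bin.
    by rewrite /= mul1g.
  by rewrite /= mul1g.
have BNQ b : B b -> b.1 \in 'N_A(Q)%g.
  move=> Bb; have : dprod_set 'N_A(Q)%g HH b.
    rewrite -defNB; exists 1%g => //; exists b => //.
    by case: b {Bb} => x s; congr (_, _); rewrite mul1g.
  by case.
have B_J b : B b -> b.1 \in (Mc <*> Mh)%G by move/BNQ; apply: (fintype.subsetP sQJ).
have factor_MhB (a : gal_prod gT) : a.1 \in (Mc <*> Mh)%G -> HH a.2 ->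
    exists (m : gT) (a' : gal_prod gT),
    [/\ m \in Mc, mul_set Mh B a', a.1 = (m * a'.1)%g & a.2 = a'.2].
  move=> Ja HHa; have : dprod_set 'N_A(Q)%g HH (1%g, a.2) by split; rewrite /= ?group1.
  (* (1, a.2) = (q, 1) b with q normalizing Q, and a.1 * q is a product m y. *)
  rewrite -defNB => -[q NQq [b Bb Db]].
  have Db1 : (1 = q * b.1)%g := congr1 fst Db.
  have Db2 : a.2 = (1 * b.2)%g := congr1 snd Db.
  have Jq : q \in (Mc <*> Mh)%G := fintype.subsetP sQJ q NQq.
  have [m [y [Mm My Dm]]] := cf_mem_J cf (groupM Ja Jq).
  exists m, ((y, 1%g) * b : gal_prod gT)%g; split=> //=; first by exists y => //; exists b.
  by rewrite mulgA -Dm -mulgA -Db1 mulg1.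
have GG_conj : conj_stable Mc GG.
  move=> m chi Mm GGchi; rewrite -cfact_conj ?irrWchar ?GG_irr //.
  by apply: GG_stable.
have MM_conj : conj_stable Mc MM.
  move=> m psi Mm MMpsi; rewrite -cfact_conj ?irrWchar ?MM_irr //.
  by apply: MM_stable.
have [Om [bijOm eqOm gecOm]] := correspondence cf abGc B_one B_inv B_J B_normalizes
  factor_MhB GG_irr MM_irr maxext_glo maxext_loc GG0_transversal MM0_transversal
  GG0_stable MM0_stable B_GG0 B_MM0 defGGc defMMc Omc_bij Omc_lin Omc_equiv
  GG_conj MM_conj HH_one Phi_glo_ext Phi_loc_ext Phi_central centG Omc_central
  Phi_bracket HH_inv HH_mul.
exists Om; split=> // a chi [Ja HHa] GGchi.
by apply: eqOm => //; rewrite /= joingC.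
Qed.
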